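(* Let $E\subset\mathbb{R}^N$ be open, $p>1$ and $\gamma>0$. (i) Let $\varphi:\mathbb{R}\to\mathbb{R}$ be convex and non-decreasing, and let $u\in[DG]_p^+(E;\gamma)$. There exists a positive constant $\overline{\gamma}$, depending only on $\{p,\gamma,N\}$ and independent of $u$, such that $\varphi(u)\in[GDG]_p^+(E;\overline{\gamma})$. (ii) Likewise, let $\psi:\mathbb{R}\to\mathbb{R}$ be concave and non-decreasing, and let $u\in[DG]_p^-(E;\gamma)$. There exists a positive constant $\overline{\gamma}$, depending only on $\{p,\gamma,N\}$ and independent of $u$, such that $\psi(u)\in[GDG]_p^-(E;\overline{\gamma})$.
   Context: For $y\in\mathbb{R}^N$ and $\rho>0$, $K_\rho(y)$ denotes the (axis-parallel) cube of edge $2\rho$ centered at $y$. Pairs of cubes $K_\rho(y)\subset K_R(y)$ have $0<\rho<R$. For a function $w$, $w_+=\max\{w,0\}$ and $w_-=\max\{-w,0\}$; $D$ denotes the weak gradient. DeGiorgi classes: for $p>1$ and a constant $\gamma>0$, $[DG]_p^{\pm}(E;\gamma)$ is the collection of functions $u\in W^{1,p}_{\mathrm{loc}}(E)$ such that $$\int_{K_\rho(y)}|D(u-k)_\pm|^p\,dx\le\frac{\gamma}{(R-\rho)^p}\int_{K_R(y)}|(u-k)_\pm|^p\,dx$$ for all cubes $K_\rho(y)\subset K_R(y)\subset E$ and all $k\in\mathbb{R}$ (upper signs for $[DG]_p^+$, lower signs for $[DG]_p^-$). Generalized DeGiorgi classes: $[GDG]_p^{\pm}(E;\gamma)$ is the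 collection of functions $u\in W^{1,p}_{\mathrm{loc}}(E)$ such that $$\int_{K_\rho(y)}|D(u-k)_\pm|^p\,dx\le\frac{\gamma}{(R-\rho)^p}\Big(\frac{R}{R-\rho}\Big)^{Np}\int_{K_R(y)}|(u-k)_\pm|^p\,dx$$ for all cubes $K_\rho(y)\subset K_R(y)\subset E$ and all $k\in\mathbb{R}$. *)

(* Defs.v *)
From HB Require Import structures.
From mathcomp Require Import all_boot all_order all_algebra.
From mathcomp Require Import all_classical all_reals all_analysis.
Set Implicit Arguments.
Unset Strict Implicit.
Unset Printing Implicit Defensive.
Import Order.TTheory GRing.Theory Num.Theory.
Import numFieldNormedType.Exports.
Local Open Scope classical_set_scope.
Local Open Scope convex_scope.
Local Open Scope ring_scope.

(** R^n is ['rV[R]_n].  MathComp-Analysis gives it a topology and a norm (the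
    sup norm), but neither a sigma-algebra nor a Lebesgue measure. *)

Definition measure_rV_display : measure_display.
Proof. exact: default_measure_display. Qed.

Definition rV_coord {R : realType} {n : nat} (i : 'I_n) (x : 'rV[R]_n) : R :=
  x ord0 i.

Lemma measurable_rV0 (R : realType) (n : nat) :
  g_sigma_preimage (@rV_coord R n) set0.
Proof. exact: sigma_algebra0. Qed.

Lemma measurable_rVC (R : realType) (n : nat) (A : set 'rV[R]_n) :
  g_sigma_preimage rV_coord A -> g_sigma_preimage rV_coord (~` A).
Proof. exact: sigma_algebraC. Qed.

Lemma measurable_rV_bigcup (R : realType) (n : nat) (F : (set 'rV[R]_n)^nat) :
  (forall i, g_sigma_preimage rV_coord (F i)) ->
  g_sigma_preimage rV_coord (\bigcup_i F i).
Proof. exact: sigma_algebra_bigcup. Qed.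

(** The product of the Borel sigma-algebras, i.e. the Borel sigma-algebra. *)
HB.instance Definition _ (R : realType) (n : nat) :=
  @isMeasurable.Build measure_rV_display 'rV[R]_n
    (g_sigma_preimage (@rV_coord R n)) (@measurable_rV0 R n)
    (@measurable_rVC R n) (@measurable_rV_bigcup R n).

Lemma measurable_rV_coord (R : realType) (n : nat) (i : 'I_n) :
  measurable_fun [set: 'rV[R]_n] (@rV_coord R n i).
Proof.
move=> _ Y mY; rewrite setTI; apply: sub_sigma_algebra => /=.
rewrite -bigcup_seq/=; exists i => /=; first by rewrite mem_index_enum.
by exists Y => //; rewrite setTI.
Qed.

Lemma measurable_fun_rV (d : measure_display) (T : measurableType d)
    (R : realType) (n : nat) (f : T -> 'rV[R]_n) :
  (forall i, measurable_fun setT (fun x => f x ord0 i)) ->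
  measurable_fun setT f.
Proof.
move=> mf; pose G := \big[setU/set0]_(i < n)
  preimage_set_system setT (@rV_coord R n i) measurable.
apply: (@measurability _ _ _ _ _ _ G) => // _ [A + <-].
rewrite /G -bigcup_seq => -[i _ [B mB <-]].
by rewrite setTI; apply: mf.
Qed.

Definition rV_cons {R : realType} {n : nat} (z : R * 'rV[R]_n) : 'rV[R]_n.+1 :=
  \row_i if unlift ord0 i is Some j then z.2 ord0 j else z.1.

Definition rV_uncons {R : realType} {n : nat} (x : 'rV[R]_n.+1) :
    R * 'rV[R]_n :=
  (x ord0 ord0, \row_j x ord0 (lift ord0 j)).

Lemma rV_consK (R : realType) (n : nat) :
  cancel (@rV_cons R n) (@rV_uncons R n).
Proof.
move=> [a v]; rewrite /rV_cons /rV_uncons; congr (_, _).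
  by rewrite mxE unlift_none.
by apply/rowP => j; rewrite !mxE liftK.
Qed.

Lemma measurable_rV_cons (R : realType) (n : nat) :
  measurable_fun setT (@rV_cons R n).
Proof.
apply: measurable_fun_rV => i; rewrite /rV_cons.
case: (unliftP ord0 i) => [j|] ->.
- rewrite (_ : (fun _ => _) = rV_coord j \o snd); last first.
    by apply/funext => z; rewrite mxE liftK.
  by apply: measurableT_comp; [exact: measurable_rV_coord|].
- rewrite (_ : (fun _ => _) = fst); first exact: measurable_fst.
  by apply/funext => z; rewrite mxE unlift_none.
Qed.

Lemma measurable_rV_uncons (R : realType) (n : nat) :
  measurable_fun setT (@rV_uncons R n).
Proof.
apply/measurable_fun_pairP; split; first exact: measurable_rV_coord.
apply: measurable_fun_rV => j.
rewrite (_ : (fun _ => _) = rV_coord (lift ord0 j)).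
  exact: measurable_rV_coord.
by apply/funext => x; rewrite /= mxE.
Qed.

Section lebesgue_rV_step.
Context (R : realType) (n : nat).
Variable m : {sigma_finite_measure set 'rV[R]_n -> \bar R}.

Definition lebesgue_rV_step : set 'rV[R]_n.+1 -> \bar R :=
  pushforward (@lebesgue_measure R \x m)%E rV_cons.

HB.instance Definition _ := Measure.copy lebesgue_rV_step
  (measure_function_pushforward__canonical__measure_function_Measure
    (@lebesgue_measure R \x m)%E (@measurable_rV_cons R n)).

Lemma lebesgue_rV_step_sigma_finite : sigma_finite setT lebesgue_rV_step.
Proof.
have /= [F FT Foo] := isSigmaFinite.sigma_finiteT
  (lebesgue_integral_fubini.measure_function_Measure_isSigmaFinite__to__measure_function_isSigmaFinite
     (@lebesgue_measure R) m).
exists (fun k => rV_uncons @^-1` F k) => [|k].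
  by rewrite -preimage_bigcup -FT preimage_setT.
have [mF ?] := Foo k; split.
  by rewrite -[X in measurable X]setTI; exact: measurable_rV_uncons.
rewrite /lebesgue_rV_step /pushforward -comp_preimage.
rewrite (_ : rV_uncons \o rV_cons = id) ?preimage_id//.
by apply/funext => z; exact: rV_consK.
Qed.

HB.instance Definition _ := @Measure_isSigmaFinite.Build _ _ _
  lebesgue_rV_step lebesgue_rV_step_sigma_finite.
End lebesgue_rV_step.

(** Lebesgue measure on R^n: the point mass on R^0, then iterated products. *)
Fixpoint lebesgue_rV (R : realType) (n : nat) :
    {sigma_finite_measure set 'rV[R]_n -> \bar R} :=
  match n with
  | 0%N => \d_ (0 : 'rV[R]_0)
  | n'.+1 => lebesgue_rV_step (lebesgue_rV R n')
  end.
Arguments lebesgue_rV {R n}.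

Lemma lebesgue_rV_rect (R : realType) (n : nat) (A : 'I_n -> set R) :
  (forall i, measurable (A i)) ->
  lebesgue_rV [set x : 'rV[R]_n | forall i, A i (x ord0 i)] =
  (\prod_(i < n) lebesgue_measure (A i))%E.
Proof.
elim: n A => [|n IH] A mA /=.
  by rewrite big_ord0 diracE mem_set// => -[].
rewrite /lebesgue_rV_step /pushforward big_ord_recl.
rewrite -(IH (fun i => A (lift ord0 i)))//.
rewrite -product_measure1E//; last first.
  rewrite (_ : mkset _ = \big[setI/setT]_(i < n)
     (rV_coord i @^-1` A (lift ord0 i))); last first.
    by rewrite -bigcap_seq; apply/seteqP; split=> [x /= Ax i _|x /= Ax i];
      apply: Ax; rewrite //= mem_index_enum.
  apply: bigsetI_measurable => i _.
  by rewrite -[X in measurable X]setTI; exact: measurable_rV_coord.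
  exact: (mA ord0).
congr (_ _); apply/seteqP.
split=> [[a v]/= Aav|[a v]/= [Aa Av] i].
- split=> [|i]; first by have := Aav ord0; rewrite mxE unlift_none.
  by have := Aav (lift ord0 i); rewrite mxE liftK.
- by rewrite mxE; case: unliftP => [j|] ->.
Qed.

(** The open cube of edge [2 * rho]; closed cubes define the same classes, by
    monotone convergence. *)
Definition cube {R : realType} {N : nat} (y : 'rV[R]_N) (rho : R) :
    set 'rV[R]_N :=
  [set x | forall i, `|x ord0 i - y ord0 i| < rho].

Definition enorm {R : realType} {N : nat} (v : 'rV[R]_N) : R :=
  Num.sqrt (\sum_i v ord0 i ^+ 2).

Definition partial {R : realType} {N : nat} (i : 'I_N) (f : 'rV[R]_N -> R) :
    'rV[R]_N -> R :=
  fun x => 'D_(delta_mx ord0 i) f x.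

Fixpoint Ck {R : realType} {N : nat} (k : nat) (f : 'rV[R]_N -> R) : Prop :=
  match k with
  | 0%N => continuous f
  | k'.+1 => continuous f /\
      forall i, (forall x, derivable f x (delta_mx ord0 i)) /\
        Ck k' (partial i f)
  end.

Definition test_function {R : realType} {N : nat} (E : set 'rV[R]_N)
    (zeta : 'rV[R]_N -> R) : Prop :=
  (forall k, Ck k zeta) /\
  exists K, [/\ compact K, K `<=` E & forall x, ~ K x -> zeta x = 0].

(** Functions on [E] are total functions whose values off [E] are irrelevant;
    Lebesgue classes are handled through Borel representatives. *)
Definition Lp_loc {R : realType} {N : nat} (E : set 'rV[R]_N) (p : R)
    (f : 'rV[R]_N -> R) : Prop :=
  measurable_fun E f /\
  forall K, compact K -> K `<=` E ->
    (\int[lebesgue_rV]_(x in K) (`|f x| `^ p)%:E < +oo)%E.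

Definition weak_gradient {R : realType} {N : nat} (E : set 'rV[R]_N)
    (u : 'rV[R]_N -> R) (Du : 'rV[R]_N -> 'rV[R]_N) : Prop :=
  [/\ Lp_loc E 1 u,
      forall i, Lp_loc E 1 (fun x => Du x ord0 i) &
      forall zeta, test_function E zeta -> forall i,
        (\int[lebesgue_rV]_(x in E) (u x * partial i zeta x)%:E =
         - \int[lebesgue_rV]_(x in E) (Du x ord0 i * zeta x)%:E)%E].

Definition W1p_loc {R : realType} {N : nat} (E : set 'rV[R]_N) (p : R)
    (u : 'rV[R]_N -> R) : Prop :=
  Lp_loc E p u /\
  exists2 Du, weak_gradient E u Du &
    forall i, Lp_loc E p (fun x => Du x ord0 i).

(** [w] has a weak gradient [Dw] in [E] (determined up to a null set) and
    [\int_(K_r(y)) |Dw|^p <= c r s * \int_(K_s(y)) |w|^p] for all concentric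
    cubes [K_r(y)], [K_s(y)] with [r < s] and [K_s(y)] included in [E].  The
    integrals are extended-real valued, as a cube may touch the boundary of
    [E]. *)
Definition energy_estimate {R : realType} {N : nat} (E : set 'rV[R]_N) (p : R)
    (c : R -> R -> R) (w : 'rV[R]_N -> R) : Prop :=
  exists2 Dw, weak_gradient E w Dw &
    forall (y : 'rV[R]_N) (r s : R), 0 < r -> r < s -> cube y s `<=` E ->
      (\int[lebesgue_rV]_(x in cube y r) (enorm (Dw x) `^ p)%:E <=
       (c r s)%:E * \int[lebesgue_rV]_(x in cube y s) (`|w x| `^ p)%:E)%E.

Definition DG_const {R : realType} (p gamma r s : R) : R :=
  gamma / (s - r) `^ p.

Definition GDG_const {R : realType} (N : nat) (p gamma r s : R) : R :=
  gamma / (s - r) `^ p * (s / (s - r)) `^ (N%:R * p).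

Definition DG_plus {R : realType} {N : nat} (E : set 'rV[R]_N) (p gamma : R)
    (u : 'rV[R]_N -> R) : Prop :=
  W1p_loc E p u /\
  forall k : R, energy_estimate E p (DG_const p gamma) (fun x => u x - k)^\+.

Definition DG_minus {R : realType} {N : nat} (E : set 'rV[R]_N) (p gamma : R)
    (u : 'rV[R]_N -> R) : Prop :=
  W1p_loc E p u /\
  forall k : R, energy_estimate E p (DG_const p gamma) (fun x => u x - k)^\-.

Definition GDG_plus {R : realType} {N : nat} (E : set 'rV[R]_N) (p gamma : R)
    (u : 'rV[R]_N -> R) : Prop :=
  W1p_loc E p u /\
  forall k : R,
    energy_estimate E p (GDG_const N p gamma) (fun x => u x - k)^\+.

Definition GDG_minus {R : realType} {N : nat} (E : set 'rV[R]_N) (p gamma : R)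
    (u : 'rV[R]_N -> R) : Prop :=
  W1p_loc E p u /\
  forall k : R,
    energy_estimate E p (GDG_const N p gamma) (fun x => u x - k)^\-.

Definition concave_function {R : realType}
    (psi : convex_lmodType R^o -> R^o) : Prop :=
  forall (t : {i01 R}) (x y : convex_lmodType R^o),
    (psi x : convex_lmodType R^o) <| t |> psi y <= psi (x <| t |> y).

(* Main.v *)
From HB Require Import structures.
Require Import Defs.
From mathcomp Require Import all_boot all_order all_algebra.
From mathcomp Require Import all_classical all_reals all_analysis measurable_realfun.
From mathcomp Require Import ring lra.
Set Implicit Arguments.
Unset Strict Implicit.
Unset Printing Implicit Defensive.
Import Order.TTheory GRing.Theory Num.Theory.
Import numFieldNormedType.Exports.
Local Open Scope classical_set_scope.
Local Open Scope ring_scope.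

(** A non-negative, non-decreasing convex function is a superposition of the
    functions [v |-> (v - k)^\+], and each [(u - k)^\+] obeys the energy estimate
    of the De Giorgi class.  The proof adds up these estimates.

    Let [phi] be convex with slopes [a] ([subgradient]), [h] a level and
    [Phi v = (phi v - h)^\+] with slopes [b].  The gradient of [Phi (u)] is
    [b (u) Du] ([weak_gradient_convex]), and that of [(u - k)^\+] is [Du] on the set
    [k <= u], so that the class controls the integral of [|Du|^p] over the
    superlevel sets of [u] ([level_energy]).  The range of [b] is cut at the dyadic
    heights [c 2^i].  As [b] is non-decreasing, [b (u)] exceeds [c 2^i] only where
    [u] is above some [k_i], and [b^p] is at most [c^p] plus the sum of
    [(2 c 2^i)^p] over the heights exceeded ([powR_dyadic]).  On the other hand the
    sum of the functions [(c 2^i / 2) (v - k_i)^\+] remains below [Phi]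
    ([sum_steep_part_le]), and the sum of the [p]-th powers is at most the [p]-th
    power of the sum.  Letting [c] tend to zero gives the energy estimate for
    [Phi (u)] with the constant [4^p gamma] ([energy_subgradient]).  The factor
    [(s / (s - r))^(N p)] of the generalized class is at least [1]
    ([DG_GDG_const]).  The concave case is the convex one for [- u] and
    [v |-> - psi (- v)].

    Two analytic facts support this.  Functions of the class are locally bounded
    above ([local_bound]): this makes the number of dyadic heights finite and puts
    [phi (u)] in the Sobolev space.  It is De Giorgi's iteration, whose step
    combines the energy estimate with a Faber-Krahn inequality ([faber_krahn]).
    The chain rule avoids mollification: a function is weakly differentiable iff
    its difference quotients converge in [L^1] on compact sets ([weak_gradient_L1],
    [L1_weak_gradient]), and the slopes of a convex function squeeze its increments
    ([L1_chain_rule]).  The source of both facts is that increments of a weakly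
    differentiable function are line integrals of its gradient
    ([weak_increment]). *)

(** * Boxes, Borel sets and Lebesgue measure *)

Definition obox {R : realType} {N : nat} (a b : 'rV[R]_N) : set 'rV[R]_N :=
  [set x | forall i, a ord0 i < x ord0 i < b ord0 i].

Lemma measurable_rV_rect (R : realType) (N : nat) (A : 'I_N -> set R) :
  (forall i, measurable (A i)) ->
  measurable [set x : 'rV[R]_N | forall i, A i (x ord0 i)].
Proof.
move=> mA.
rewrite (_ : mkset _ = \big[setI/setT]_(i < N) (rV_coord i @^-1` A i)).
  apply: bigsetI_measurable => i _.
  by rewrite -[X in measurable X]setTI; exact: measurable_rV_coord.
by rewrite -bigcap_seq; apply/seteqP; split=> [x /= Ax i _|x /= Ax i];
  apply: Ax; rewrite //= mem_index_enum.
Qed.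

Lemma oboxE (R : realType) (N : nat) (a b : 'rV[R]_N) :
  obox a b = [set x | forall i, `]a ord0 i, b ord0 i[%classic (x ord0 i)].
Proof. by apply/seteqP; split=> x xab i; have := xab i; rewrite /= in_itv. Qed.

Lemma measurable_obox (R : realType) (N : nat) (a b : 'rV[R]_N) :
  measurable (obox a b).
Proof. by rewrite oboxE; apply: (@measurable_rV_rect _ _ (fun i => `]a ord0 i, b ord0 i[%classic)). Qed.

Lemma lebesgue_obox (R : realType) (N : nat) (a b : 'rV[R]_N) :
  lebesgue_rV (obox a b) =
  (\prod_(i < N) Num.max 0 (b ord0 i - a ord0 i))%:E.
Proof.
rewrite oboxE (@lebesgue_rV_rect R N (fun i => `]a ord0 i, b ord0 i[%classic))//.
rewrite -prodEFin; apply: eq_bigr => i _.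
rewrite lebesgue_measure_itv/= lte_fin; case: ltP => ab.
  by rewrite max_r ?subr_ge0 ?ltW// EFinB.
by rewrite max_l// subr_le0.
Qed.

Lemma obox_ball (R : realType) (N : nat) (x : 'rV[R]_N) (e : R) : 0 < e ->
  ball x e = obox (x - const_mx e) (x + const_mx e).
Proof.
move=> e0; apply/seteqP; split=> y /=.
  move=> [_ xy] i; have := xy ord0 i; rewrite /ball/= !mxE ltr_distlC.
  by [].
move=> yb; split=> // i j; rewrite (ord1 i) /ball/= ltr_distlC.
by have := yb j; rewrite !mxE.
Qed.

Section obox_generates.
Context (R : realType) (N : nat).
Let G := [set A | exists a b : 'rV[R]_N, A = obox a b].

(** An open set is the union of the countably many rational boxes inside it. *)
Lemma open_sigma_obox (U : set 'rV[R]_N) : open U -> <<s G >> U.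
Proof.
move=> oU.
pose r (q : 'rV[rat]_N) : 'rV[R]_N := map_mx ratr q.
pose F (z : 'rV[rat]_N * 'rV[rat]_N) :=
  if `[< obox (r z.1) (r z.2) `<=` U >] then obox (r z.1) (r z.2) else set0.
rewrite (_ : U = \bigcup_k (if unpickle k is Some z then F z else set0)).
  apply: sigma_algebra_bigcup => k; case: unpickle => [z|]; last exact: sigma_algebra0.
  rewrite /F; case: ifP => _; last exact: sigma_algebra0.
  by apply: sub_sigma_algebra; eexists; eexists.
apply/seteqP; split=> x.
  move=> Ux; have [e /= e0 xeU] : exists2 e : R, 0 < e & ball x e `<=` U.
    by have /nbhs_ballP[e] := open_nbhs_nbhs (conj oU Ux); exists e.
  have /choice[q1 q1P] i : exists q : rat, x ord0 i - e < ratr q < x ord0 i.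
    have [|q] := @rat_in_itvoo R (x ord0 i - e) (x ord0 i); first by rewrite ltrBlDr ltrDl.
    by rewrite in_itv/= => ?; exists q.
  have /choice[q2 q2P] i : exists q : rat, x ord0 i < ratr q < x ord0 i + e.
    have [|q] := @rat_in_itvoo R (x ord0 i) (x ord0 i + e); first by rewrite ltrDl.
    by rewrite in_itv/= => ?; exists q.
  exists (pickle (\row_i q1 i, \row_i q2 i)) => //; rewrite pickleK /F.
  rewrite asboolT; last first.
    apply: subset_trans xeU; rewrite obox_ball// => y /= yq i.
    have := yq i; rewrite !mxE => /andP[y1 y2].
    have /andP[u1 u2] := q1P i; have /andP[v1 v2] := q2P i.
    by rewrite (lt_trans u1)// (lt_trans y2).
  move=> i; rewrite !mxE; have /andP[u1 u2] := q1P i; have /andP[v1 v2] := q2P i.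
  by rewrite u2.
case=> k _; case: unpickle => [z|] //.
by rewrite /F; case: ifPn => [/asboolP|_]; first exact.
Qed.

(** Boxes are stable under intersection, so this makes them available for Dynkin
    induction. *)
Lemma measurable_rV_oboxE : @measurable _ 'rV[R]_N = <<s G >>.
Proof.
apply/seteqP; split=> A.
  move: A; apply: smallest_sub; first exact: smallest_sigma_algebra.
  rewrite -bigcup_seq => _ [i _ [B mB <-]]; rewrite setTI.
  pose T1 := g_sigma_algebraType G.
  have : measurable_fun [set: T1] (rV_coord i : T1 -> R).
    apply: (measurability _ (measurable_realfun.RGenOpens.measurableE R)) => //.
    move=> _ [_ [a [b ->]] <-]; rewrite setTI; apply: open_sigma_obox.
    apply: open_comp; last exact: itv_open.
    by move=> x _; exact: coord_continuous.
  by move=> /(_ measurableT B mB); rewrite setTI.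
move: A; apply: smallest_sub; first exact: sigma_algebra_measurable.
by move=> _ [a [b ->]]; exact: measurable_obox.
Qed.
End obox_generates.

Lemma open_measurable_rV (R : realType) (N : nat) (U : set 'rV[R]_N) :
  open U -> measurable U.
Proof. by rewrite measurable_rV_oboxE; exact: open_sigma_obox. Qed.

Lemma closed_measurable_rV (R : realType) (N : nat) (U : set 'rV[R]_N) :
  closed U -> measurable U.
Proof.
by move=> cU; rewrite -[U]setCK; apply: measurableC; apply: open_measurable_rV;
  exact: closed_openC.
Qed.

Lemma hausdorff_rV (R : realType) (N : nat) : hausdorff_space 'rV[R]_N.
Proof. exact: norm_hausdorff. Qed.

Lemma compact_measurable_rV (R : realType) (N : nat) (U : set 'rV[R]_N) :
  compact U -> measurable U.
Proof.
move=> cU; apply: closed_measurable_rV.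
exact: compact_closed (@hausdorff_rV R N) cU.
Qed.

Lemma continuous_measurable_rV (R : realType) (N : nat) (f : 'rV[R]_N -> R) :
  continuous f -> measurable_fun setT f.
Proof.
move=> /continuousP cf; apply: (measurability _ (measurable_realfun.RGenOpens.measurableE R)) => //.
move=> _ [_ [a [b ->]] <-]; rewrite setTI; apply: open_measurable_rV.
apply: cf; exact: itv_open.
Qed.

Lemma obox_setI (R : realType) (N : nat) (a b c d : 'rV[R]_N) :
  obox a b `&` obox c d =
  obox (\row_i Num.max (a ord0 i) (c ord0 i)) (\row_i Num.min (b ord0 i) (d ord0 i)).
Proof.
apply/seteqP; split=> [x [xab xcd] i|x xm].
  by rewrite !mxE gt_max lt_min; have /andP[-> ->] := xab i; have /andP[-> ->] := xcd i.
by split=> i; have := xm i; rewrite !mxE gt_max lt_min => /andP[/andP[? ?] /andP[? ?]]; apply/andP.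
Qed.

Lemma bigcup_obox (R : realType) (N : nat) :
  \bigcup_k obox (const_mx (- k%:R)) (const_mx k%:R) = [set: 'rV[R]_N].
Proof.
apply/seteqP; split=> // x _.
exists (Num.truncn (\sum_i `|x ord0 i|)).+1 => // i; rewrite !mxE -ltr_norml.
apply: le_lt_trans (truncnS_gt _).
by rewrite (bigD1 i)//= lerDl sumr_ge0.
Qed.

Lemma measure_obox_unique (R : realType) (N : nat)
    (m1 m2 : {measure set 'rV[R]_N -> \bar R}) :
  (forall a b, m1 (obox a b) = m2 (obox a b)) ->
  (forall a b, (m1 (obox a b) < +oo)%E) ->
  forall A, measurable A -> m1 A = m2 A.
Proof.
move=> m12 m1oo.
apply: (@measure_unique _ _ _ _ (fun k => obox (const_mx (- k%:R)) (const_mx k%:R))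
  (@measurable_rV_oboxE R N)) => //.
- by move=> _ _ [a [b ->]] [c [d ->]]; rewrite obox_setI; eexists; eexists.
- by move=> i; eexists; eexists.
- exact: bigcup_obox.
- by move=> _ [a [b ->]].
Qed.

(** * Translation invariance *)
Section translation.
Context (R : realType) (N : nat).
Implicit Types (h : 'rV[R]_N).
Local Notation mu := (@lebesgue_rV R N).

Lemma measurable_shift h : measurable_fun [set: 'rV[R]_N] (fun x => x + h).
Proof.
apply: measurable_fun_rV => i.
rewrite (_ : (fun _ => _) = (fun x => rV_coord i x + h ord0 i)); last first.
  by apply/funext => x; rewrite mxE.
by apply: measurable_funD => //; exact: measurable_rV_coord.
Qed.

Let mshift h := measurable_shift h.

Lemma shift_obox h (a b : 'rV[R]_N) :
  (fun x => x + h) @^-1` obox a b = obox (a - h) (b - h).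
Proof.
by apply/seteqP; split=> x /= xab i; have := xab i;
  rewrite !mxE ltrBlDr ltrBrDr.
Qed.

Lemma lebesgue_rV_shift h (A : set 'rV[R]_N) : measurable A ->
  pushforward mu (fun x => x + h) A = mu A.
Proof.
pose m1 : {measure set _ -> \bar R} :=
  measure_function_pushforward__canonical__measure_function_Measure mu (mshift h).
move=> mA.
apply: (@measure_obox_unique _ _ m1 mu) => // a b.
  rewrite /m1/= /pushforward shift_obox !lebesgue_obox; congr EFin.
  by apply: eq_bigr => i _; rewrite !mxE; congr (Num.max _ _); ring.
by rewrite /m1/= /pushforward shift_obox lebesgue_obox ltry.
Qed.

Lemma ge0_integral_shift h (D : set 'rV[R]_N) (f : 'rV[R]_N -> \bar R) :
  measurable D -> measurable_fun D f -> (forall x, D x -> 0 <= f x)%E ->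
  (\int[mu]_(x in (fun x : 'rV[R]_N => (x + h)%R) @^-1` D) f (x + h)%R = \int[mu]_(x in D) f x)%E.
Proof.
move=> mD mf f0.
rewrite -[LHS](@ge0_integral_pushforward _ _ _ _ _ _ (mshift h) mu D f)//; last first.
  by move=> x; rewrite inE; exact: f0.
apply: eq_measure_integral => A mA AD; exact: lebesgue_rV_shift.
Qed.

Lemma ge0_integral_shiftT h (f : 'rV[R]_N -> \bar R) :
  measurable_fun setT f -> (forall x, 0 <= f x)%E ->
  (\int[mu]_x f (x + h)%R = \int[mu]_x f x)%E.
Proof. move=> mf f0; exact: (@ge0_integral_shift h setT f measurableT mf (fun x _ => f0 x)). Qed.

Lemma measurable_fun_shift d (T : measurableType d) h (f : 'rV[R]_N -> T) :
  measurable_fun setT f -> measurable_fun setT (fun x : 'rV[R]_N => f (x + h)).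
Proof. by move=> mf; apply: (measurableT_comp mf (mshift h)). Qed.

Lemma integrable_shift h (f : 'rV[R]_N -> \bar R) :
  mu.-integrable setT f -> mu.-integrable setT (fun x => f (x + h)).
Proof.
move=> /integrableP[mf foo]; apply/integrableP; split.
  exact: measurable_fun_shift.
rewrite (ge0_integral_shiftT h (f := fun x => `|f x|%E))//.
exact: measurableT_comp.
Qed.

Lemma integral_shift h (f : 'rV[R]_N -> \bar R) : mu.-integrable setT f ->
  (\int[mu]_x f (x + h)%R = \int[mu]_x f x)%E.
Proof.
move=> /integrableP[mf _]; rewrite integralE [in RHS]integralE.
congr (_ - _)%E.
  transitivity (\int[mu]_x (f^\+ (x + h)%R))%E; first by apply: eq_integral => x _; rewrite !funeposE.
  by rewrite (ge0_integral_shiftT h (f := f^\+%E))//; exact: measurable_funepos.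
transitivity (\int[mu]_x (f^\- (x + h)%R))%E; first by apply: eq_integral => x _; rewrite !funenegE.
  by rewrite (ge0_integral_shiftT h (f := f^\-%E))//; exact: measurable_funeneg.
Qed.
End translation.

(** * Cubes and compact sets *)
Lemma cube_obox (R : realType) (N : nat) (y : 'rV[R]_N) r :
  cube y r = obox (y - const_mx r) (y + const_mx r).
Proof.
by apply/seteqP; split=> x xr i; have := xr i; rewrite !mxE ltr_distl.
Qed.

Lemma cube_ball (R : realType) (N : nat) (y : 'rV[R]_N) r : 0 < r ->
  cube y r = ball y r.
Proof. by move=> r0; rewrite cube_obox obox_ball. Qed.

Definition ccube {R : realType} {N : nat} (y : 'rV[R]_N) (r : R) : set 'rV[R]_N :=
  [set x | forall i, `|x ord0 i - y ord0 i| <= r].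

Lemma compact_ccube (R : realType) (N : nat) (y : 'rV[R]_N) r : compact (ccube y r).
Proof.
rewrite (_ : ccube y r = [set v | forall i, `[y ord0 i - r, y ord0 i + r]%classic (v ord0 i)]).
  by apply: (@rV_compact _ _ (fun i => `[y ord0 i - r, y ord0 i + r]%classic)) => i; exact: segment_compact.
by apply/seteqP; split=> x xr i; have := xr i; rewrite /= in_itv/= ler_distl.
Qed.

Lemma measurable_ccube (R : realType) (N : nat) (y : 'rV[R]_N) r : measurable (ccube y r).
Proof. by apply: compact_measurable_rV; exact: compact_ccube. Qed.

Lemma measurable_cube (R : realType) (N : nat) (y : 'rV[R]_N) r : measurable (cube y r).
Proof. by rewrite cube_obox; exact: measurable_obox. Qed.

Lemma ccube_sub (R : realType) (N : nat) (y : 'rV[R]_N) r s : r < s -> ccube y r `<=` cube y s.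
Proof. by move=> rs x xr i; exact: le_lt_trans (xr i) rs. Qed.

Lemma sub_ccube (R : realType) (N : nat) (y : 'rV[R]_N) r : cube y r `<=` ccube y r.
Proof. by move=> x xr i; exact: ltW. Qed.

Lemma le_cube (R : realType) (N : nat) (y : 'rV[R]_N) r s : r <= s -> cube y r `<=` cube y s.
Proof. by move=> rs x xr i; exact: lt_le_trans (xr i) rs. Qed.

Lemma lebesgue_compact_lty (R : realType) (N : nat) (K : set 'rV[R]_N) : compact K ->
  (lebesgue_rV K < +oo)%E.
Proof.
move=> cK; have /compact_bounded[M [Mr MK]] := cK.
have mK := compact_measurable_rV cK.
pose B := `|M| + 1.
have KB x : K x -> `|x| <= B by apply: MK; rewrite /B (le_lt_trans (ler_norm _))// ltrDl.
have B0 : 0 < B + 1 by rewrite /B addr_gt0// ltr_wpDl.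
have KS : K `<=` obox (0 - const_mx (B + 1)) (0 + const_mx (B + 1)).
  rewrite -obox_ball// => x /KB xB; rewrite -ball_normE/= sub0r normrN.
  by rewrite (le_lt_trans xB)// ltrDl.
apply: (@le_lt_trans _ _ (lebesgue_rV (obox (0 - const_mx (B + 1)) (0 + const_mx (B + 1))))).
  by apply: le_measure KS; rewrite ?inE//; exact: measurable_obox.
by rewrite lebesgue_obox ltry.
Qed.

(** Room for translating: a test function or an integral over [K] can be moved by
    less than [d] without leaving a compact subset of [E].  The set [K'] is the
    Minkowski sum of [K] and a closed cube. *)
Lemma compact_fatten (R : realType) (N : nat) (K E : set 'rV[R]_N) :
  compact K -> open E -> K `<=` E ->
  exists2 d : R, 0 < d & exists K', [/\ compact K', K' `<=` E &
    forall x z, K x -> ccube x d z -> K' z].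
Proof.
move=> cK oE KE.
have [e e0 He] : exists2 e : R, 0 < e & forall x, K x -> ball x e `<=` E.
  have /compact_near_coveringP/(_ R (0^'+) (fun e x => ball x e `<=` E)) := cK.
  case=> [x /KE Ex|e /= e0 He].
    have /nbhs_ballP[r /= r0 rE] := open_nbhs_nbhs (conj oE Ex).
    have r20 : 0 < r / 2 by rewrite divr_gt0.
    near=> z e => y zey; apply: rE; apply: (@ball_split _ _ z).
      by near: z; apply: nbhsx_ballx; rewrite divr_gt0.
    apply: le_ball zey; change (e <= r / 2); near: e; exact: nbhs_right_le.
  exists (e / 2); first by rewrite divr_gt0.
  apply: He => //=; rewrite ?divr_gt0//.
  by rewrite sub0r normrN gtr0_norm ?divr_gt0// ltr_pdivrMr// ltr_pMr// ltr1n.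
exists (e / 2); first by rewrite divr_gt0.
exists ((fun z : 'rV[R]_N * 'rV[R]_N => z.1 + z.2) @` (K `*` ccube 0 (e / 2))); split.
- apply: continuous_compact; last first.
    by apply: compact_setX => //; exact: compact_ccube.
  by apply: continuous_subspaceT; exact: (@add_continuous 'rV[R]_N).
- move=> _ [[x z]/= [Kx zc] <-]; apply: (He x) => //.
  rewrite -cube_ball//; move=> i; rewrite !mxE addrAC subrr add0r.
  have := zc i; rewrite mxE subr0 => /le_lt_trans; apply.
  by rewrite ltr_pdivrMr// ltr_pMr// ltr1n.
- move=> x z Kx xz; exists (x, z - x) => /=; last by rewrite addrC subrK.
  by split => //= i; have := xz i; rewrite !mxE subr0.
Unshelve. all: by end_near. Qed.

(** * Equality almost everywhere from integrals over boxes *)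
Section ae_eq_boxes.
Context (R : realType) (N : nat).
Local Notation mu := (@lebesgue_rV R N).

Lemma integral_setI_box (f g : 'rV[R]_N -> \bar R) (c d : 'rV[R]_N) :
  mu.-integrable (obox c d) f -> mu.-integrable (obox c d) g ->
  (forall a b, obox a b `<=` obox c d ->
    \int[mu]_(x in obox a b) f x = \int[mu]_(x in obox a b) g x)%E ->
  forall A, measurable A ->
    (\int[mu]_(x in A `&` obox c d) f x = \int[mu]_(x in A `&` obox c d) g x)%E.
Proof.
move=> intf intg fg A; rewrite measurable_rV_oboxE.
have mC := measurable_obox c d.
have [iD jD] : (forall B, measurable B -> mu.-integrable (B `&` obox c d) f) /\
    (forall B, measurable B -> mu.-integrable (B `&` obox c d) g).
  by split=> B mB; apply: (@integrableS _ _ _ mu (obox c d)) => //; exact: measurableI.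
move: A; apply: (dynkin_induction (P := fun A =>
  \int[mu]_(x in A `&` obox c d) f x = \int[mu]_(x in A `&` obox c d) g x)%E
  (measurable_rV_oboxE R N)).
- by move=> _ _ [a [b ->]] [a' [b' ->]]; rewrite obox_setI; eexists; eexists.
- by rewrite setTI; apply: fg.
- move=> _ [a [b ->]]; have := fg (\row_i Num.max (a ord0 i) (c ord0 i)) (\row_i Num.min (b ord0 i) (d ord0 i)).
  by rewrite -obox_setI; apply; exact: subIsetr.
- move=> B mB IH.
  have E (h : 'rV[R]_N -> \bar R) : mu.-integrable (obox c d) h ->
      (\int[mu]_(x in obox c d) h x =
       \int[mu]_(x in B `&` obox c d) h x + \int[mu]_(x in ~` B `&` obox c d) h x)%E.
    move=> inth; rewrite -integral_setU//.
    + by rewrite -setIUl setUv setTI.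
    + exact: measurableI.
    + by apply: measurableI => //; exact: measurableC.
    + by rewrite -setIUl setUv setTI; exact: measurable_int inth.
    + by apply/disj_setPS => x [[Bx _] [nBx _]].
  have F (h : 'rV[R]_N -> \bar R) : mu.-integrable (obox c d) h -> forall B', measurable B' ->
      (\int[mu]_(x in B' `&` obox c d) h x)%E \is a fin_num.
    move=> inth B' mB'; apply: integrable_fin_num; first exact: measurableI.
    by apply: (@integrableS _ _ _ mu (obox c d)) => //; exact: measurableI.
  have := fg c d (@subset_refl _ _); rewrite (E _ intf) (E _ intg) -IH.
  move=> /(congr1 (fun z => z - \int[mu]_(x in B `&` obox c d) f x)%E).
  have FB := F f intf B mB.
  by rewrite addeAC subee// add0e addeAC subee// add0e.
- move=> F mF tF IH; rewrite setI_bigcupl.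
  have mFC k : measurable (F k `&` obox c d) by exact: measurableI.
  have tFC : trivIset setT (fun k => F k `&` obox c d).
    by apply: trivIset_setIr.
  rewrite !integral_bigcup//.
  + by apply: eq_eseriesr => k _; exact: IH.
  + rewrite -setI_bigcupl; apply: jD; exact: bigcup_measurable.
  + rewrite -setI_bigcupl; apply: iD; exact: bigcup_measurable.
Qed.

Lemma ae_eq_obox (f g : 'rV[R]_N -> \bar R) (c d : 'rV[R]_N) :
  mu.-integrable (obox c d) f -> mu.-integrable (obox c d) g ->
  (forall a b, obox a b `<=` obox c d ->
    \int[mu]_(x in obox a b) f x = \int[mu]_(x in obox a b) g x)%E ->
  ae_eq mu (obox c d) f g.
Proof.
move=> intf intg fg; apply: integral_ae_eq => //.
- exact: measurable_obox.
- exact: measurable_int intg.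
- move=> A AC mA; have <- : A `&` obox c d = A by apply/setIidPl.
  exact: integral_setI_box.
Qed.
End ae_eq_boxes.

(** * Continuity of translations in L^1 *)

Lemma cvge0_near_lt (R : realType) (u : nat -> \bar R) (e : R) : 0 < e ->
  u n @[n --> \oo] --> 0%E -> \forall n \near \oo, (u n < e%:E)%E.
Proof.
move=> e0 u0; have := u0 [set y | (y < e%:E)%E]; apply.
apply: open_nbhs_nbhs; split; first exact: open_ereal_lt_ereal.
by rewrite /= lte_fin.
Qed.

Lemma le_indic (R : realType) (T : Type) (A B : set T) (x : T) : A `<=` B ->
  \1_A x <= \1_B x :> R.
Proof.
move=> AB; rewrite !indicE ler_nat; case: (boolP (x \in A)) => //.
by rewrite inE => /AB Bx; rewrite mem_set.
Qed.

Lemma lebesgue_obox_lty (R : realType) (N : nat) (a b : 'rV[R]_N) :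
  (lebesgue_rV (obox a b) < +oo)%E.
Proof. by rewrite lebesgue_obox ltry. Qed.

Section sum_indic.
Context (R : realType) (T : Type) (F : (set T)^nat).
Hypothesis tF : trivIset setT F.

Lemma sum_indic n x : \sum_(i < n) \1_(F i) x = \1_(\bigcup_(i < n) F i) x :> R.
Proof.
have [[k kn Fkx]|nF] := pselect (exists2 k, (k < n)%N & F k x).
  rewrite (bigD1 (Ordinal kn))//= big1 ?addr0; last first.
    move=> i ik; rewrite indicE memNset// => Fix.
    move: ik; apply/negP/negPn/eqP/val_inj => /=.
    by apply: tF => //; exists x.
  by rewrite !indicE !mem_set//; exists k.
rewrite big1; last by move=> i _; rewrite indicE memNset// => Fix; apply: nF; exists i.
by rewrite indicE memNset// => -[k kn Fkx]; apply: nF; exists k.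
Qed.

Lemma cvg_sum_indic x : \sum_(i < n) \1_(F i) x @[n --> \oo] --> (\1_(\bigcup_i F i) x : R).
Proof.
under eq_fun do rewrite sum_indic.
apply: cvg_near_cst.
have [[k _ Fkx]|nF] := pselect ((\bigcup_i F i) x).
  exists k.+1 => // n /= kn; rewrite !indicE !mem_set//; first by exists k.
  by exists k.
apply: nearW => n; rewrite !indicE !memNset// => -[k kn Fkx]; apply: nF; by exists k.
Qed.
End sum_indic.

Lemma integrable_indic_lty d (T : measurableType d) (R : realType)
    (mu : {measure set T -> \bar R}) (A : set T) :
  measurable A -> (mu A < +oo)%E -> mu.-integrable setT (EFin \o \1_A).
Proof.
move=> mA Aoo; apply/integrableP; split; first exact/measurable_EFinP/measurable_indic.
rewrite (eq_integral (fun x => (\1_A x)%:E)); last by move=> x _ /=; rewrite ger0_norm.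
by rewrite integral_indic// setIT.
Qed.

Section translation_L1.
Context (R : realType) (N : nat) (v : 'rV[R]_N).
Local Notation mu := (@lebesgue_rV R N).

Definition transl_continuous (f : 'rV[R]_N -> R) := forall e : R, 0 < e ->
  exists2 d : R, 0 < d & forall s, `|s| < d ->
    (\int[mu]_x (`|f (x + s *: v) - f x|)%:E <= e%:E)%E.

Lemma measurable_abs_diff (f g : 'rV[R]_N -> R) : measurable_fun setT f -> measurable_fun setT g ->
  measurable_fun setT (fun x => (`|f x - g x|)%:E).
Proof.
by move=> mf mg; apply/measurable_EFinP; apply: measurableT_comp => //; exact: measurable_funB.
Qed.

(** Translation is an isometry of [L^1], so approximation in [L^1] preserves
    continuity. *)
Lemma transl_continuous_lim (f : 'rV[R]_N -> R) : measurable_fun setT f ->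
  (forall e : R, 0 < e -> exists g, [/\ measurable_fun setT g, transl_continuous g &
    (\int[mu]_x (`|f x - g x|)%:E <= e%:E)%E]) -> transl_continuous f.
Proof.
move=> mf H e e0; have e30 : 0 < e / 3 by rewrite divr_gt0.
have [g [mg cg fg]] := H _ e30; have [d d0 dg] := cg _ e30.
exists d => // s sd.
apply: (@le_trans _ _ (\int[mu]_x ((`|f (x + s *: v) - g (x + s *: v)|)%:E +
   ((`|g (x + s *: v) - g x|)%:E + (`|f x - g x|)%:E)))%E).
  apply: ge0_le_integral => //.
  - by apply: measurable_abs_diff => //; exact: measurable_fun_shift.
  - apply: emeasurable_funD; first by apply: measurable_abs_diff; exact: measurable_fun_shift.
    by apply: emeasurable_funD; apply: measurable_abs_diff => //; exact: measurable_fun_shift.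
  - move=> x _; rewrite -!EFinD lee_fin.
    rewrite (_ : f (x + s *: v) - f x = (f (x + s *: v) - g (x + s *: v)) + ((g (x + s *: v) - g x) + (g x - f x))); last by ring.
    apply: le_trans (ler_normD _ _) _; rewrite lerD2l.
    by apply: le_trans (ler_normD _ _) _; rewrite lerD2l distrC.
rewrite ge0_integralD//; last 3 first.
- by apply: measurable_abs_diff; exact: measurable_fun_shift.
- by move=> x _; rewrite adde_ge0.
- by apply: emeasurable_funD; apply: measurable_abs_diff => //; exact: measurable_fun_shift.
rewrite ge0_integralD//; last 2 first.
- by apply: measurable_abs_diff => //; exact: measurable_fun_shift.
- exact: measurable_abs_diff.
rewrite (ge0_integral_shiftT (s *: v) (f := fun x => (`|f x - g x|)%:E))//; last exact: measurable_abs_diff.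
rewrite (_ : e%:E = (e / 3)%:E + ((e / 3)%:E + (e / 3)%:E))%E; last by rewrite -!EFinD; congr EFin; lra.
by apply: leeD => //; apply: leeD => //; exact: dg.
Qed.

Lemma transl_continuousD f g : measurable_fun setT f -> measurable_fun setT g ->
  transl_continuous f -> transl_continuous g -> transl_continuous (fun x => f x + g x).
Proof.
move=> mf mg cf cg e e0; have e20 : 0 < e / 2 by rewrite divr_gt0.
have [d d0 df] := cf _ e20; have [d' d'0 dg] := cg _ e20.
exists (Num.min d d'); first by rewrite lt_min d0.
move=> s; rewrite lt_min => /andP[sd sd'].
apply: (@le_trans _ _ (\int[mu]_x ((`|f (x + s *: v) - f x|)%:E + (`|g (x + s *: v) - g x|)%:E))%E).
  apply: ge0_le_integral => //.
  - by apply: measurable_abs_diff => //; apply: measurable_funD => //; exact: measurable_fun_shift.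
  - by apply: emeasurable_funD; apply: measurable_abs_diff => //; exact: measurable_fun_shift.
  - move=> x _; rewrite -!EFinD lee_fin.
    by rewrite opprD addrACA; exact: ler_normD.
rewrite ge0_integralD//; last 2 first.
- by apply: measurable_abs_diff => //; exact: measurable_fun_shift.
- by apply: measurable_abs_diff => //; exact: measurable_fun_shift.
rewrite (_ : e%:E = (e / 2)%:E + (e / 2)%:E)%E; last by rewrite -!EFinD; congr EFin; lra.
by apply: leeD; [exact: df|exact: dg].
Qed.

Lemma transl_continuousZ (c : R) f : measurable_fun setT f ->
  transl_continuous f -> transl_continuous (fun x => c * f x).
Proof.
move=> mf cf e e0; have c0 : 0 < `|c| + 1 by rewrite ltr_wpDl.
have [d d0 df] := cf _ (divr_gt0 e0 c0).
exists d => // s sd.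
apply: (@le_trans _ _ (\int[mu]_x ((`|c| + 1)%:E * (`|f (x + s *: v) - f x|)%:E))%E).
  apply: ge0_le_integral => //.
  - by apply: measurable_abs_diff; apply: measurable_funM => //; exact: measurable_fun_shift.
  - by apply: emeasurable_funM => //; apply: measurable_abs_diff => //; exact: measurable_fun_shift.
  - by move=> x _; rewrite -EFinM lee_fin -mulrBr normrM ler_wpM2r// lerDl.
rewrite ge0_integralZl//; last first.
  by apply: measurable_abs_diff => //; exact: measurable_fun_shift.
rewrite (_ : e%:E = (`|c| + 1)%:E * (e / (`|c| + 1))%:E)%E; last first.
  by rewrite -EFinM mulrC divfK// gt_eqF.
by rewrite lee_pmul2l// ?lte_fin//; exact: df.
Qed.

Lemma transl_continuous0 : transl_continuous (fun=> 0).
Proof.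
move=> e e0; exists 1 => // s _.
by rewrite subrr normr0 integral0 lee_fin ltW.
Qed.

Lemma transl_continuous_sum (I : Type) (r : seq I) (F : I -> 'rV[R]_N -> R) :
  (forall i, measurable_fun setT (F i)) -> (forall i, transl_continuous (F i)) ->
  transl_continuous (fun x => \sum_(i <- r) F i x).
Proof.
move=> mF cF; elim: r => [|i r IH].
  rewrite (_ : (fun _ => _) = (fun=> 0)); first exact: transl_continuous0.
  by apply/funext => x; rewrite big_nil.
rewrite (_ : (fun _ => _) = (fun x => F i x + \sum_(j <- r) F j x)); last first.
  by apply/funext => x; rewrite big_cons.
by apply: transl_continuousD => //; exact: measurable_sum.
Qed.

(** The symmetric difference of a box and its translate has the measure
    [2 (F 0 - F s)], where [F s] is the volume of their intersection: a continuous
    function of the corners. *)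
Lemma transl_continuous_box (a b : 'rV[R]_N) : transl_continuous (\1_(obox a b)).
Proof.
move=> e e0.
have mQ := measurable_obox a b.
have mQs s := measurable_obox (a - s *: v) (b - s *: v).
pose F (s : R) := \prod_(i < N) Num.max 0 (Num.min (b ord0 i) (b ord0 i - s * v ord0 i) -
   Num.max (a ord0 i) (a ord0 i - s * v ord0 i)).
have FE s : lebesgue_rV (obox a b `&` obox (a - s *: v) (b - s *: v)) = (F s)%:E.
  by rewrite obox_setI lebesgue_obox; congr EFin; apply: eq_bigr => i _; rewrite !mxE.
have F0 : lebesgue_rV (obox a b) = (F 0)%:E.
  by rewrite -FE scale0r !subr0 setIid.
have Fs s : lebesgue_rV (obox (a - s *: v) (b - s *: v)) = (F 0)%:E.
  by rewrite -F0 -shift_obox; exact: lebesgue_rV_shift.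
have cF : {for 0, continuous F}.
  apply: (@cvg_big _ _ _ _ predT (@mul_continuous R)) => i _.
  change ({for 0, continuous (cst 0 \max (fun s : R => Num.min (b ord0 i) (b ord0 i - s * v ord0 i) - Num.max (a ord0 i) (a ord0 i - s * v ord0 i)))}).
  apply: (@continuous_max R _ (cst 0)); first exact: cvg_cst.
  apply: continuousB.
    apply: (@continuous_min R _ (cst (b ord0 i))); first exact: cvg_cst.
    by apply: continuousB; [exact: cvg_cst|apply: continuousM; [exact: cvg_id|exact: cvg_cst]].
  apply: (@continuous_max R _ (cst (a ord0 i))); first exact: cvg_cst.
  by apply: continuousB; [exact: cvg_cst|apply: continuousM; [exact: cvg_id|exact: cvg_cst]].
have : \forall s \near (0 : R), `|F 0 - F s| < e / 2.
  by apply: (cvgr_dist_lt _ _ cF); rewrite divr_gt0.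
case => d /= d0 dF; exists d => // s sd.
have {dF} := dF s; rewrite /= sub0r normrN => /(_ sd) dF.
rewrite (_ : (\int[mu]_x _)%E = (F 0 - F s + (F 0 - F s))%:E); last first.
  rewrite (eq_integral (fun x => (\1_(obox a b `\` obox (a - s *: v) (b - s *: v)) x)%:E +
     (\1_(obox (a - s *: v) (b - s *: v) `\` obox a b) x)%:E)%E); last first.
    move=> x _; rewrite -EFinD; congr EFin.
    have -> : \1_(obox a b) (x + s *: v) = \1_(obox (a - s *: v) (b - s *: v)) x :> R.
      by rewrite !indicE -shift_obox; congr (nat_of_bool _)%:R; apply/idP/idP; rewrite !inE.
    rewrite !indicE !in_setD; case: (_ \in _); case: (_ \in _) => /=;
      by rewrite ?subrr ?normr0 ?addr0 ?subr0 ?sub0r ?normrN ?normr1 ?add0r.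
  rewrite ge0_integralD//; last 2 first.
  - by apply/measurable_EFinP; apply: measurable_indic; exact: measurableD.
  - by apply/measurable_EFinP; apply: measurable_indic; exact: measurableD.
  rewrite !integral_indic ?setIT//; [|exact: measurableD|exact: measurableD].
  rewrite EFinD; congr (_ + _)%E.
    by rewrite measureD//= ?FE ?F0 ?ltry// -EFinB.
  by rewrite measureD//= ?Fs ?ltry// setIC FE -EFinB.
rewrite lee_fin; have := ler_norm (F 0 - F s); lra.
Qed.

(** Dominated pointwise convergence of the approximants gives the criterion of
    [transl_continuous_lim]. *)
Lemma transl_continuous_dominated (f : 'rV[R]_N -> R) (g : nat -> 'rV[R]_N -> R)
    (h : 'rV[R]_N -> R) :
  measurable_fun setT f -> (forall n, measurable_fun setT (g n)) ->
  (forall n, transl_continuous (g n)) ->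
  (forall x, g n x @[n --> \oo] --> f x) ->
  mu.-integrable setT (EFin \o h) -> (forall n x, `|g n x| <= h x) ->
  transl_continuous f.
Proof.
move=> mf mg cg gf ih gh; apply: transl_continuous_lim => // e e0.
have [] := @dominated_convergence _ _ _ mu setT measurableT
  (fun n x => (g n x)%:E) (EFin \o f) (EFin \o h).
- by move=> n; apply/measurable_EFinP.
- exact/measurable_EFinP.
- by apply: aeW => x _; apply: cvg_EFin; [exact: nearW|exact: gf].
- exact: ih.
- by apply: aeW => x n _; rewrite /= lee_fin.
move=> _ gf0 _.
have : \forall n \near \oo, (\int[mu]_x `|(g n x)%:E - (f x)%:E| < e%:E)%E.
  exact: cvge0_near_lt.
move=> [n _ /(_ n (leqnn _)) /= gn]; exists (g n); split => //.
apply: le_trans (ltW gn); apply: ge0_le_integral => //.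
- exact: measurable_abs_diff.
- by apply/measurable_EFinP; apply: measurableT_comp => //; exact: measurable_funB.
- by move=> x _; rewrite lee_fin distrC.
Qed.

(** Dynkin induction from the boxes; the intersection with a fixed box keeps all
    the indicators dominated by one integrable function. *)
Lemma transl_continuous_indic_bounded (c d : 'rV[R]_N) (A : set 'rV[R]_N) :
  measurable A -> transl_continuous (\1_(A `&` obox c d)).
Proof.
have mC := measurable_obox c d.
rewrite measurable_rV_oboxE; move: A.
apply: (dynkin_induction (P := fun A => transl_continuous (\1_(A `&` obox c d)))
  (measurable_rV_oboxE R N)).
- by move=> _ _ [a [b ->]] [a' [b' ->]]; rewrite obox_setI; eexists; eexists.
- by rewrite setTI; exact: transl_continuous_box.
- by move=> _ [a [b ->]]; rewrite obox_setI; exact: transl_continuous_box.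
- move=> B mB cB.
  (* complement: subtract from the indicator of the fixed box *)
  rewrite (_ : \1__ = (fun x => \1_(obox c d) x + (-1) * \1_(B `&` obox c d) x)).
    apply: transl_continuousD => //.
    + by apply: measurable_funM => //; apply: measurable_indic; exact: measurableI.
    + exact: transl_continuous_box.
    + by apply: transl_continuousZ => //; apply: measurable_indic; exact: measurableI.
  apply/funext => x; rewrite !indicE !in_setI in_setC.
  by case: (x \in B); case: (x \in obox c d) => /=; lra.
- move=> F mF tF IH.
  have mFC k : measurable (F k `&` obox c d) by exact: measurableI.
  rewrite setI_bigcupl.
  have tFC : trivIset setT (fun k => F k `&` obox c d) by exact: trivIset_setIr.
  apply: (@transl_continuous_dominated _
    (fun n x => \sum_(i < n) \1_(F i `&` obox c d) x) (\1_(obox c d))).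
  + by apply: measurable_indic; exact: bigcupT_measurable.
  + by move=> n; apply: measurable_sum => i; exact: measurable_indic.
  + move=> n; apply: transl_continuous_sum => // i; exact: measurable_indic.
  + by move=> x; exact: cvg_sum_indic.
  + by apply: integrable_indic_lty => //; exact: lebesgue_obox_lty.
  + move=> n x; rewrite (sum_indic _ tFC) ger0_norm//.
    by apply: le_indic => y [i _ []].
Qed.

Lemma transl_continuous_indic (A : set 'rV[R]_N) :
  measurable A -> (mu A < +oo)%E -> transl_continuous (\1_A).
Proof.
move=> mA Aoo.
pose Q n : set 'rV[R]_N := obox (const_mx (- n%:R)) (const_mx n%:R).
have mAQ n : measurable (A `&` Q n) by apply: measurableI => //; exact: measurable_obox.
apply: (@transl_continuous_dominated _ (fun n => \1_(A `&` Q n)) (\1_A)) => //.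
- by move=> n; exact: transl_continuous_indic_bounded.
- move=> x; have [n _ Qnx] : (\bigcup_k Q k) x by rewrite bigcup_obox.
  apply: cvg_near_cst; exists n => // m /= nm; rewrite !indicE in_setI.
  suff -> : x \in Q m by rewrite andbT.
  rewrite inE => i; have := Qnx i; rewrite !mxE => /andP[h1 h2].
  by rewrite (le_lt_trans _ h1) ?lerN2 ?ler_nat// (lt_le_trans h2)// ler_nat.
- exact: integrable_indic_lty.
- move=> n x; rewrite ger0_norm//.
  by apply: le_indic => y [].
Qed.

Import HBSimple.

Lemma integrable_transl_continuous (f : 'rV[R]_N -> R) :
  mu.-integrable setT (EFin \o f) -> transl_continuous f.
Proof.
move=> intf; have mf : measurable_fun setT f by apply/measurable_EFinP; exact: measurable_int intf.
have [g [intg _ gf0]] := approximation_sfun_integrable measurableT intf.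
apply: transl_continuous_lim => // e e0.
have [n _ /(_ n (leqnn _)) gn] := cvge0_near_lt e0 gf0.
exists (g n); split; [exact: measurable_funPT| |]; last exact: ltW gn.
rewrite (_ : (g n : _ -> R) = (fun x => \sum_(y <- finmap.enum_fset (fset_set (range (g n)))) y * \1_(g n @^-1` [set y]) x)); last first.
  apply/funext => x; rewrite {1}fimfunE fsbig_finite//.
apply: transl_continuous_sum => y.
  by apply: measurable_funM => //; exact: measurable_indic.
have [->|y0] := eqVneq y 0.
  rewrite (_ : (fun _ => _) = (fun=> 0)); first exact: transl_continuous0.
  by apply/funext => x; rewrite mul0r.
apply: transl_continuousZ; first exact: measurable_indic.
apply: transl_continuous_indic => //.
have /integrableP[_ goo] := intg n.
have y00 : 0 < `|y| by rewrite normr_gt0.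
suff : (`|y|%:E * mu (g n @^-1` [set y]) < +oo)%E.
  move=> h; rewrite ltey; apply/eqP => yoo; move: h.
  by rewrite yoo gt0_muley ?lte_fin.
apply: le_lt_trans goo.
rewrite -(setIT (g n @^-1` [set y])) -integral_indic// -ge0_integralZl//; last exact/measurable_EFinP/measurable_indic.
apply: ge0_le_integral => //.
- by apply: emeasurable_funM => //; exact/measurable_EFinP/measurable_indic.
- by apply: measurableT_comp => //; exact/measurable_EFinP.
move=> x _; rewrite /= -EFinM lee_fin indicE; case: (boolP (x \in _)) => /=; last by rewrite mulr0.
by rewrite inE/= => ->; rewrite mulr1.
Qed.
End translation_L1.

(** * Smooth bump functions *)

Section flat.
Context {R : realType}.
Implicit Types (x y : R).

(** The building block of smooth bumps; the power of [x^-1] makes the family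
    stable under differentiation. *)
Definition flat (k : nat) (x : R) : R :=
  if 0 < x then x^-1 ^+ k * expR (- x^-1) else 0.

Lemma flat_ge0 k x : 0 <= flat k x.
Proof.
by rewrite /flat; case: ifP => // x0; rewrite mulr_ge0 ?expR_ge0// exprn_ge0// invr_ge0 ltW.
Qed.

Lemma flat0_le1 x : flat 0 x <= 1.
Proof.
by rewrite /flat; case: ifP => // x0; rewrite expr0 mul1r expR_le1 oppr_le0 invr_ge0 ltW.
Qed.

(** From one term of the exponential series: [y^(k+2) / (k+2)! <= exp y] at
    [y = x^-1]. *)
Lemma flat_le_sqr k x : 0 < x -> flat k x <= k.+2`!%:R * x ^+ 2.
Proof.
move=> x0; rewrite /flat x0.
have y0 : 0 < x^-1 by rewrite invr_gt0.
have := expR_ge1Dxn k.+1 (ltW y0).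
rewrite expRN => h.
have f0 : 0 < k.+2`!%:R :> R by rewrite ltr0n fact_gt0.
have {}h : x^-1 ^+ k.+2 / k.+2`!%:R <= expR x^-1 by apply: le_trans h; rewrite lerDr.
rewrite ler_pdivrMr ?expR_gt0//.
rewrite ler_pdivrMr// in h.
have -> : x^-1 ^+ k = x ^+ 2 * x^-1 ^+ k.+2.
  by rewrite -(addn2 k) exprD mulrCA -exprMn divff ?gt_eqF// expr1n mulr1.
rewrite [leRHS]mulrAC [leRHS]mulrC; apply: ler_wpM2l; first exact: sqr_ge0.
by rewrite mulrC.
Qed.

(** At [0] the difference quotient is squeezed by [flat_le_sqr]. *)
Lemma is_derive_flat k x :
  is_derive x 1 (flat k) (flat k.+2 x - k%:R * flat k.+1 x).
Proof.
have [x0|x0|x0] := ltgtP x 0.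
- have H : \forall y \near x, flat k y = cst 0 y.
    near=> y; rewrite /flat/= ltNge (_ : y <= 0)//.
    by near: y; apply: lt_le_nbhsl x0.
  have -> : flat k.+2 x - k%:R * flat k.+1 x = 0.
    by rewrite /flat ltNge (ltW x0)/= mulr0 subr0.
  apply: DeriveDef.
    by apply: (near_eq_derivable (f := cst 0)); [apply: filterS H => ? ->|exact: derivable_cst].
  by rewrite (near_eq_derive _ H) derive_cst.
- have H : \forall y \near x, flat k y = ((fun y => y^-1 ^+ k) * (fun y => expR (- y^-1))) y.
    near=> y; rewrite /flat/= (_ : 0 < y)//.
    by near: y; apply: lt_nbhsr x0.
  have D : is_derive x 1 ((fun y : R => y^-1 ^+ k) * (fun y => expR (- y^-1)))
     (flat k.+2 x - k%:R * flat k.+1 x).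
    have xn0 : id x != 0 :> R by rewrite gt_eqF.
    have DV : is_derive x 1 (fun y : R => y^-1) (- x ^- 2).
      have := is_deriveV xn0 (is_derive_id x (1 : R)).
      by rewrite scaler1.
    have DN : is_derive x 1 (fun y : R => - y^-1) (x ^- 2).
      by have := is_deriveN DV; rewrite opprK.
    have DE : is_derive x 1 (fun y => expR (- y^-1)) (expR (- x^-1) * x ^- 2).
      by apply: (is_derive1_comp (f := expR)).
    have DX : is_derive x 1 (fun y : R => y^-1 ^+ k) (k%:R * x^-1 ^+ k.-1 * (- x ^- 2)).
      have [h1 h2] := is_deriveX k DV.
      rewrite (_ : (fun y => y^-1 ^+ k) = (fun y : R => y^-1) ^+ k); last first.
        by apply/funext => y; rewrite fctE.
      by apply: DeriveDef.
    have [h1 h2] := is_deriveM DX DE; apply: DeriveDef; first exact: h1.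
    rewrite [LHS]h2 /flat x0 -exprVn /GRing.scale/=.
    case: (k) => [|m]; first by rewrite !mul0r mulr0 addr0 subr0 expr0 mul1r mulrC.
    by rewrite -[m.+3]addn2 -[m.+2 in X in _ - X]addn1 !exprD /= expr1 exprS; ring.
  apply: DeriveDef.
    by apply: (near_eq_derivable (f := (fun y => y^-1 ^+ k) * (fun y => expR (- y^-1)))); [apply: filterS H => ? ->|apply: ex_derive].
  by rewrite (near_eq_derive _ H); apply: derive_val.
- rewrite x0 (_ : flat k.+2 0 - _ = 0); last by rewrite /flat ltxx mulr0 subr0.
  have C : h^-1 *: ((flat k \o shift 0) (h *: 1) - flat k 0) @[h --> 0^'] --> (0 : R).
    apply/cvgr0Pnorm_le => e e0.
    have f0 : 0 < k.+2`!%:R :> R by rewrite ltr0n fact_gt0.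
    near=> h; have hn0 : h != 0 by near: h; exact: nbhs_dnbhs_neq.
    rewrite /= addr0 [h *: 1]mulr1 {2}/flat ltxx subr0 normrZ normfV.
    have [h0|h0] := ltP 0 h; last by rewrite /flat ltNge h0/= normr0 mulr0 ltW.
    rewrite (ger0_norm (flat_ge0 k h)) gtr0_norm// mulrC ler_pdivrMr//.
    apply: le_trans (flat_le_sqr k h0) _; rewrite expr2 mulrA ler_pM2r//.
    rewrite -ler_pdivlMl//.
    have : `|h| < k.+2`!%:R^-1 * e; last by rewrite gtr0_norm// => /ltW.
    near: h.
    have : 0 < k.+2`!%:R^-1 * e by rewrite mulr_gt0 ?invr_gt0.
    move=> he; exists (k.+2`!%:R^-1 * e) => // z /=; by rewrite sub0r normrN.
  apply: DeriveDef; first by apply/cvg_ex; exists 0.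
  exact: cvg_lim C.
Unshelve. all: by end_near. Qed.
End flat.

Section bumpy.
Context {R : realType}.

(** The functions of one variable needed below form an algebra generated by
    affine reparametrizations of [flat]; derivatives stay in it, so all its
    members are smooth. *)
Inductive bumpy : (R -> R) -> Prop :=
| bumpy_flat k a b : bumpy (fun x => flat k (a * x + b))
| bumpyZ c f : bumpy f -> bumpy (fun x => c * f x)
| bumpyD f g : bumpy f -> bumpy g -> bumpy (fun x => f x + g x)
| bumpyM f g : bumpy f -> bumpy g -> bumpy (fun x => f x * g x).

Lemma bumpy_derivable f : bumpy f ->
  exists2 f', bumpy f' & forall x : R, is_derive x 1 f (f' x).
Proof.
elim=> [k a b|c {}f _ [f' bf' Df]|{}f g _ [f' bf' Df] _ [g' bg' Dg]|{}f g bf [f' bf' Df] bg [g' bg' Dg]].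
- exists (fun x => a * (flat k.+2 (a * x + b) + (- k%:R) * flat k.+1 (a * x + b))).
    by do ?constructor.
  move=> x; have D1 : is_derive x 1 (fun x : R => a * x + b) a.
    have := is_deriveD (is_deriveZ a (is_derive_id x (1 : R))) (is_derive_cst b x 1).
    by move=> /is_derive_eq; apply; rewrite addr0 [_ *: _]mulr1.
  have := @is_derive1_comp _ (flat k) (fun x => a * x + b) x _ _ (is_derive_flat k (a * x + b)) D1.
  by move=> /is_derive_eq; apply; rewrite mulrC mulNr.
- exists (fun x => c * f' x); first by constructor.
  by move=> x; apply: is_deriveZ.
- exists (fun x => f' x + g' x); first by constructor.
  by move=> x; apply: is_deriveD.
- exists (fun x => f x * g' x + g x * f' x); first by do ?constructor.
  by move=> x; apply: is_deriveM.
Qed.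

Lemma bumpy_continuous f : bumpy f -> continuous f.
Proof.
move=> /bumpy_derivable[f' _ Df] x.
apply: differentiable_continuous; apply/derivable1_diffP.
by have [] := Df x.
Qed.
End bumpy.

Section product_functions.
Context {R : realType} {N : nat}.

Definition prodf (f : 'I_N -> R -> R) (x : 'rV[R]_N) : R :=
  \prod_j f j (x ord0 j).

Lemma prodf_continuous f : (forall j, bumpy (f j)) -> continuous (prodf f).
Proof.
move=> bf x; apply: (@cvg_big _ _ _ _ predT (@mul_continuous R) _ (nbhs x)) => j _.
apply: continuous_comp; first exact: coord_continuous.
exact: bumpy_continuous.
Qed.

(** A partial derivative changes a single factor, hence gives a product of the
    same kind; [prodf_Ck] iterates this. *)
Lemma prodf_is_derive f i : (forall j, bumpy (f j)) ->
  exists2 f', (forall j, bumpy (f' j)) & forall x : 'rV[R]_N,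
    is_derive x (delta_mx ord0 i) (prodf f) (prodf f' x).
Proof.
move=> bf; have [g bg Dg] := bumpy_derivable (bf i).
exists (fun j => if j == i then g else f j) => [j|x]; first by case: ifP.
pose c := \prod_(j | j != i) f j (x ord0 j).
have E h : h^-1 *: ((prodf f \o shift x) (h *: delta_mx ord0 i) - prodf f x) =
    c *: (h^-1 *: ((f i \o shift (x ord0 i)) (h *: 1) - f i (x ord0 i))).
  have E1 : \prod_(j | j != i) f j ((h *: delta_mx ord0 i + x) ord0 j) = c.
    by apply: eq_bigr => j ji; rewrite !mxE (negPf ji) andbF mulr0 add0r.
  rewrite /prodf /= (bigD1 i)//= [X in _ - X](bigD1 i)//= E1 -/c -mulrBl.
  by rewrite !mxE !eqxx /GRing.scale/=; ring.
have -> : prodf (fun j => if j == i then g else f j) x = c *: g (x ord0 i).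
  rewrite /prodf (bigD1 i)//= eqxx mulrC; congr (_ * _).
  by apply: eq_bigr => j /negPf ->.
have [Dx <-] := Dg (x ord0 i).
have C : h^-1 *: ((prodf f \o shift x) (h *: delta_mx ord0 i) - prodf f x) @[h --> 0^'] -->
    c *: 'D_1 (f i) (x ord0 i).
  under eq_fun do rewrite E.
  by apply: cvgZr => //; exact: Dx.
apply: DeriveDef; first by apply/cvg_ex; eexists; exact: C.
exact: cvg_lim C.
Qed.

Lemma prodf_Ck f : (forall j, bumpy (f j)) -> forall k, Ck k (prodf f).
Proof.
move=> bf k; elim: k f bf => [|k IH] f bf /=; first exact: prodf_continuous.
split=> [|i]; first exact: prodf_continuous.
have [g bg Dg] := prodf_is_derive i bf; split.
  by move=> x; have [] := Dg x.
rewrite (_ : partial i (prodf f) = prodf g); first exact: IH.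
by apply/funext => x; have [_] := Dg x.
Qed.
End product_functions.

Section boxbump.
Context {R : realType}.

(** An increasing sequence of smooth functions that tends to the indicator of
    [`]a, b[]: it suffices to speed up [flat 0], which tends to 1. *)
Definition itvbump (n : nat) (a b x : R) : R :=
  flat 0 (n.+1%:R * x + (- (n.+1%:R * a))) * flat 0 ((- n.+1%:R) * x + n.+1%:R * b).

Lemma bumpy_itvbump n a b : bumpy (itvbump n a b).
Proof. by do ?constructor. Qed.

Lemma itvbump_ge0 n a b x : 0 <= itvbump n a b x.
Proof. by rewrite mulr_ge0// flat_ge0. Qed.

Lemma itvbump_le1 n a b x : itvbump n a b x <= 1.
Proof. by rewrite /itvbump mulr_ile1// ?flat_ge0// flat0_le1. Qed.

Lemma itvbump_out n a b x : ~~ (a < x < b) -> itvbump n a b x = 0.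
Proof.
rewrite negb_and -!leNgt => /orP[xa|bx]; rewrite /itvbump.
  rewrite [X in X * _](_ : _ = 0) ?mul0r// /flat ifF//.
  by rewrite -mulrBr pmulr_rgt0// subr_gt0 ltNge xa.
rewrite [X in _ * X](_ : _ = 0) ?mulr0// /flat ifF//.
by rewrite mulNr addrC -mulrBr pmulr_rgt0// subr_gt0 ltNge bx.
Qed.

Lemma flat0_cvg1 (c : R) : 0 < c -> flat 0 (n.+1%:R * c) @[n --> \oo] --> (1 : R).
Proof.
move=> c0; rewrite -[X in _ --> X]expR0.
have E n : flat 0 (n.+1%:R * c) = expR (- (c^-1 * n.+1%:R^-1)).
  by rewrite /flat pmulr_rgt0// c0 expr0 mul1r invfM mulrC.
under eq_fun do rewrite E.
apply: continuous_cvg; first exact: continuous_expR.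
rewrite -oppr0; apply: cvgN; rewrite -[X in _ --> X](mulr0 c^-1).
by apply: cvgMr; exact: cvg_harmonic.
Qed.

Lemma itvbump_cvg1 a b x : a < x < b -> itvbump n a b x @[n --> \oo] --> (1 : R).
Proof.
move=> /andP[ax xb]; rewrite -[X in _ --> X](mulr1 1); apply: cvgM.
  under eq_fun do rewrite -mulrBr.
  by apply: flat0_cvg1; rewrite subr_gt0.
under eq_fun do rewrite mulNr addrC -mulrBr.
by apply: flat0_cvg1; rewrite subr_gt0.
Qed.

Context {N : nat}.
Local Notation mu := (@lebesgue_rV R N).
Implicit Types (a b c d x : 'rV[R]_N).

Definition boxbump (n : nat) a b : 'rV[R]_N -> R :=
  prodf (fun j => itvbump n (a ord0 j) (b ord0 j)).

Definition cbox a b : set 'rV[R]_N :=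
  [set x | forall i, a ord0 i <= x ord0 i <= b ord0 i].

Lemma compact_cbox a b : compact (cbox a b).
Proof.
rewrite (_ : cbox a b = [set v | forall i, `[a ord0 i, b ord0 i]%classic (v ord0 i)]).
  by apply: (@rV_compact _ _ (fun i => `[a ord0 i, b ord0 i]%classic)) => i; exact: segment_compact.
by apply/seteqP; split=> x xr i; have := xr i; rewrite /= in_itv/=.
Qed.

Lemma boxbump_ge0 n a b x : 0 <= boxbump n a b x.
Proof. by apply: prodr_ge0 => i _; exact: itvbump_ge0. Qed.

Lemma boxbump_le1 n a b x : boxbump n a b x <= 1.
Proof.
suff /andP[] : 0 <= boxbump n a b x <= 1 by [].
apply: (big_ind (fun u : R => 0 <= u <= 1)) => [|u v|i _].
- by rewrite ler01 lexx.
- by move=> /andP[? ?] /andP[? ?]; rewrite mulr_ge0// mulr_ile1.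
- by rewrite itvbump_ge0 itvbump_le1.
Qed.

Lemma boxbump_out n a b x : ~ obox a b x -> boxbump n a b x = 0.
Proof.
move=> /existsNP[i /negP xi]; rewrite /boxbump /prodf (bigD1 i)//=.
by rewrite itvbump_out// mul0r.
Qed.

Lemma boxbump_cvg a b x : boxbump n a b x @[n --> \oo] --> (\1_(obox a b) x : R).
Proof.
rewrite indicE; case: (boolP (x \in obox a b)) => [|/negP]; rewrite inE => xab.
  rewrite (_ : true%:R = \prod_(i < N) (1 : R)); last by rewrite big1.
  apply: (@cvg_big _ _ _ _ predT (@mul_continuous R)) => j _.
  exact: itvbump_cvg1.
by under eq_fun do rewrite boxbump_out//; exact: cvg_cst.
Qed.

Lemma test_boxbump (E : set 'rV[R]_N) n a b : cbox a b `<=` E ->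
  test_function E (boxbump n a b).
Proof.
move=> abE; split; first by apply: prodf_Ck => j; exact: bumpy_itvbump.
exists (cbox a b); split => //; first exact: compact_cbox.
move=> x xab; apply: boxbump_out => xo; apply: xab => i.
by have /andP[/ltW -> /ltW ->] := xo i.
Qed.

Lemma continuous_boxbump n a b : continuous (boxbump n a b).
Proof. by apply: prodf_continuous => j; exact: bumpy_itvbump. Qed.

(** The fundamental lemma of the calculus of variations, on a box: the bumps of a
    smaller box tend boundedly to its indicator, and the integrals over all
    smaller boxes determine an integrable function. *)
Lemma test_function_ae_eq (E : set 'rV[R]_N) c d (f g : 'rV[R]_N -> R) :
  cbox c d `<=` E ->
  mu.-integrable (obox c d) (EFin \o f) -> mu.-integrable (obox c d) (EFin \o g) ->
  (forall z, test_function E z -> (forall x, ~ obox c d x -> z x = 0) ->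
    (\int[mu]_(x in obox c d) (f x * z x)%:E = \int[mu]_(x in obox c d) (g x * z x)%:E)%E) ->
  ae_eq mu (obox c d) (EFin \o f) (EFin \o g).
Proof.
move=> cdE intf intg fg; apply: ae_eq_obox => // a b abcd.
(* The corners are clipped to those of the large box, so that the closed box of the
   bump stays in [E] even when [obox a b] is empty. *)
set a' := \row_i Num.max (a ord0 i) (c ord0 i); set b' := \row_i Num.min (b ord0 i) (d ord0 i).
have ab' : obox a b = obox a' b' by rewrite -obox_setI; exact/esym/setIidPl.
have abE : cbox a' b' `<=` cbox c d.
  by move=> x xab i; have := xab i; rewrite !mxE ge_max le_min => /andP[/andP[_ ->] /andP[_ ->]].
have mC := measurable_obox c d.
have lim (h : 'rV[R]_N -> R) : mu.-integrable (obox c d) (EFin \o h) ->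
    (\int[mu]_(x in obox c d) (h x * boxbump n a' b' x)%:E @[n --> \oo] -->
     \int[mu]_(x in obox a b) (h x)%:E)%E.
  move=> inth; have mh : measurable_fun (obox c d) h by apply/measurable_EFinP; exact: measurable_int inth.
  have [] := @dominated_convergence _ _ _ mu (obox c d) mC
    (fun n x => (h x * boxbump n a' b' x)%:E) (fun x => (h x * \1_(obox a b) x)%:E) (fun x => `|h x|%:E).
  - move=> n; apply/measurable_EFinP; apply: measurable_funM => //.
    by apply: measurable_funTS; apply: continuous_measurable_rV; exact: continuous_boxbump.
  - by apply/measurable_EFinP; apply: measurable_funM => //; apply: measurable_funTS; apply: measurable_indic; exact: measurable_obox.
  - apply: aeW => x _; apply: cvg_EFin; first exact: nearW.
    by apply: cvgMr; rewrite ab'; exact: boxbump_cvg.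
  - exact: integrable_norm inth.
  - apply: aeW => x n _; rewrite /= lee_fin normrM (ger0_norm (boxbump_ge0 _ _ _ _)).
    by apply: ler_piMr => //; exact: boxbump_le1.
  move=> _ _; rewrite [X in _ --> X](_ : _ = \int[mu]_(x in obox a b) (h x)%:E)%E//.
  have I : obox c d `&` obox a b = obox a b by apply/setIidPr.
  rewrite -[in RHS]I integral_mkcondr.
  by apply: eq_integral => x _; rewrite patchE indicE; case: ifP; rewrite ?mulr1 ?mulr0.
have := lim f intf; have := lim g intg.
under eq_fun.
  move=> n; rewrite -fg; last 2 first.
  - by apply: test_boxbump; exact: subset_trans cdE.
  - by move=> x xcd; rewrite boxbump_out// -ab' => /abcd.
  over.
move=> h1 h2; exact: cvg_unique h2 h1.
Qed.
End boxbump.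

(** * Translates of test functions *)
Section test_functions.
Context {R : realType} {N : nat}.
Local Notation mu := (@lebesgue_rV R N).
Implicit Types (E K : set 'rV[R]_N) (z f g : 'rV[R]_N -> R) (v x : 'rV[R]_N).

Lemma bounded_compact_support z K : continuous z -> compact K ->
  (forall x, ~ K x -> z x = 0) -> exists2 M : R, 0 <= M & forall x, `|z x| <= M.
Proof.
move=> cz cK zK.
have /compact_bounded[M [_ HM]] : compact (z @` K).
  by apply: continuous_compact => //; exact: continuous_subspaceT.
exists (`|M| + 1) => [|x]; first by rewrite addr_ge0.
have [Kx|nKx] := pselect (K x); last by rewrite zK// normr0 addr_ge0.
by apply: HM; [rewrite (le_lt_trans (ler_norm _))// ltrDl|exists x].
Qed.

Lemma derive_out z K v x : closed K -> (forall x, ~ K x -> z x = 0) -> ~ K x ->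
  'D_v z x = 0.
Proof.
move=> cK zK nKx; rewrite (near_eq_derive (g := cst 0)) ?derive_cst//.
have : open_nbhs x (~` K) by split => //; exact: closed_openC.
by move/open_nbhs_nbhs; apply: filterS => y; exact: zK.
Qed.

Lemma diff_quotient_shift z v h x :
  (fun t : R => t^-1 *: (((fun y : 'rV[R]_N => z (y + h)) \o shift x) (t *: v) - z (x + h))) =
  (fun t : R => t^-1 *: ((z \o shift (x + h)) (t *: v) - z (x + h))).
Proof. by apply/funext => t /=; rewrite addrA. Qed.

Lemma derivable_shift_rV z v h x : derivable z (x + h) v ->
  derivable (fun y => z (y + h)) x v.
Proof. by rewrite /derivable diff_quotient_shift. Qed.

Lemma derive_shift_rV z v h x : 'D_v (fun y => z (y + h)) x = 'D_v z (x + h).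
Proof. by rewrite /derive diff_quotient_shift. Qed.

Lemma continuous_shift_rV z (h : 'rV[R]_N) : continuous z ->
  continuous (fun y : 'rV[R]_N => z (y + h)).
Proof.
move=> cz x; apply: continuous_comp; last exact: cz.
by apply: (@cvgD R 'rV[R]_N _ (nbhs x) _ id (cst h) x h); [exact: cvg_id|exact: cvg_cst].
Qed.

Lemma Ck_shift k z (h : 'rV[R]_N) : Ck k z -> Ck k (fun y => z (y + h)).
Proof.
elim: k z => [|k IH] z /=; first exact: continuous_shift_rV.
move=> [cz Hz]; split=> [|i]; first exact: continuous_shift_rV.
have [dz Cz] := Hz i; split=> [x|]; first exact: derivable_shift_rV.
rewrite (_ : partial i _ = fun y => partial i z (y + h)); first exact: IH.
by apply/funext => x; rewrite /partial derive_shift_rV.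
Qed.

Lemma test_function_continuous E z : test_function E z -> continuous z.
Proof. by move=> [/(_ 0%N)]. Qed.

Lemma test_function_derivable E z i x : test_function E z ->
  derivable z x (delta_mx ord0 i).
Proof. by move=> [/(_ 1%N) [_ /(_ i)[]]]. Qed.

Lemma test_function_partial_continuous E z i : test_function E z ->
  continuous (partial i z).
Proof. by move=> [/(_ 1%N) [_ /(_ i)[]]]. Qed.

Lemma integrable_mul_bounded (D : set 'rV[R]_N) f z M : measurable D ->
  mu.-integrable D (EFin \o f) -> measurable_fun D z -> (forall x, `|z x| <= M) ->
  mu.-integrable D (fun x => (f x * z x)%:E).
Proof.
move=> mD intf mz zM.
have mf : measurable_fun D f by apply/measurable_EFinP; exact: measurable_int intf.
apply: (le_integrable mD _ _ (integrableZl mD M intf)).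
  by apply/measurable_EFinP; exact: measurable_funM.
move=> x _ /=; rewrite lee_fin !normrM mulrC ler_wpM2r//.
by rewrite (le_trans (zM x))// ler_norm.
Qed.

Lemma integrable_indicM (D : set 'rV[R]_N) f : measurable D ->
  mu.-integrable D (EFin \o f) -> mu.-integrable setT (EFin \o (fun x => f x * \1_D x)).
Proof.
move=> mD intf; have := (integrable_mkcond (EFin \o f) mD).1 intf.
apply: eq_integrable => // x _.
by rewrite patchE /= indicE; case: ifP; rewrite ?mulr1 ?mulr0.
Qed.

Lemma measurable_fun_shift_cont z h : continuous z ->
  measurable_fun setT (fun x => z (x + h)).
Proof. by move=> cz; apply: measurable_fun_shift; exact: continuous_measurable_rV. Qed.

Lemma is_derive_line z v x (s : R) : derivable z (x + s *: v) v ->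
  is_derive s 1 (fun s => z (x + s *: v)) ('D_v z (x + s *: v)).
Proof.
move=> dz.
have E : (fun h : R => h^-1 *: (((fun s => z (x + s *: v)) \o shift s) (h *: 1) - z (x + s *: v))) =
   (fun h : R => h^-1 *: ((z \o shift (x + s *: v)) (h *: v) - z (x + s *: v))).
  apply/funext => h /=; congr (_ *: (z _ - _)).
  by rewrite [h *: 1]mulr1 scalerDl addrCA.
apply: DeriveDef; first by rewrite /derivable E.
by rewrite /derive E.
Qed.

(** Differentiation under the integral sign, with the constant [M'] times [|f|] as
    the dominating function. *)
Lemma is_derive_int_transl f z v (M M' s : R) :
  mu.-integrable setT (EFin \o f) -> continuous z ->
  (forall x, derivable z x v) ->
  (forall x, `|z x| <= M) -> (forall x, `|'D_v z x| <= M') ->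
  is_derive s 1 (fun s => \int[mu]_x (f x * z (x + s *: v)))
                (\int[mu]_x (f x * 'D_v z (x + s *: v))).
Proof.
move=> intf cz dz zM DzM.
pose F s x := f x * z (x + s *: v).
have sI : `]s - 1, s + 1[%classic s by rewrite /= in_itv/= ltrDl ltr01 andbT ltrBlDr ltrDl ltr01.
have D (t : R) x : is_derive t (1 : R) (F^~ x) (f x * 'D_v z (x + t *: v)).
  have := is_deriveZ (f x) (is_derive_line (dz (x + t *: v))).
  by [].
have H1 (t : R) : `]s - 1, s + 1[%classic t -> mu.-integrable setT (EFin \o F t).
  move=> _; apply: (@integrable_mul_bounded _ _ _ M) => //.
  exact: measurable_fun_shift_cont.
have H2 (t : R) x : `]s - 1, s + 1[%classic t -> [set: 'rV[R]_N] x -> derivable (F^~ x) t 1.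
  by move=> _ _; have [] := D t x.
pose G x := `|f x| * M'.
have M'0 : 0 <= M' by exact: le_trans (DzM 0).
have G0 x : 0 <= G x by rewrite mulr_ge0.
have intG : mu.-integrable setT (EFin \o G).
  have := integrableZl measurableT M' (integrable_norm intf).
  by apply: eq_integrable => // x _; rewrite /= /G -EFinM mulrC.
have GF (t : R) x : `]s - 1, s + 1[%classic t -> [set: 'rV[R]_N] x -> `|partial1of2 F t x| <= G x.
  move=> _ _; rewrite partial1of2E; have [_ ->] := D t x.
  by rewrite normrM ler_wpM2l.
apply: DeriveDef; first exact: (derivable_under_integral measurableT sI H1 H2 G0 intG GF).
rewrite -derive1E (differentiation_under_integral measurableT sI H1 H2 G0 intG GF).
by apply: eq_Rintegral => x _; rewrite partial1of2E; have [_ ->] := D s x.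
Qed.

Lemma continuous_int_transl g z v (M : R) :
  mu.-integrable setT (EFin \o g) -> continuous z -> (forall x, `|z x| <= M) ->
  continuous (fun s : R => \int[mu]_x (g x * z (x + s *: v))).
Proof.
move=> intg cz zM s.
have M0 : 0 <= M by exact: le_trans (zM 0).
have := @continuity_under_integral R _ _ mu (fun s x => g x * z (x + s *: v)) setT measurableT
  (s - 1) (s + 1) _ _ (fun x => `|g x| * M).
move=> /(_ _ _ _ _ s); apply.
- move=> t _; apply: (@integrable_mul_bounded _ _ _ M) => //.
  exact: measurable_fun_shift_cont.
- apply: aeW => x _ t _; apply: continuousM; first exact: cvg_cst.
  apply: continuous_comp; last exact: cz.
  apply: cvgD; first exact: cvg_cst.
  by apply: cvgZr_tmp.
- have := integrableZl measurableT M (integrable_norm intg).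
  by apply: eq_integrable => // x _; rewrite /= -EFinM mulrC.
- by move=> t _; apply: aeW => x _; rewrite normrM ler_wpM2l.
- by rewrite inE /= in_itv/= ltrDl ltr01 andbT ltrBlDr ltrDl ltr01.
Qed.
End test_functions.

(** * Increments of weakly differentiable functions *)
Section increments.
Context {R : realType} {N : nat}.
Local Notation mu := (@lebesgue_rV R N).
Local Notation lam := (@lebesgue_measure R).
Implicit Types (E K : set 'rV[R]_N) (z f g : 'rV[R]_N -> R) (v x : 'rV[R]_N).

Lemma measurable_transl_pair v :
  measurable_fun setT (fun xs : 'rV[R]_N * R => xs.1 - xs.2 *: v).
Proof.
apply: measurable_fun_rV => i.
rewrite (_ : (fun _ => _) = (fun xs : 'rV[R]_N * R => rV_coord i xs.1 - xs.2 * v ord0 i)); last first.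
  by apply/funext => xs; rewrite !mxE.
apply: measurable_funB; first by apply: measurableT_comp => //; exact: measurable_rV_coord.
by apply: measurable_funM.
Qed.

(** The segment lies on the negative side because line integrals are written with
    [x - s *: v]. *)
Definition bseg (t : R) : set R := `[- t, 0]%classic.

Lemma measurable_bseg t : measurable (bseg t).
Proof. exact: measurable_itv. Qed.

Lemma lebesgue_bseg t : 0 < t -> lam (bseg t) = t%:E.
Proof.
move=> t0; rewrite /bseg lebesgue_measure_itv/= lte_fin oppr_lt0 t0.
by rewrite -EFinB opprK add0r.
Qed.

Definition line_integral v (t : R) (g : 'rV[R]_N -> R) x : R :=
  \int[lam]_(s in bseg t) g (x - s *: v).

(** Fubini's theorem for [(x, s) |-> g (x - s v)]. *)
Section fubini_line.
Context (v : 'rV[R]_N) (t : R) (t0 : 0 < t) (g : 'rV[R]_N -> R).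
Let mI := measurable_bseg t.
Hypothesis intg : mu.-integrable setT (EFin \o g).
Let F (xs : 'rV[R]_N * R) : \bar R := (g (xs.1 - xs.2 *: v) * \1_(bseg t) xs.2)%:E.

Let mg : measurable_fun setT g.
Proof. by apply/measurable_EFinP; exact: measurable_int intg. Qed.

Let mF : measurable_fun setT F.
Proof.
apply/measurable_EFinP; apply: measurable_funM.
  by apply: measurableT_comp => //; exact: measurable_transl_pair.
by apply: measurableT_comp => //; exact: measurable_indic.
Qed.

Let intF : (mu \x lam)%E.-integrable setT F.
Proof.
apply/integrable21ltyP => //.
have /integrableP[_ goo] := intg.
have E s : (\int[mu]_x `|F (x, s)| = (\int[mu]_x `|(g x)%:E|) * (\1_(bseg t) s)%:E)%E.
  rewrite -(ge0_integral_shiftT (- (s *: v)) (f := fun x => `|(g x)%:E|%E))//; last first.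
    by apply: measurableT_comp => //; exact/measurable_EFinP.
  rewrite muleC -ge0_integralZl//.
  - by apply: eq_integral => x _; rewrite /F /= normrM -EFinM mulrC; congr (_ * _)%:E; rewrite ger0_norm.
  - apply: measurableT_comp => //; apply/measurable_EFinP.
    exact: measurable_fun_shift.
under eq_integral do rewrite E.
rewrite ge0_integralZl//; last 2 first.
- exact/measurable_EFinP/measurable_indic.
- exact: integral_ge0.
rewrite integral_indic// setIT [X in (_ * X)%E](lebesgue_bseg t0).
have gfin : (\int[mu]_x `|(g x)%:E|)%E \is a fin_num by rewrite ge0_fin_numE// integral_ge0.
by rewrite -(fineK gfin) -EFinM ltry.
Qed.

Let QE x : (\int[lam]_s F (x, s) = \int[lam]_(s in bseg t) (g (x - s *: v))%:E)%E.
Proof.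
rewrite [RHS]integral_mkcond; apply: eq_integral => s _.
by rewrite patchE /F /= indicE; case: ifP; rewrite ?mulr1 ?mulr0.
Qed.

Let intQ : mu.-integrable setT (fun x => \int[lam]_(s in bseg t) (g (x - s *: v))%:E)%E.
Proof.
have := integrable_fubini_F intF; apply: eq_integrable => // x _.
by rewrite -QE.
Qed.

Lemma integrable_line_integral : mu.-integrable setT (EFin \o line_integral v t g).
Proof.
have /measurable_int mQ := intQ.
apply: le_integrable intQ => //.
  by apply/measurable_EFinP; apply: measurableT_comp => //; exact: measurable_fine.
move=> x _ /=; rewrite /line_integral /Rintegral.
by case: (\int[_]_(_ in _) _)%E => [r| |] //=; rewrite ?normr0 ?leey// lee_fin.
Qed.

Lemma line_integral_test z M : continuous z -> (forall x, `|z x| <= M) ->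
  (\int[mu]_x (line_integral v t g x * z x)%:E =
   \int[lam]_(s in bseg t) \int[mu]_x (g (x - s *: v) * z x)%:E)%E.
Proof.
move=> cz zM; have mz : measurable_fun setT z by exact: continuous_measurable_rV.
have M0 : 0 <= M by exact: le_trans (zM 0).
pose F1 (xs : 'rV[R]_N * R) : \bar R := ((z xs.1)%:E * F xs)%E.
have intF1 : (mu \x lam)%E.-integrable setT F1.
  have mF1 : measurable_fun setT F1.
    apply: emeasurable_funM => //; apply/measurable_EFinP.
    by apply: measurableT_comp.
  apply: le_integrable (integrableZl measurableT M intF) => // xs _.
  by rewrite /F1 !abseM lee_wpmul2r// lee_fin (le_trans (zM _))// ler_norm.
transitivity (\int[mu]_x \int[lam]_s F1 (x, s))%E.
  apply: ae_eq_integral => //.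
  - apply/measurable_EFinP; apply: measurable_funM => //.
    by apply/measurable_EFinP; exact: measurable_int integrable_line_integral.
  - exact: measurable_fubini_F intF1.
  have := ae_integrable1 intF; apply: filterS => x intFx _.
  rewrite /F1 /= integralZl// QE /line_integral /Rintegral EFinM fineK 1?muleC//.
  rewrite -QE; exact: integrable_fin_num.
rewrite (Fubini intF1) [RHS]integral_mkcond; apply: eq_integral => s _.
rewrite patchE; case: ifP => sI.
  by apply: eq_integral => x _; rewrite /F1 /F /= indicE sI mulr1 -EFinM mulrC.
by apply: integral0_eq => x _; rewrite /F1 /F /= indicE sI mulr0 mule0.
Qed.
End fubini_line.

Lemma Lp_loc1_integrable E f K : open E -> Lp_loc E 1 f -> compact K -> K `<=` E ->
  mu.-integrable K (EFin \o f).
Proof.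
move=> oE [mf foo] cK KE; have mK := compact_measurable_rV cK.
have mfK : measurable_fun K f by apply: measurable_funS mf => //; exact: open_measurable_rV.
apply/integrableP; split; first exact/measurable_EFinP.
apply: le_lt_trans (foo K cK KE).
by rewrite le_eqVlt; apply/orP; left; apply/eqP; apply: eq_integral => x _; rewrite powRr1.
Qed.

Lemma integral_support (D : set 'rV[R]_N) f z : (forall x, ~ D x -> z x = 0) ->
  (\int[mu]_(x in D) (f x * z x)%:E = \int[mu]_x (f x * z x)%:E)%E.
Proof.
move=> z0; rewrite integral_mkcond; apply: eq_integral => x _.
by rewrite patchE; case: ifPn => // /negP; rewrite inE => /z0 ->; rewrite mulr0.
Qed.

Lemma fine_Rintegral (D : set 'rV[R]_N) f : measurable D -> mu.-integrable D (EFin \o f) ->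
  (\int[mu]_(x in D) (f x)%:E = (\int[mu]_(x in D) f x)%R%:E)%E.
Proof. by move=> mD intf; rewrite /Rintegral fineK//; exact: integrable_fin_num intf. Qed.

Local Notation dir i := (delta_mx ord0 i : 'rV[R]_N).

Lemma cbox_shift (c d x : 'rV[R]_N) i (r t : R) : 0 <= r -> r <= t -> cbox c d x ->
  cbox c (d + t *: dir i) (x + r *: dir i).
Proof.
move=> r0 rt cdx j; have /andP[cx xd] := cdx j; rewrite !mxE.
have v0 : (0 : R) <= (((ord0 : 'I_1) == ord0) && (j == i))%:R by [].
rewrite (le_trans cx) ?lerDl ?mulr_ge0//=.
by apply: lerD => //; exact: ler_wpM2r.
Qed.

(** Moving the test function along [dir i] by [s], the integral [A s] of
    [w' z (x + s v)] has the derivative [- B s], where [B] is the same integral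
    with the weak derivative in place of [w']: this is the definition of the weak
    derivative.  The claim is the fundamental theorem of calculus on [[- t, 0]]
    followed by Fubini's theorem. *)
Lemma weak_increment_test E w Dw i c d t z : open E -> weak_gradient E w Dw ->
  0 < t -> cbox c (d + t *: dir i) `<=` E ->
  test_function E z -> (forall x, ~ obox c d x -> z x = 0) ->
  let C := cbox c (d + t *: dir i) in
  let w' x := w x * \1_C x in
  let g' x := Dw x ord0 i * \1_C x in
  (\int[mu]_x ((w' (x + t *: dir i) - w' x) * z x)%:E =
   \int[mu]_x (line_integral (dir i) t g' x * z x)%:E)%E.
Proof.
move=> oE [w1 g1 wg] t0 CE tz z0 C w' g'.
have cC : compact C by exact: compact_cbox.
have mC : measurable C by exact: compact_measurable_rV.
have intw' : mu.-integrable setT (EFin \o w').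
  by apply: (integrable_indicM mC); exact: (Lp_loc1_integrable oE w1 cC CE).
have intg' : mu.-integrable setT (EFin \o g').
  by apply: (@integrable_indicM _ _ C (fun x => Dw x ord0 i) mC); exact: (Lp_loc1_integrable oE (g1 i) cC CE).
have cz := test_function_continuous tz.
have dz x : derivable z x (dir i) by exact: test_function_derivable tz.
have cpz : continuous (partial i z) by exact: test_function_partial_continuous tz.
have mz : measurable_fun setT z by exact: continuous_measurable_rV.
have cbox_z x : ~ cbox c d x -> z x = 0.
  by move=> ncd; apply: z0 => ocd; apply: ncd => j; have /andP[/ltW -> /ltW ->] := ocd j.
have ccd : closed (cbox c d) by apply: compact_closed; [exact: hausdorff_rV|exact: compact_cbox].
have ccb : compact (cbox c d) by exact: compact_cbox.
have [M M0 zM] := bounded_compact_support cz ccb cbox_z.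
have [M' M'0 pzM] := bounded_compact_support cpz ccb
  (fun x => derive_out (dir i) ccd cbox_z).
pose A s := \int[mu]_x (w' x * z (x + s *: dir i)).
pose B s := \int[mu]_x (g' x * z (x + s *: dir i)).
have intwz s : mu.-integrable setT (fun x => (w' x * z (x + s *: dir i))%:E).
  by apply: (integrable_mul_bounded (M := M)) => //; exact: measurable_fun_shift_cont.
have intgz s : mu.-integrable setT (fun x => (g' x * z (x + s *: dir i))%:E).
  by apply: (integrable_mul_bounded (M := M)) => //; exact: measurable_fun_shift_cont.
have dA (s : R) : is_derive s (1 : R) A (\int[mu]_x (w' x * partial i z (x + s *: dir i))).
  exact: (is_derive_int_transl (M := M) (M' := M')).
have cA : continuous A.
  by move=> s; apply: differentiable_continuous; apply/derivable1_diffP; have [] := dA s.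
have cB : continuous B by exact: (continuous_int_transl (M := M)).
have AB (s : R) : bseg t s -> \int[mu]_x (w' x * partial i z (x + s *: dir i)) = - B s.
  rewrite /bseg /= in_itv/= => /andP[ts s0].
  have inC x : cbox c d (x + s *: dir i) -> C x.
    move=> /(@cbox_shift _ _ _ i (- s) t); rewrite scaleNr addrK; apply.
      by rewrite oppr_ge0.
    by rewrite lerNl.
  have tzs : test_function E (fun x => z (x + s *: dir i)).
    split=> [k|]; first by apply: Ck_shift; case: tz.
    by exists C; split => // x nCx; apply: cbox_z => /inC.
  have := wg _ tzs i.
  have -> : (\int[mu]_(x in E) (w x * partial i (fun y => z (y + s *: dir i)) x)%:E =
     \int[mu]_x (w' x * partial i z (x + s *: dir i))%:E)%E.
    rewrite integral_mkcond; apply: eq_integral => x _.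
    rewrite patchE /w' indicE /partial derive_shift_rV.
    have [xC|nxC] := boolP (x \in C).
      by rewrite mem_set ?mulr1//; apply: CE; rewrite inE in xC.
    rewrite (derive_out _ ccd cbox_z) ?mulr0 ?if_same//.
    by move=> /inC Cx; move: nxC; rewrite mem_set.
  have -> : (\int[mu]_(x in E) (Dw x ord0 i * z (x + s *: dir i))%:E =
     \int[mu]_x (g' x * z (x + s *: dir i))%:E)%E.
    rewrite integral_mkcond; apply: eq_integral => x _.
    rewrite patchE /g' indicE.
    have [xC|nxC] := boolP (x \in C).
      by rewrite mem_set ?mulr1//; apply: CE; rewrite inE in xC.
    rewrite (cbox_z (x + s *: dir i)) ?mulr0 ?if_same//.
    by move=> /inC Cx; move: nxC; rewrite mem_set.
  by rewrite /Rintegral => ->; rewrite /B /Rintegral fineN.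
have FTC : (\int[lam]_(s in bseg t) (- B s)%:E = (A 0)%:E - (A (- t))%:E)%E.
  apply: continuous_FTC2; first by rewrite oppr_lt0.
  - by apply: continuous_subspaceT => s; apply: continuousN; exact: cB.
  - split.
    + by move=> s _; have [] := dA s.
    + by apply: cvg_at_right_filter; exact: cA.
    + by apply: cvg_at_left_filter; exact: cA.
  - move=> s sI; rewrite derive1E; have [_ ->] := dA s.
    apply: AB; move: sI; rewrite /bseg /= !in_itv/= => /andP[/ltW -> /ltW ->]//.
have intBN : lam.-integrable (bseg t) (EFin \o (fun s => - B s)).
  apply: continuous_compact_integrable; first exact: segment_compact.
  by apply: continuous_subspaceT => s; apply: continuousN; exact: cB.
rewrite (line_integral_test (dir i) t0 intg' cz zM).
transitivity (\int[lam]_(s in bseg t) (B s)%:E)%E; last first.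
  apply: eq_integral => s _; rewrite /B -fine_Rintegral//; last exact: intgz.
  have := integral_shift (s *: dir i) (f := fun x => (g' (x - s *: dir i) * z x)%:E).
  rewrite /= => <-.
    by apply: eq_integral => x _; rewrite addrK.
  have := integrable_shift (- (s *: dir i)) (intgz s).
  by apply: eq_integrable => // x _; rewrite /= subrK.
have -> : (\int[lam]_(s in bseg t) (B s)%:E = (A (- t))%:E - (A 0)%:E)%E.
  transitivity (\int[lam]_(s in bseg t) ((-1)%:E * (- B s)%:E))%E.
    by apply: eq_integral => s _; rewrite -EFinM mulrNN mul1r.
  rewrite integralZl//; last exact: measurable_bseg.
  by rewrite FTC -!EFinB -EFinM mulN1r opprB.
rewrite /A -!fine_Rintegral//; [|exact: intwz|exact: intwz].
have Hs : (\int[mu]_x (w' x * z (x + - t *: dir i))%:E = \int[mu]_x (w' (x + t *: dir i) * z x)%:E)%E.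
  rewrite -(integral_shift (t *: dir i) (intwz (- t))).
  by apply: eq_integral => x _; rewrite scaleNr addrK.
rewrite Hs -integralB//; last 1 first.
  have := integrable_shift (t *: dir i) (intwz (- t)).
  by apply: eq_integrable => // x _; rewrite /= scaleNr addrK.
by apply: eq_integral => x _; rewrite -EFinB scale0r addr0 mulrBl.
Qed.

(** By [weak_increment_test] both sides have the same integrals against test
    functions, so the fundamental lemma applies. *)
Lemma weak_increment E w Dw i c d t : open E -> weak_gradient E w Dw ->
  0 < t -> cbox c (d + t *: dir i) `<=` E ->
  {ae mu, forall x, obox c d x ->
    w (x + t *: dir i) - w x = line_integral (dir i) t (fun x => Dw x ord0 i) x}.
Proof.
move=> oE wDw t0 CE; have [w1 g1 _] := wDw.
pose C := cbox c (d + t *: dir i).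
(* Truncation makes both functions integrable on the whole space; on the segments
   that matter it changes nothing. *)
pose w' x := w x * \1_C x.
pose g' x := Dw x ord0 i * \1_C x.
have cC : compact C by exact: compact_cbox.
have mC : measurable C by exact: compact_measurable_rV.
have intw' : mu.-integrable setT (EFin \o w').
  by apply: (integrable_indicM mC); exact: (Lp_loc1_integrable oE w1 cC CE).
have intg' : mu.-integrable setT (EFin \o g').
  by apply: (@integrable_indicM _ _ C (fun x => Dw x ord0 i) mC); exact: (Lp_loc1_integrable oE (g1 i) cC CE).
have mO := measurable_obox c d.
have := @test_function_ae_eq R N E c d (fun x => w' (x + t *: dir i) - w' x) (line_integral (dir i) t g').
have sub0 x : obox c d x -> cbox c d x.
  by move=> ocd j; have /andP[/ltW -> /ltW ->] := ocd j.
have subC x r : obox c d x -> 0 <= r -> r <= t -> C (x + r *: dir i).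
  by move=> /sub0 cdx r0 rt; exact: cbox_shift.
move=> /(_ _ _ _ _)/wrap[].
- move=> x cdx; apply: CE; have := @cbox_shift c d x i 0 t (lexx 0) (ltW t0) cdx.
  by rewrite scale0r addr0.
- apply: integrableS measurableT _ _ _ => //.
  rewrite (_ : EFin \o _ = (fun x => (w' (x + t *: dir i))%:E - (w' x)%:E)%E)//.
  by apply: integrableB => //; exact: (integrable_shift (t *: dir i) intw').
- apply: integrableS measurableT _ _ _ => //; exact: integrable_line_integral.
- move=> z tz z0; rewrite (integral_support _ z0) (integral_support _ z0).
  exact: (weak_increment_test oE wDw t0 CE tz z0).
apply: filterS => x H ox; have := H ox; rewrite /= => -[].
rewrite /w' !indicE !mem_set; last 2 first.
- by have := subC x 0 ox (lexx _) (ltW t0); rewrite scale0r addr0.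
- exact: subC ox (ltW t0) (lexx _).
rewrite !mulr1 => ->; apply: eq_Rintegral => s; rewrite inE /bseg/= in_itv/= => /andP[ts s0].
rewrite /g' indicE mem_set ?mulr1// -scaleNr; apply: subC => //; by [rewrite oppr_ge0|rewrite lerNl].
Qed.
End increments.

(** * Integral inequalities *)
Section power_mean.
Context d (T : measurableType d) (R : realType) (mu : {measure set T -> \bar R}).

(** Young's inequality with exponents [p] and [p / (p - 1)]. *)
Lemma young_powR (p a b : R) : 1 < p -> 0 <= a -> 0 <= b ->
  p * (a * b `^ (p - 1)) <= a `^ p + (p - 1) * b `^ p.
Proof.
move=> p1 a0 b0; have p0 : 0 < p by apply: lt_trans p1.
have p10 : 0 < p - 1 by rewrite subr_gt0.
have q0 : 0 < p / (p - 1) by rewrite divr_gt0.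
have pq : p^-1 + (p / (p - 1))^-1 = 1 by field; rewrite !gt_eqF.
have := conjugate_powR a0 (powR_ge0 b (p - 1)) p0 q0 pq.
rewrite -powRrM mulrCA divff ?gt_eqF// mulr1 => h.
have := ler_wpM2l (ltW p0) h; rewrite mulrDr => h2.
apply: le_trans h2 _; rewrite mulrCA divff ?gt_eqF// mulr1 lerD2l.
rewrite le_eqVlt; apply/orP; left; apply/eqP; field; by rewrite !gt_eqF.
Qed.

Lemma le_1D_powR (p a : R) : 1 < p -> 0 <= a -> a <= 1 + a `^ p.
Proof.
move=> p1 a0; have [a1|/ltW a1] := leP a 1; first by rewrite (le_trans a1)// lerDl powR_ge0.
by rewrite -[leLHS]add0r lerD//; apply: le1r_powR => //; exact: ltW.
Qed.

Lemma measurable_norm_powR (D : set T) (f : T -> R) (p : R) : measurable_fun D f ->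
  measurable_fun D (fun x => `|f x| `^ p).
Proof.
move=> mf; apply: (measurableT_comp (measurable_powR p)).
exact: measurableT_comp.
Qed.

Lemma powR_predr (t p : R) : 0 < t -> t `^ p = t `^ (p - 1) * t.
Proof.
move=> t0; rewrite -[X in _ * X](powRr1 (ltW t0)) -powRD ?subrK//.
by rewrite (gt_eqF t0) implybT.
Qed.

(** Hoelder's inequality for the constant function [1].  It follows from Young's
    inequality with the mean value [A] of [|h|] as the second factor. *)
Lemma powR_Rintegral_le (D : set T) (h : T -> R) (p t : R) : measurable D ->
  measurable_fun D h -> 1 < p -> 0 < t -> mu D = t%:E ->
  ((`|\int[mu]_(s in D) h s| `^ p)%:E <=
   (t `^ (p - 1))%:E * \int[mu]_(s in D) (`|h s| `^ p)%:E)%E.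
Proof.
move=> mD mh p1 t0 Dt.
have p0 : 0 < p by apply: lt_trans p1.
have mhp : measurable_fun D (fun s => (`|h s| `^ p)%:E).
  apply/measurable_EFinP; exact: measurable_norm_powR.
have I0 : (0 <= \int[mu]_(s in D) (`|h s| `^ p)%:E)%E by apply: integral_ge0 => x _; rewrite lee_fin powR_ge0.
have [Ioo|] := ltP (\int[mu]_(s in D) (`|h s| `^ p)%:E)%E +oo%E; last first.
  by rewrite leye_eq => /eqP ->; rewrite gt0_muley ?leey// lte_fin powR_gt0.
have inthp : mu.-integrable D (EFin \o (fun s => `|h s| `^ p)).
  apply/integrableP; split => //; apply: le_lt_trans Ioo.
  by rewrite le_eqVlt; apply/orP; left; apply/eqP; apply: eq_integral => x _ /=; rewrite ger0_norm ?powR_ge0.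
have intc (c : R) : mu.-integrable D (EFin \o cst c).
  apply/integrableP; split; first exact/measurable_EFinP.
  rewrite (eq_integral (cst (`|c|)%:E))//; first by rewrite integral_cst// Dt -EFinM ltry.
have inth : mu.-integrable D (EFin \o h).
  apply: (@le_integrable _ _ _ mu D mD _ (EFin \o (fun s => 1 + `|h s| `^ p))).
  - exact/measurable_EFinP.
  - move=> x _ /=; rewrite lee_fin [leRHS]ger0_norm ?addr_ge0 ?powR_ge0//.
    exact: le_1D_powR.
  - by have := integrableD mD (intc 1) inthp.
have intnh : mu.-integrable D (EFin \o (fun s => `|h s|)) by exact: integrable_norm inth.
pose a := \int[mu]_(s in D) `|h s|.
have a0 : 0 <= a by apply: Rintegral_ge0.
apply: (@le_trans _ _ (a `^ p)%:E).
  by rewrite lee_fin ge0_ler_powR ?nnegrE ?(ltW p0)//; exact: le_normr_Rintegral.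
pose A := a / t.
have A0 : 0 <= A by rewrite divr_ge0// ltW.
have {}Iint : (\int[mu]_(s in D) (`|h s| `^ p)%:E = (\int[mu]_(s in D) (`|h s| `^ p))%R%:E)%E.
  by rewrite /Rintegral fineK//; exact: integrable_fin_num inthp.
rewrite Iint -EFinM lee_fin.
have H : \int[mu]_(s in D) (p * (`|h s| * A `^ (p - 1))) <=
         \int[mu]_(s in D) (`|h s| `^ p + (p - 1) * A `^ p).
  apply: le_Rintegral => //.
  - have := integrableZl mD (p * A `^ (p - 1)) intnh.
    by apply: eq_integrable => // x _; rewrite /= -EFinM mulrAC mulrA.
  - by have := integrableD mD inthp (intc ((p - 1) * A `^ p)).
  - by move=> x _; exact: young_powR.
have : p * A `^ (p - 1) * a <= \int[mu]_(s in D) (`|h s| `^ p) + (p - 1) * A `^ p * t.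
  move: H; under eq_Rintegral do rewrite mulrA mulrAC.
  rewrite RintegralZl// RintegralD//; last exact: intc.
  by rewrite Rintegral_cst// Dt.
have aE : a = A * t by rewrite divfK ?gt_eqF.
have ApE : A `^ p = A `^ (p - 1) * A.
  have [->|An0] := eqVneq A 0; first by rewrite powR0 ?gt_eqF// mulr0.
  have -> : p = (p - 1) + 1 by ring.
  by rewrite powRD ?An0 ?implybT// addrK powRr1.
move=> K; have {}K : t * A `^ p <= \int[mu]_(s in D) (`|h s| `^ p).
  by move: K; rewrite aE ApE; lra.
have -> : a `^ p = t `^ (p - 1) * (t * A `^ p).
  rewrite aE powRM// ?(ltW t0)// mulrC mulrA; congr (_ * _).
  exact: powR_predr.
by apply: ler_wpM2l => //; exact: powR_ge0.
Qed.
End power_mean.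

Lemma tonelli_set d1 d2 (T1 : measurableType d1) (T2 : measurableType d2) (R : realType)
    (m1 : {sigma_finite_measure set T1 -> \bar R})
    (m2 : {sigma_finite_measure set T2 -> \bar R}) (D1 : set T1) (D2 : set T2)
    (F : T1 * T2 -> \bar R) :
  measurable D1 -> measurable D2 -> measurable_fun setT F -> (forall z, 0 <= F z)%E ->
  (\int[m1]_(x in D1) \int[m2]_(y in D2) F (x, y) =
   \int[m2]_(y in D2) \int[m1]_(x in D1) F (x, y))%E.
Proof.
move=> mD1 mD2 mF F0.
pose G z := (F z * (\1_D1 z.1 * \1_D2 z.2)%:E)%E.
have mG : measurable_fun setT G.
  apply: emeasurable_funM => //; apply/measurable_EFinP; apply: measurable_funM.
    by apply: measurableT_comp => //; exact: measurable_indic.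
  by apply: measurableT_comp => //; exact: measurable_indic.
have G0 z : (0 <= G z)%E by rewrite mule_ge0// lee_fin mulr_ge0.
have := @fubini_tonelli _ _ T1 T2 R m1 m2 G mG G0.
have -> : (\int[m1]_x \int[m2]_y G (x, y) = \int[m1]_(x in D1) \int[m2]_(y in D2) F (x, y))%E.
  rewrite [RHS]integral_mkcond; apply: eq_integral => x _.
  rewrite patchE; case: ifPn => xD.
    rewrite [RHS]integral_mkcond; apply: eq_integral => y _.
    by rewrite patchE /G /= !indicE xD mul1r; case: ifP; rewrite ?mule1 ?mule0.
  by apply: integral0_eq => y _; rewrite /G /= !indicE (negPf xD) mul0r mule0.
move=> ->.
rewrite [RHS]integral_mkcond; apply: eq_integral => y _.
rewrite patchE; case: ifPn => yD.
  rewrite [RHS]integral_mkcond; apply: eq_integral => x _.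
  by rewrite patchE /G /= !indicE yD mulr1; case: ifP; rewrite ?mule1 ?mule0.
by apply: integral0_eq => x _; rewrite /G /= !indicE (negPf yD) mulr0 mule0.
Qed.

Lemma measurable_integral_set d1 d2 (T1 : measurableType d1) (T2 : measurableType d2)
    (R : realType) (m2 : {sigma_finite_measure set T2 -> \bar R}) (D2 : set T2)
    (F : T1 * T2 -> \bar R) :
  measurable D2 -> measurable_fun setT F -> (forall z, 0 <= F z)%E ->
  measurable_fun setT (fun x => \int[m2]_(y in D2) F (x, y))%E.
Proof.
move=> mD2 mF F0.
pose G z := (F z * (\1_D2 z.2)%:E)%E.
have mG : measurable_fun setT G.
  apply: emeasurable_funM => //; apply/measurable_EFinP.
  by apply: measurableT_comp => //; exact: measurable_indic.
have G0 z : (0 <= G z)%E by rewrite mule_ge0// lee_fin.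
have := measurable_fun_fubini_tonelli_F (m2 := m2) G mG G0.
congr measurable_fun; apply/funext => x; rewrite /fubini_F [RHS]integral_mkcond.
apply: eq_integral => y _.
by rewrite patchE /G /= indicE; case: ifP; rewrite ?mule1 ?mule0.
Qed.

Lemma measurable_integral_set2 d1 d2 (T1 : measurableType d1) (T2 : measurableType d2)
    (R : realType) (m1 : {sigma_finite_measure set T1 -> \bar R}) (D1 : set T1)
    (F : T1 * T2 -> \bar R) :
  measurable D1 -> measurable_fun setT F -> (forall z, 0 <= F z)%E ->
  measurable_fun setT (fun y => \int[m1]_(x in D1) F (x, y))%E.
Proof.
move=> mD1 mF F0; apply: (measurable_integral_set m1 (F := fun z => F (z.2, z.1))) => //.
by apply: (measurableT_comp mF); exact: measurable_swap.
Qed.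

(** * L^p estimates for translates *)
Section translation_Lp.
Context {R : realType} {N : nat}.
Local Notation mu := (@lebesgue_rV R N).
Local Notation lam := (@lebesgue_measure R).
Local Notation dir i := (delta_mx ord0 i : 'rV[R]_N).
Implicit Types (E : set 'rV[R]_N) (w : 'rV[R]_N -> R) (Dw : 'rV[R]_N -> 'rV[R]_N).
Implicit Types (a b c d x h : 'rV[R]_N).

Lemma sub_obox_cbox c d : obox c d `<=` cbox c d.
Proof. by move=> x ocd j; have /andP[/ltW -> /ltW ->] := ocd j. Qed.

Lemma measurable_line (v x : 'rV[R]_N) : measurable_fun [set: R] (fun s : R => x - s *: v).
Proof.
apply: measurable_fun_rV => i.
rewrite (_ : (fun _ => _) = (fun s : R => x ord0 i - s * v ord0 i)); last first.
  by apply/funext => s; rewrite !mxE.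
by apply: measurable_funB => //; apply: measurable_funM.
Qed.

Lemma ge0_integral_obox_shift h c d (f : 'rV[R]_N -> \bar R) :
  measurable_fun setT f -> (forall x, 0 <= f x)%E ->
  (\int[mu]_(x in obox c d) f (x + h)%R = \int[mu]_(x in obox (c + h) (d + h)) f x)%E.
Proof.
move=> mf f0; rewrite -(@ge0_integral_shift _ _ h (obox (c + h) (d + h)))//.
- by rewrite shift_obox !addrK.
- exact: measurable_obox.
- exact: measurable_funTS.
Qed.

Lemma le_obox a b c d : (forall j, c ord0 j <= a ord0 j) -> (forall j, b ord0 j <= d ord0 j) ->
  obox a b `<=` obox c d.
Proof.
by move=> ca bd x xab j; have /andP[ax xb] := xab j; rewrite (le_lt_trans (ca j) ax) (lt_le_trans xb).
Qed.

Lemma dir_ge0 i j : 0 <= dir i ord0 j.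
Proof. by rewrite mxE. Qed.

Lemma le_obox_dir c d i r t : 0 <= r -> r <= t ->
  obox (c + r *: dir i) (d + r *: dir i) `<=` obox c (d + t *: dir i).
Proof.
move=> r0 rt; apply: le_obox => j; have v0 := dir_ge0 i j; rewrite mxE in v0; rewrite !mxE.
  by rewrite lerDl mulr_ge0.
by rewrite lerD2l ler_wpM2r.
Qed.

(** Hoelder's inequality along the segment, then Tonelli's theorem. *)
Lemma weak_increment_Lp E w Dw i c d t p : open E -> weak_gradient E w Dw ->
  measurable_fun setT w -> measurable_fun setT (fun x => Dw x ord0 i) ->
  1 < p -> 0 < t -> cbox c (d + t *: dir i) `<=` E ->
  (\int[mu]_(x in obox c d) (`|w (x + t *: dir i) - w x| `^ p)%:E <=
   (t `^ p)%:E * \int[mu]_(x in obox c (d + t *: dir i)) (`|Dw x ord0 i| `^ p)%:E)%E.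
Proof.
move=> oE wDw mw mD p1 t0 CE; pose v := dir i; pose g x := Dw x ord0 i.
have mO := measurable_obox c d; have mO' := measurable_obox c (d + t *: v).
have mI := measurable_bseg t.
have mgp : measurable_fun setT (fun x => (`|g x| `^ p)%:E).
  by apply/measurable_EFinP; exact: measurable_norm_powR.
pose F (xs : 'rV[R]_N * R) := (`|g (xs.1 - xs.2 *: v)| `^ p)%:E.
have mF : measurable_fun setT F by apply: (measurableT_comp mgp); exact: measurable_transl_pair.
have mFx x : measurable_fun setT (fun s => F (x, s)) by exact: measurableT_comp.
pose J := (\int[mu]_(x in obox c (d + t *: v)) (`|g x| `^ p)%:E)%E.
apply: (@le_trans _ _ (\int[mu]_(x in obox c d)
    ((t `^ (p - 1))%:E * \int[lam]_(s in bseg t) F (x, s)))%E).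
  apply: ae_ge0_le_integral => //.
  - apply: measurable_funTS; apply/measurable_EFinP; apply: measurable_norm_powR.
    by apply: measurable_funB => //; exact: measurable_fun_shift.
  - move=> x _; rewrite mule_ge0 ?lee_fin ?powR_ge0//.
    by apply: integral_ge0 => s _; rewrite lee_fin powR_ge0.
  - apply: emeasurable_funM => //; apply: measurable_funTS.
    by apply: measurable_integral_set => // z; rewrite lee_fin powR_ge0.
  - have := weak_increment oE wDw t0 CE; apply: filterS => x H ox.
    rewrite (H ox) /line_integral; apply: powR_Rintegral_le => //.
    + apply: measurable_funTS; apply: (measurableT_comp (f := g)) => //.
      exact: measurable_line.
    + exact: lebesgue_bseg.
rewrite ge0_integralZl//; last 3 first.
- apply: measurable_funTS.
  by apply: measurable_integral_set => // z; rewrite lee_fin powR_ge0.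
- by move=> x _; apply: integral_ge0 => s _; rewrite lee_fin powR_ge0.
- by rewrite lee_fin powR_ge0.
rewrite (tonelli_set mu lam)//; last by move=> z; rewrite lee_fin powR_ge0.
apply: (@le_trans _ _ ((t `^ (p - 1))%:E * (\int[lam]_(s in bseg t) J))%E).
  apply: lee_wpmul2l; first by rewrite lee_fin powR_ge0.
  apply: ge0_le_integral.
  - exact: mI.
  - by move=> s _; apply: integral_ge0 => x _; rewrite lee_fin powR_ge0.
  - apply: measurable_funTS.
    apply: (measurable_integral_set2 mu (F := F)) => //.
    by move=> z; rewrite lee_fin powR_ge0.
  - exact: measurable_cst.
  - move=> s; rewrite /bseg/= in_itv/= => /andP[ts s0].
    rewrite (ge0_integral_obox_shift (- (s *: v)) c d (f := fun x => (`|g x| `^ p)%:E))//.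
    apply: ge0_subset_integral.
    + exact: measurable_obox.
    + exact: mO'.
    + exact: measurable_funTS.
    + by move=> x _; rewrite lee_fin powR_ge0.
    + by rewrite -!scaleNr; apply: le_obox_dir; rewrite ?oppr_ge0// lerNl.
rewrite integral_cst// [X in (_ * (_ * X))%E](lebesgue_bseg t0).
by rewrite (powR_predr p t0) EFinM -muleA [X in (_ * X)%E]muleC.
Qed.
End translation_Lp.

(** * A Faber-Krahn inequality *)
Section enorm.
Context {R : realType} {N : nat}.
Implicit Types (v : 'rV[R]_N).

Lemma enorm_ge0 v : 0 <= enorm v.
Proof. exact: sqrtr_ge0. Qed.

Lemma le_coord_enorm v i : `|v ord0 i| <= enorm v.
Proof.
rewrite -sqrtr_sqr /enorm ler_wsqrtr// (bigD1 i)//= lerDl sumr_ge0// => j _.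
exact: sqr_ge0.
Qed.

Lemma enormZ (c : R) v : enorm (c *: v) = `|c| * enorm v.
Proof.
rewrite /enorm -sqrtr_sqr -sqrtrM ?sqr_ge0// mulr_sumr; congr Num.sqrt.
by apply: eq_bigr => i _; rewrite mxE exprMn.
Qed.

Lemma measurable_enorm d (T : measurableType d) (D : set T) (F : T -> 'rV[R]_N) :
  (forall i, measurable_fun D (fun x => F x ord0 i)) ->
  measurable_fun D (fun x => enorm (F x)).
Proof.
move=> mF; rewrite /enorm; apply: (measurableT_comp (f := fun y : R => Num.sqrt y)).
  by apply: continuous_measurable_fun; exact: sqrt_continuous.
by apply: measurable_sum => i; apply: measurable_funX; exact: mF.
Qed.
End enorm.

Lemma powR_le2D (R : realType) (p a b : R) : 0 < p -> 0 <= a -> 0 <= b ->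
  (a + b) `^ p <= 2 `^ p * (a `^ p + b `^ p).
Proof.
move=> p0; wlog ab : a b / a <= b.
  move=> H a0 b0; have [/H|/ltW/H] := leP a b; first exact.
  by rewrite addrC [X in _ * X]addrC; exact.
move=> a0 b0; apply: (@le_trans _ _ ((2 * b) `^ p)).
  by rewrite ge0_ler_powR ?nnegrE ?(ltW p0) ?addr_ge0 ?mulr_ge0// mulr2n mulrDl mul1r lerD2r.
by rewrite powRM// ler_wpM2l ?powR_ge0// lerDr powR_ge0.
Qed.

Section translate_Lp.
Context {R : realType} {N : nat}.
Local Notation mu := (@lebesgue_rV R N).
Local Notation dir i := (delta_mx ord0 i : 'rV[R]_N).
Context (E : set 'rV[R]_N) (w : 'rV[R]_N -> R) (Dw : 'rV[R]_N -> 'rV[R]_N) (p : R).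
Hypothesis oE : open E.
Hypothesis wDw : weak_gradient E w Dw.
Hypothesis mw : measurable_fun setT w.
Hypothesis mD : forall i, measurable_fun setT (fun x => Dw x ord0 i).
Hypothesis p1 : 1 < p.
Context (c d : 'rV[R]_N) (l : R).
Hypothesis l0 : 0 < l.
Hypothesis CE : cbox c (d + const_mx l) `<=` E.

(** The constant of [m] successive translations along coordinate axes; each one
    costs a factor [2 ^ p] through [powR_le2D]. *)
Definition translate_const (m : nat) : R := iter m (fun k => 2 `^ p * (1 + k)) 0.

Lemma translate_const_ge0 m : 0 <= translate_const m.
Proof. by elim: m => //= m IH; rewrite mulr_ge0 ?powR_ge0// addr_ge0. Qed.

Let p0 : 0 < p. Proof. exact: lt_trans p1. Qed.

Let G := (\int[mu]_(x in obox c (d + const_mx l)) (enorm (Dw x) `^ p)%:E)%E.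

Let mG : measurable_fun setT (fun x => (enorm (Dw x) `^ p)%:E).
Proof.
apply/measurable_EFinP; apply: (measurableT_comp (measurable_powR p)).
exact: measurable_enorm.
Qed.

Let mtr (h : 'rV[R]_N) : measurable_fun setT (fun x : 'rV[R]_N => (`|w (x + h) - w x| `^ p)%:E).
Proof.
apply/measurable_EFinP; apply: measurable_norm_powR.
by apply: measurable_funB => //; exact: measurable_fun_shift.
Qed.

Let h_trunc (h : 'rV[R]_N) (m : nat) : 'rV[R]_N := \row_j if (j < m)%N then h ord0 j else 0.

(** The translation by [h] is made one coordinate after the other: [h_trunc h m]
    keeps the first [m] coordinates of [h]. *)
Lemma translate_Lp_trunc (h : 'rV[R]_N) m : (forall j, 0 <= h ord0 j <= l) -> (m <= N)%N ->
  (\int[mu]_(x in obox c d) (`|w (x + h_trunc h m) - w x| `^ p)%:E <=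
   (translate_const m * l `^ p)%:E * G)%E.
Proof.
move=> hl; have mO := measurable_obox c d.
have G0 : (0 <= G)%E by apply: integral_ge0 => x _; rewrite lee_fin powR_ge0.
elim: m => [_|m IH mN].
  rewrite mul0r mul0e (_ : h_trunc h 0 = 0); last by apply/rowP => j; rewrite !mxE.
  by rewrite integral0_eq// => x _; rewrite addr0 subrr normr0 powR0 ?gt_eqF.
pose i := Ordinal mN; pose hm := h_trunc h m; pose t := h ord0 i.
have /andP[t0 tl] : 0 <= t <= l by exact: hl.
have hmS : h_trunc h m.+1 = hm + t *: dir i.
  apply/rowP => j; rewrite !mxE eqxx /=; have [->|ji] := eqVneq j i.
    by rewrite ltnn ltnSn mulr1 add0r.
  rewrite mulr0 addr0 ltnS leq_eqVlt; case: (ltnP j m) => [_|]; rewrite ?orbT// orbF.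
  by move=> _; case: eqP => // jm; move: ji; rewrite -val_eqE /= jm eqxx.
have hm0 j : 0 <= hm ord0 j.
  by rewrite mxE; case: ifP => // _; have /andP[] := hl j.
have hml j : hm ord0 j + t * dir i ord0 j <= l.
  rewrite !mxE eqxx /=; have [->|ji] := eqVneq j i; first by rewrite ltnn mulr1 add0r.
  by rewrite mulr0 addr0; case: ifP => [_|_]; [have /andP[] := hl j|exact: ltW].
have e1 j : (c + hm) ord0 j = c ord0 j + hm ord0 j by rewrite mxE.
have e2 j : (d + hm + t *: dir i) ord0 j = d ord0 j + (hm ord0 j + t * dir i ord0 j).
  by rewrite [LHS]mxE [X in X + _]mxE [X in _ + X]mxE -addrA.
have e3 j : (d + const_mx l) ord0 j = d ord0 j + l by rewrite !mxE.
(* The last step is an axis-parallel translation of the box already shifted by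
   [hm]; the nonnegative coordinates keep it in the fattened box. *)
have first : (\int[mu]_(x in obox c d) (`|w (x + hm + t *: dir i) - w (x + hm)| `^ p)%:E <=
    (l `^ p)%:E * G)%E.
  rewrite (ge0_integral_obox_shift hm c d (f := fun y => (`|w (y + t *: dir i) - w y| `^ p)%:E))//.
  move: t0; rewrite le_eqVlt => /orP[/eqP t0|t0].
    rewrite integral0_eq ?mule_ge0// ?lee_fin ?powR_ge0// => x _.
    by rewrite -t0 scale0r addr0 subrr normr0 powR0 ?gt_eqF.
  have sub : cbox (c + hm) (d + hm + t *: dir i) `<=` cbox c (d + const_mx l).
    move=> x xc j; have /andP[x1 x2] := xc j; move: x1 x2; rewrite e1 e2 e3 => x1 x2.
    by rewrite (le_trans _ x1) ?lerDl//= (le_trans x2)// lerD2l.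
  have := @weak_increment_Lp R N E w Dw i (c + hm) (d + hm) t p oE wDw mw (mD i) p1 t0 (subset_trans sub CE).
  move=> /le_trans; apply.
  apply: lee_pmul.
  - by rewrite lee_fin powR_ge0.
  - by apply: integral_ge0 => x _; rewrite lee_fin powR_ge0.
  - by rewrite lee_fin ge0_ler_powR ?nnegrE ?(ltW p0)// ltW.
  apply: (@le_trans _ _ (\int[mu]_(x in obox (c + hm) (d + hm + t *: dir i)) (enorm (Dw x) `^ p)%:E)%E).
    apply: ge0_le_integral.
    - exact: measurable_obox.
    - by move=> x _; rewrite lee_fin powR_ge0.
    - by apply: measurable_funTS; apply/measurable_EFinP; apply: measurable_norm_powR; exact: mD.
    - exact: measurable_funTS.
    - by move=> x _; rewrite lee_fin ge0_ler_powR ?nnegrE ?(ltW p0) ?enorm_ge0// le_coord_enorm.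
  apply: ge0_subset_integral.
  - exact: measurable_obox.
  - exact: measurable_obox.
  - exact: measurable_funTS.
  - by move=> x _; rewrite lee_fin powR_ge0.
  by apply: le_obox => j; rewrite ?e1 ?e2 ?e3 ?lerDl ?lerD2l.
rewrite hmS; apply: (@le_trans _ _ (\int[mu]_(x in obox c d) ((2 `^ p)%:E *
    ((`|w (x + hm + t *: dir i) - w (x + hm)| `^ p)%:E + (`|w (x + hm) - w x| `^ p)%:E)))%E).
  apply: ge0_le_integral.
  - exact: mO.
  - by move=> x _; rewrite lee_fin powR_ge0.
  - exact: measurable_funTS.
  - apply: measurable_funTS; apply: emeasurable_funM => //; apply: emeasurable_funD => //.
    by apply: (measurable_fun_shift hm (f := fun y => (`|w (y + t *: dir i) - w y| `^ p)%:E)).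
  - move=> x _; rewrite -EFinD -EFinM lee_fin addrA.
    apply: le_trans (powR_le2D p0 (normr_ge0 _) (normr_ge0 _)).
    rewrite ge0_ler_powR ?nnegrE ?(ltW p0) ?addr_ge0//.
    by apply: le_trans (ler_normD _ _); rewrite addrA subrK.
have m1 : measurable_fun (obox c d) (fun x => (`|w (x + hm + t *: dir i) - w (x + hm)| `^ p)%:E).
  apply: measurable_funTS.
  by apply: (measurable_fun_shift hm (f := fun y => (`|w (y + t *: dir i) - w y| `^ p)%:E)).
have m2 : measurable_fun (obox c d) (fun x => (`|w (x + hm) - w x| `^ p)%:E) by exact: measurable_funTS.
rewrite ge0_integralZl//; last 2 first.
- exact: emeasurable_funD.
- by move=> x _; rewrite adde_ge0// lee_fin powR_ge0.
rewrite ge0_integralD//.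
rewrite /= -mulrA EFinM -muleA; apply: lee_wpmul2l; first by rewrite lee_fin powR_ge0.
rewrite mulrDl mul1r EFinD ge0_muleDl ?lee_fin ?mulr_ge0 ?powR_ge0 ?translate_const_ge0//.
by apply: leeD => //; apply: IH; exact: ltnW.
Qed.

Lemma translate_Lp (h : 'rV[R]_N) : (forall j, 0 <= h ord0 j <= l) ->
  (\int[mu]_(x in obox c d) (`|w (x + h) - w x| `^ p)%:E <=
   (translate_const N * l `^ p)%:E * G)%E.
Proof.
move=> hl; have := translate_Lp_trunc hl (leqnn N).
by rewrite (_ : h_trunc h N = h)//; apply/rowP => j; rewrite mxE ltn_ord.
Qed.

Let mwp (h : 'rV[R]_N) : measurable_fun setT (fun x : 'rV[R]_N => (`|w (x + h)| `^ p)%:E).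
Proof.
apply/measurable_EFinP; apply: measurable_norm_powR.
exact: measurable_fun_shift.
Qed.

(** For every [h] in the box [B] of edge [l], [|w x|] is at most
    [|w (x + h) - w x| + |w (x + h)|].  The first term is small by [translate_Lp].
    Averaging over [h] in [B] turns the second one, for each [x] in [S], into the
    mean of [|w|^p] over a translate of [B]; this produces the measure of [S],
    since [w] vanishes elsewhere. *)
Lemma faber_krahn (S : set 'rV[R]_N) : measurable S ->
  (forall x, obox c d x -> ~ S x -> w x = 0) ->
  (\int[mu]_(x in obox c d) (`|w x| `^ p)%:E <=
   (2 `^ p)%:E * ((translate_const N * l `^ p)%:E * G +
     (l ^- N)%:E * (mu (obox c d `&` S) *
        \int[mu]_(x in obox c (d + const_mx l)) (`|w x| `^ p)%:E)))%E.
Proof.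
move=> mS wS; have mO := measurable_obox c d.
have mOS : measurable (obox c d `&` S) by exact: measurableI.
set W := (\int[mu]_(x in obox c (d + const_mx l)) (`|w x| `^ p)%:E)%E.
set L := (\int[mu]_(x in obox c d) (`|w x| `^ p)%:E)%E.
have W0 : (0 <= W)%E by apply: integral_ge0 => x _; rewrite lee_fin powR_ge0.
have G0 : (0 <= G)%E by apply: integral_ge0 => x _; rewrite lee_fin powR_ge0.
pose B := obox 0 (const_mx l : 'rV[R]_N).
have mB : measurable B by exact: measurable_obox.
have Bl : mu B = (l ^+ N)%:E.
  rewrite lebesgue_obox; congr EFin; under eq_bigr do rewrite !mxE subr0 max_r ?(ltW l0)//.
  by rewrite prodr_const card_ord.
have lN0 : 0 < l ^+ N by rewrite exprn_gt0.
have w0 : measurable_fun setT (fun x : 'rV[R]_N => (`|w x| `^ p)%:E).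
  by apply/measurable_EFinP; exact: measurable_norm_powR.
have wp0 (x : 'rV[R]_N) : (0 <= (`|w x| `^ p)%:E)%E by rewrite lee_fin powR_ge0.
pose H (xh : 'rV[R]_N * 'rV[R]_N) : \bar R := (`|w (xh.1 + xh.2)| `^ p)%:E.
have mH : measurable_fun setT H.
  apply: (measurableT_comp w0); apply: measurable_fun_rV => j.
  rewrite (_ : (fun _ => _) = (fun xh : 'rV[R]_N * 'rV[R]_N => rV_coord j xh.1 + rV_coord j xh.2)); last first.
    by apply/funext => xh; rewrite !mxE.
  by apply: measurable_funD; apply: measurableT_comp => //; exact: measurable_rV_coord.
have H0 z : (0 <= H z)%E by rewrite lee_fin powR_ge0.
pose I h := (\int[mu]_(x in obox c d `&` S) H (x, h))%E.
have I0 h : (0 <= I h)%E by apply: integral_ge0 => x _; exact: H0.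
have mI : measurable_fun setT I by exact: (measurable_integral_set2 mu).
have K0 : 0 <= translate_const N * l `^ p by rewrite mulr_ge0 ?powR_ge0 ?translate_const_ge0.
(* the pointwise inequality, integrated over [x] for a fixed [h] *)
have each h : B h -> (L <= (2 `^ p)%:E * ((translate_const N * l `^ p)%:E * G + I h))%E.
  move=> Bh; have hl j : 0 <= h ord0 j <= l.
    by have := Bh j; rewrite !mxE => /andP[/ltW -> /ltW ->].
  apply: (@le_trans _ _ ((2 `^ p)%:E * (\int[mu]_(x in obox c d)
      ((`|w (x + h) - w x| `^ p)%:E + (`|w (x + h)| `^ p * \1_S x)%:E)))%E); last first.
    apply: lee_wpmul2l; first by rewrite lee_fin powR_ge0.
    rewrite ge0_integralD//; last 2 first.
    - exact: measurable_funTS.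
    - apply: measurable_funTS; apply/measurable_EFinP; apply: measurable_funM.
        by apply/measurable_EFinP; exact: mwp.
      exact: measurable_indic.
    apply: leeD; first exact: translate_Lp.
    rewrite /I integral_mkcondr le_eqVlt; apply/orP; left; apply/eqP.
    by apply: eq_integral => x _; rewrite patchE indicE /H/=; case: ifP; rewrite ?mulr1 ?mulr0.
  rewrite -ge0_integralZl//; last 2 first.
  - apply: emeasurable_funD; first exact: measurable_funTS.
    apply: measurable_funTS; apply/measurable_EFinP; apply: measurable_funM.
      by apply/measurable_EFinP; exact: mwp.
    exact: measurable_indic.
  - by move=> x _; rewrite -EFinD lee_fin addr_ge0 ?mulr_ge0 ?powR_ge0.
  apply: ge0_le_integral.
  - exact: mO.
  - by move=> x _; rewrite lee_fin powR_ge0.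
  - exact: measurable_funTS.
  - apply: emeasurable_funM => //; apply: emeasurable_funD; first exact: measurable_funTS.
    apply: measurable_funTS; apply/measurable_EFinP; apply: measurable_funM.
      by apply/measurable_EFinP; exact: mwp.
    exact: measurable_indic.
  - move=> x ox; rewrite -EFinD -EFinM lee_fin indicE.
    have [xS|xS] := boolP (x \in S); last first.
      rewrite wS//; last by move=> Sx; move: xS; rewrite mem_set.
      by rewrite normr0 powR0 ?gt_eqF// mulr_ge0 ?addr_ge0 ?mulr_ge0 ?powR_ge0.
    rewrite mulr1; apply: le_trans (powR_le2D p0 (normr_ge0 _) (normr_ge0 _)).
    rewrite ge0_ler_powR ?nnegrE ?(ltW p0) ?addr_ge0//.
    by have := ler_normB (w (x + h)) (w (x + h) - w x); rewrite subKr addrC.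
(* the average over [h], by exchanging the integrals *)
have intI : (\int[mu]_(h in B) I h <= mu (obox c d `&` S) * W)%E.
  rewrite /I -(tonelli_set mu mu)//.
  apply: (@le_trans _ _ (\int[mu]_(x in obox c d `&` S) W)%E); last first.
    by rewrite integral_cst// muleC.
  apply: ge0_le_integral.
  - exact: mOS.
  - by move=> x _; apply: integral_ge0.
  - by apply: measurable_funTS; exact: (measurable_integral_set mu).
  - exact: measurable_cst.
  - move=> x [ox _].
    have -> : (\int[mu]_(y in B) H (x, y) = \int[mu]_(y in obox (0 + x) (const_mx l + x)) (`|w y| `^ p)%:E)%E.
      rewrite -[RHS](@ge0_integral_obox_shift R N x 0 (const_mx l) _ w0 wp0).
      by apply: eq_integral => y _; rewrite /H [(_, _).1]/= [(_, _).2]/= addrC.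
    apply: ge0_subset_integral.
    + exact: measurable_obox.
    + exact: measurable_obox.
    + exact: measurable_funTS.
    + by move=> y _; rewrite lee_fin powR_ge0.
    apply: le_obox => j; have /andP[x1 x2] := ox j; rewrite !mxE ?add0r; first exact: ltW.
    by rewrite addrC lerD2r ltW.
have SW0 : (0 <= mu (obox c d `&` S) * W)%E by apply: mule_ge0; [exact: measure_ge0|exact: W0].
have X0 : (0 <= (translate_const N * l `^ p)%:E * G)%E by apply: mule_ge0 => //; rewrite lee_fin.
have L0 : (0 <= L)%E by apply: integral_ge0 => x _; exact: wp0.
move: X0 each; set X := ((translate_const N * l `^ p)%:E * G)%E => X0 each.
move: SW0 intI; set SW := (mu (obox c d `&` S) * W)%E => SW0 intI.
clearbody X SW L I.
have Bcst r : (\int[mu]_(h in B) r = r * (l ^+ N)%:E)%E.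
  by rewrite integral_cst// [X in (r * X)%E]Bl.
have lL : (\int[mu]_(h in B) L = (l ^+ N)%:E * L)%E by rewrite Bcst muleC.
have : (\int[mu]_(h in B) L <= \int[mu]_(h in B) ((2 `^ p)%:E * (X + I h)))%E.
  apply: ge0_le_integral.
  - exact: mB.
  - by move=> h _.
  - exact: measurable_cst.
  - apply: emeasurable_funM => //; apply: emeasurable_funD => //; exact: measurable_funTS.
  - exact: each.
rewrite lL ge0_integralZl//; last 2 first.
- by apply: emeasurable_funD => //; exact: measurable_funTS.
- by move=> h _; exact: adde_ge0.
rewrite ge0_integralD//; last exact: measurable_funTS.
rewrite Bcst => KL.
rewrite -(@lee_pmul2l _ (l ^+ N)%:E) ?lte_fin//.
apply: (le_trans KL); rewrite [leRHS]muleCA.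
apply: lee_wpmul2l; first by rewrite lee_fin powR_ge0.
rewrite ge0_muleDr//; last by apply: mule_ge0 => //; rewrite lee_fin invr_ge0 ltW.
rewrite [X in (X + _ <= _)%E]muleC.
apply: leeD => //.
by rewrite muleA -EFinM divff ?gt_eqF// mul1e.
Qed.
End translate_Lp.

(** * Local boundedness *)
Section restrict.
Context {R : realType} {N : nat}.
Local Notation mu := (@lebesgue_rV R N).
Implicit Types (E : set 'rV[R]_N).

Lemma measurable_fun_indicM E (f : 'rV[R]_N -> R) : measurable E -> measurable_fun E f ->
  measurable_fun setT (fun x => f x * \1_E x).
Proof.
move=> mE mf; have := (measurable_restrictT f mE).1 mf.
congr measurable_fun; apply/funext => x; rewrite patchE indicE.
by case: ifP; rewrite ?mulr1 ?mulr0.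
Qed.

Lemma eq_Lp_loc E p (f g : 'rV[R]_N -> R) : (forall x, E x -> f x = g x) ->
  Lp_loc E p f -> Lp_loc E p g.
Proof.
move=> fg [mf foo]; split.
  by apply: eq_measurable_fun mf => x; rewrite inE => Ex; exact: fg.
move=> K cK KE.
have <- : (\int[mu]_(x in K) (`|f x| `^ p)%:E = \int[mu]_(x in K) (`|g x| `^ p)%:E)%E.
  by apply: eq_integral => x; rewrite inE => Kx; rewrite fg//; exact: KE.
exact: foo.
Qed.

Lemma eq_weak_gradient E (w w' : 'rV[R]_N -> R) (Dw Dw' : 'rV[R]_N -> 'rV[R]_N) :
  (forall x, E x -> w x = w' x) -> (forall x, E x -> Dw x = Dw' x) ->
  weak_gradient E w Dw -> weak_gradient E w' Dw'.
Proof.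
move=> ww' DD' [w1 D1 H]; split.
- exact: eq_Lp_loc w1.
- by move=> i; apply: eq_Lp_loc (D1 i) => x Ex; rewrite DD'.
move=> z tz i.
have <- : (\int[mu]_(x in E) (w x * partial i z x)%:E = \int[mu]_(x in E) (w' x * partial i z x)%:E)%E.
  by apply: eq_integral => x; rewrite inE => Ex; rewrite ww'.
rewrite (H z tz i); congr (- _)%E; apply: eq_integral => x; rewrite inE => Ex.
by rewrite DD'.
Qed.
End restrict.

Section de_giorgi.
Context {R : realType} {N : nat}.
Local Notation mu := (@lebesgue_rV R N).
Context (E : set 'rV[R]_N) (p gamma : R) (u : 'rV[R]_N -> R).
Hypothesis oE : open E.
Hypothesis p1 : 1 < p.
Hypothesis gamma0 : 0 < gamma.
Hypothesis uDG : DG_plus E p gamma u.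

Let p0 : 0 < p. Proof. exact: lt_trans p1. Qed.
Let mE : measurable E. Proof. exact: open_measurable_rV. Qed.
Let mu_ : measurable_fun E u. Proof. by have [[[]]] := uDG. Qed.

Definition upart (k : R) (x : 'rV[R]_N) : R := Num.max (u x - k) 0.

Lemma upart_ge0 k x : 0 <= upart k x.
Proof. by rewrite /upart le_max lexx orbT. Qed.

Lemma measurable_upart k : measurable_fun E (upart k).
Proof. by apply: measurable_maxr => //; exact: measurable_funB. Qed.

Definition uenergy (y : 'rV[R]_N) (r k : R) : \bar R :=
  (\int[mu]_(x in cube y r) (upart k x `^ p)%:E)%E.

Lemma measurable_upart_pow D k : measurable D -> D `<=` E ->
  measurable_fun D (fun x => (upart k x `^ p)%:E).
Proof.
move=> mD DE; apply/measurable_EFinP; apply: (measurableT_comp (measurable_powR p)).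
by apply: measurable_funS DE _ => //; exact: measurable_upart.
Qed.

Lemma uenergy_ge0 y r k : (0 <= uenergy y r k)%E.
Proof. by apply: integral_ge0 => x _; rewrite lee_fin powR_ge0. Qed.

Lemma uenergy_le y r r' k k' : r <= r' -> k' <= k -> cube y r' `<=` E ->
  (uenergy y r k <= uenergy y r' k')%E.
Proof.
move=> rr' kk' cE; apply: (@le_trans _ _ (uenergy y r k')).
  apply: ge0_le_integral.
  - exact: measurable_cube.
  - by move=> x _; rewrite lee_fin powR_ge0.
  - apply: measurable_upart_pow; first exact: measurable_cube.
    exact: subset_trans (le_cube rr') cE.
  - apply: measurable_upart_pow; first exact: measurable_cube.
    exact: subset_trans (le_cube rr') cE.
  - move=> x _; rewrite lee_fin ge0_ler_powR ?nnegrE ?upart_ge0 ?(ltW p0)//.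
    by rewrite /upart ge_max !le_max lexx orbT andbT lerD2l lerN2 kk'.
apply: ge0_subset_integral.
- exact: measurable_cube.
- exact: measurable_cube.
- by apply: measurable_upart_pow => //; exact: measurable_cube.
- by move=> x _; rewrite lee_fin powR_ge0.
- exact: le_cube.
Qed.

Lemma upart_energy k : exists Dw, weak_gradient E (upart k) Dw /\
  forall y r s, 0 < r -> r < s -> cube y s `<=` E ->
  (\int[mu]_(x in cube y r) (enorm (Dw x) `^ p)%:E <= (gamma / (s - r) `^ p)%:E * uenergy y s k)%E.
Proof.
have [_ /(_ k)[Dw wD H]] := uDG; exists Dw; split.
  exact: eq_weak_gradient wD.
move=> y r s r0 rs sE; have := H y r s r0 rs sE; rewrite /DG_const => /le_trans; apply.
rewrite le_eqVlt; apply/orP; left; apply/eqP; congr (_ * _)%E.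
by apply: eq_integral => x _; rewrite ger0_norm ?upart_ge0.
Qed.

(** The Faber-Krahn inequality at scale [l = th * del] for [(u - k')^\+], whose
    support has small measure by Chebyshev's inequality at the lower level [k], and
    whose gradient is controlled by the class on a cube larger by [del / 2].  The
    first coefficient is small with [th], the second one with [Z]. *)
Lemma uenergy_step y rho del th k k' Z : 0 < rho -> 0 < del -> 0 < th -> th <= 2^-1 -> k < k' ->
  cube y (rho + del) `<=` E -> (uenergy y (rho + del) k <= Z%:E)%E ->
  (uenergy y rho k' <=
   ((2 `^ p * (translate_const p N * (2 * th) `^ p * gamma + (th * del) ^- N * (Z / (k' - k) `^ p))) * Z)%:E)%E.
Proof.
move=> rho0 del0 th0 th2 kk' cE YZ.
have Z0 : 0 <= Z by rewrite -lee_fin (le_trans _ YZ)// uenergy_ge0.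
have [Dw [wD HD]] := upart_energy k'.
(* off [E] the values are arbitrary, so they are set to zero *)
pose w := fun x => upart k' x * \1_E x.
pose Dw' := fun x => \1_E x *: Dw x.
have inE1 x : E x -> \1_E x = 1 :> R by move=> Ex; rewrite indicE mem_set.
have wD' : weak_gradient E w Dw'.
  apply: eq_weak_gradient wD => x Ex; first by rewrite /w inE1// mulr1.
  by rewrite /Dw' inE1// scale1r.
have mw : measurable_fun setT w by apply: measurable_fun_indicM => //; exact: measurable_upart.
have mD i : measurable_fun setT (fun x => Dw' x ord0 i).
  have [_ /(_ i)[mDi _] _] := wD.
  have := measurable_fun_indicM mE mDi; congr measurable_fun.
  by apply/funext => x; rewrite mxE mulrC.
pose l := th * del; have l0 : 0 < l by rewrite mulr_gt0.
have l2 : l <= del / 2 by rewrite /l mulrC ler_wpM2l// ltW.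
have d2 : del / 2 < del by rewrite ltr_pdivrMr// ltr_pMr// ltr1n.
pose c := y - const_mx rho; pose d := y + const_mx rho.
have cd : cube y rho = obox c d by rewrite cube_obox.
have subl : obox c (d + const_mx l) `<=` cube y (rho + del / 2).
  rewrite cube_obox; apply: le_obox => j; rewrite !mxE.
    by rewrite lerD2l lerN2 lerDl divr_ge0 ?ltW.
  by rewrite -addrA lerD2l lerD2l.
have CE : cbox c (d + const_mx l) `<=` E.
  apply: subset_trans cE => x xc j; have := xc j; rewrite !mxE => /andP[x1 x2].
  rewrite ltr_norml; apply/andP; split; lra.
have sE2 : cube y (rho + del / 2) `<=` E by apply: subset_trans cE; apply: le_cube; rewrite lerD2l ltW.
pose S := E `&` u @^-1` `]k', +oo[%classic.
have mS : measurable S by exact: mu_.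
have wS x : obox c d x -> ~ S x -> w x = 0.
  rewrite -cd => cx nS; have Ex : E x by apply: sE2; apply: le_cube cx; rewrite lerDl divr_ge0// ltW.
  rewrite /w inE1// mulr1 /upart max_r// subr_le0 leNgt; apply/negP => uk; apply: nS; split => //.
  by rewrite /= in_itv/= uk.
have FK := @faber_krahn R N E w Dw' p oE wD' mw mD p1 c d l l0 CE S mS wS.
have -> : uenergy y rho k' = (\int[mu]_(x in obox c d) (`|w x| `^ p)%:E)%E.
  rewrite /uenergy cd; apply: eq_integral => x; rewrite inE -cd => cx.
  have Ex : E x by apply: sE2; apply: le_cube cx; rewrite lerDl divr_ge0// ltW.
  by rewrite /w inE1// mulr1 ger0_norm// upart_ge0.
apply: (le_trans FK).
have YZ' : (uenergy y (rho + del) k' <= Z%:E)%E.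
  by apply: le_trans YZ; apply: uenergy_le => //; exact: ltW.
have GZ : (\int[mu]_(x in obox c (d + const_mx l)) (enorm (Dw' x) `^ p)%:E <= (gamma / (del / 2) `^ p * Z)%:E)%E.
  apply: (@le_trans _ _ (\int[mu]_(x in cube y (rho + del / 2)) (enorm (Dw' x) `^ p)%:E)%E).
    apply: ge0_subset_integral => //.
    - exact: measurable_obox.
    - exact: measurable_cube.
    - apply: measurable_funTS; apply/measurable_EFinP; apply: (measurableT_comp (measurable_powR p)).
      exact: measurable_enorm.
    - by move=> x _; rewrite lee_fin powR_ge0.
  rewrite (eq_integral (fun x => (enorm (Dw x) `^ p)%:E)); last first.
    by move=> x; rewrite inE => cx; rewrite /Dw' inE1 ?scale1r//; exact: sE2.
  apply: le_trans (HD y (rho + del / 2) (rho + del) _ _ cE) _.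
  - by rewrite addr_gt0// divr_gt0.
  - by rewrite ltrD2l.
  rewrite (_ : rho + del - (rho + del / 2) = del / 2); last by lra.
  by rewrite [leRHS]EFinM; apply: lee_wpmul2l => //; rewrite lee_fin divr_ge0 ?powR_ge0// ltW.
have WZ : (\int[mu]_(x in obox c (d + const_mx l)) (`|w x| `^ p)%:E <= Z%:E)%E.
  apply: le_trans YZ'; rewrite /uenergy.
  rewrite [leRHS](eq_integral (fun x => (`|w x| `^ p)%:E)); last first.
    by move=> x; rewrite inE => cx; rewrite /w inE1 ?mulr1 ?ger0_norm ?upart_ge0//; exact: cE.
  apply: ge0_subset_integral.
  - exact: measurable_obox.
  - exact: measurable_cube.
  - by apply: measurable_funTS; apply/measurable_EFinP; exact: measurable_norm_powR.
  - by move=> x _; rewrite lee_fin powR_ge0.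
  - by apply: subset_trans subl _; apply: le_cube; rewrite lerD2l ltW.
have kp : 0 < (k' - k) `^ p by rewrite powR_gt0// subr_gt0.
(* Chebyshev's inequality: on [S] the function [(u - k)^\+] is at least [k' - k] *)
have SZ : (mu (obox c d `&` S) <= (Z / (k' - k) `^ p)%:E)%E.
  have mcS : measurable (obox c d `&` S) by apply: measurableI => //; exact: measurable_obox.
  have : ((((k' - k) `^ p)%:E) * mu (obox c d `&` S) <= Z%:E)%E.
    have <- : (\int[mu]_(x in obox c d `&` S) ((k' - k) `^ p)%:E = ((k' - k) `^ p)%:E * mu (obox c d `&` S))%E.
      by apply: integral_cst; exact: mcS.
    apply: le_trans YZ; rewrite /uenergy.
    apply: (@le_trans _ _ (\int[mu]_(x in obox c d `&` S) (upart k x `^ p)%:E)%E).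
      apply: ge0_le_integral => //.
      - by move=> x _; rewrite lee_fin powR_ge0.
      - by apply: measurable_upart_pow => // x [_ []].
      - move=> x [_ [_]]; rewrite /= in_itv/= andbT => uk.
        rewrite lee_fin ge0_ler_powR ?nnegrE ?upart_ge0 ?(ltW p0) ?subr_ge0 ?(ltW kk')//.
        by rewrite /upart le_max lerD2r (ltW uk).
    apply: ge0_subset_integral.
    - exact: mcS.
    - exact: measurable_cube.
    - by apply: measurable_upart_pow => //; exact: measurable_cube.
    - by move=> x _; rewrite lee_fin powR_ge0.
    - by rewrite -cd => x [cx _]; apply: le_cube cx; rewrite lerDl ltW.
  by rewrite -lee_pdivlMl// => /le_trans; apply; rewrite -EFinM mulrC.
have l2p : l `^ p * (gamma / (del / 2) `^ p) = (2 * th) `^ p * gamma.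
  have -> : l = (2 * th) * (del / 2) by rewrite /l; field.
  rewrite powRM ?mulr_ge0 ?divr_ge0 ?ltW// -mulrA [_ * (gamma / _)]mulrC -!mulrA mulVf ?mulr1//.
  by rewrite gt_eqF// powR_gt0// divr_gt0.
have lN : 0 <= l ^- N by rewrite invr_ge0 exprn_ge0// ltW.
apply: (@le_trans _ _ ((2 `^ p)%:E * ((translate_const p N * l `^ p)%:E * (gamma / (del / 2) `^ p * Z)%:E +
     (l ^- N)%:E * ((Z / (k' - k) `^ p)%:E * Z%:E)))%E).
  apply: lee_wpmul2l; first by rewrite lee_fin powR_ge0.
  apply: leeD.
    by apply: lee_wpmul2l => //; rewrite lee_fin mulr_ge0 ?powR_ge0 ?translate_const_ge0.
  apply: lee_wpmul2l; first by rewrite lee_fin.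
  apply: lee_pmul => //.
  by apply: integral_ge0 => x _; rewrite lee_fin powR_ge0.
rewrite -!EFinM -?EFinD -?EFinM.
rewrite lee_fin le_eqVlt; apply/orP; left; apply/eqP.
rewrite -/l; move: l2p; generalize (l `^ p) (gamma / (del / 2) `^ p) (Z / (k' - k) `^ p) (l ^- N) (2 `^ p).
move=> a b q e P l2p.
rewrite [RHS]mulrAC (_ : P * Z * _ = P * (translate_const p N * ((2 * th) `^ p * gamma) * Z + e * (q * Z))); last by ring.
by rewrite -l2p; ring.
Qed.

(** De Giorgi's iteration: with radii decreasing to [r] and levels increasing to
    [k], both along powers of [1/2], the energies are at most [eta ^+ n * Z0], so
    the energy at the limit level [k] vanishes.  In the second coefficient of
    [uenergy_step] the shrinking gaps cost [(2^N 2^p)^(n+1) = eta^-(n+1)] at step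
    [n], and the energy already attained pays back [eta ^+ n]; the rest does not
    depend on [n].  First [th] and then [k] are chosen to make either coefficient
    at most [eta / 2]. *)
Lemma local_bound y r s : 0 < r -> r < s -> cube y s `<=` E ->
  exists M, {ae mu, forall x, cube y r x -> u x <= M}.
Proof.
move=> r0 rs sE.
(* The iteration starts from an intermediate cube, where the energy is finite
   because the closed cube is a compact subset of [E]. *)
pose s0 := (r + s) / 2; have rs0 : r < s0 by rewrite /s0; lra.
have s0s : s0 < s by rewrite /s0; lra.
have s0E : cube y s0 `<=` E by apply: subset_trans sE; apply: le_cube; exact: ltW.
have cs0E : ccube y s0 `<=` E.
  by apply: subset_trans sE; apply: ccube_sub.
have Zoo : (uenergy y s0 0 < +oo)%E.
  have [[[_ /(_ _ (compact_ccube (y:=y) (r:=s0)) cs0E) uoo] _] _] := uDG.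
  apply: le_lt_trans uoo; rewrite /uenergy.
  apply: (@le_trans _ _ (\int[mu]_(x in cube y s0) (`|u x| `^ p)%:E)%E).
    apply: ge0_le_integral.
    - exact: measurable_cube.
    - by move=> x _; rewrite lee_fin powR_ge0.
    - by apply: measurable_upart_pow => //; exact: measurable_cube.
    - apply/measurable_EFinP; apply: (measurableT_comp (measurable_powR p)).
      by apply: measurableT_comp => //; apply: measurable_funS mu_.
    - move=> x _; rewrite lee_fin ge0_ler_powR ?nnegrE ?upart_ge0 ?(ltW p0)//.
      by rewrite /upart subr0 ge_max ler_norm normr_ge0.
  apply: ge0_subset_integral.
  - exact: measurable_cube.
  - exact: measurable_ccube.
  - apply/measurable_EFinP; apply: (measurableT_comp (measurable_powR p)).
    apply: measurableT_comp => //; apply: measurable_funS mu_ => //.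
  - by move=> x _; rewrite lee_fin powR_ge0.
  - exact: sub_ccube.
have Z00 := uenergy_ge0 y s0 0.
pose Z0 := fine (uenergy y s0 0).
have ZE : uenergy y s0 0 = Z0%:E by rewrite /Z0 fineK// ge0_fin_numE.
have Z0ge : 0 <= Z0 by rewrite -lee_fin -ZE.
pose h : R := 2^-1; have h0 : 0 < h by rewrite invr_gt0.
have h1 : h < 1 by rewrite invf_lt1// ltr1n.
pose P := 2 `^ p; have P0 : 0 < P by rewrite powR_gt0.
pose b := h `^ p; have b0 : 0 < b by rewrite powR_gt0.
have b1 : b < 1.
  have -> : 1 = 1 `^ p :> R by rewrite powR1.
  by rewrite gt0_ltr_powR ?nnegrE// ltW.
pose a := h ^+ N; have a0 : 0 < a by rewrite exprn_gt0.
have a1 : a <= 1 by rewrite exprn_ile1 // ltW.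
pose eta := a * b; have eta0 : 0 < eta by rewrite mulr_gt0.
have eta1 : eta < 1 by rewrite (le_lt_trans _ b1)// /eta ler_piMl// ltW.
pose A := P * translate_const p N * gamma.
have A0 : 0 <= A by rewrite !mulr_ge0 ?translate_const_ge0// ltW.
pose th := eta / (4 * (A + 1)).
have A10 : 0 < 4 * (A + 1) by lra.
have th0 : 0 < th by rewrite divr_gt0.
have th2 : th <= 2^-1 by rewrite /th ler_pdivrMr//; lra.
have thA : A * (2 * th) <= eta / 2.
  rewrite /th; have -> : A * (2 * (eta / (4 * (A + 1)))) = (eta / 2) * (A / (A + 1)) by field; lra.
  have A1 : 0 < A + 1 by lra.
  rewrite ler_piMr ?ler_pdivrMr// ?mul1r; last by lra.
  by rewrite divr_ge0// ltW.
pose D := s0 - r; have D0 : 0 < D by rewrite subr_gt0.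
(* [B] is the value of [k `^ p] at which the second coefficient is [eta / 2]. *)
pose B := 2 * P * (th * D) ^- N * Z0 / eta ^+ 2.
have thDN : 0 < (th * D) ^- N by rewrite invr_gt0 exprn_gt0// mulr_gt0.
have B0 : 0 <= B by rewrite /B divr_ge0 ?exprn_ge0 ?(ltW eta0)// mulr_ge0// mulr_ge0 ?(ltW thDN)// mulr_ge0// ltW.
pose k := B + 1; have k1 : 1 <= k by rewrite lerDr.
have k0 : 0 < k by exact: lt_le_trans k1.
have kB : B <= k `^ p.
  by apply: (@le_trans _ _ k); rewrite ?lerDl// -[leLHS]powRr1 ?(ltW k0)// ler_powR// ltW.
have hb n : (h ^+ n) `^ p = b ^+ n.
  elim: n => [|n IH]; first by rewrite !expr0 powR1.
  by rewrite !exprS powRM ?exprn_ge0 ?(ltW h0)// IH.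
have claim n : (uenergy y (r + D * h ^+ n) (k * (1 - h ^+ n)) <= (eta ^+ n * Z0)%:E)%E.
  elim: n => [|n IH].
    rewrite !expr0 subrr mulr0 mulr1 mul1r (_ : r + D = s0) ?ZE//.
    by rewrite /D addrC subrK.
  have hn0 : 0 < h ^+ n by rewrite exprn_gt0.
  have hS : h ^+ n = h ^+ n.+1 + h ^+ n.+1 by rewrite exprS /h; lra.
  have hS0 : 0 < h ^+ n.+1 by rewrite exprn_gt0.
  have rD : r + D * h ^+ n = (r + D * h ^+ n.+1) + D * h ^+ n.+1.
    by rewrite [in LHS]hS mulrDr addrA.
  have kD : k * (1 - h ^+ n.+1) - k * (1 - h ^+ n) = k * h ^+ n.+1.
    by rewrite hS; ring.
  have hle : h ^+ n <= 1 by rewrite exprn_ile1// ltW.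
  rewrite rD in IH.
  have := @uenergy_step y (r + D * h ^+ n.+1) (D * h ^+ n.+1) th (k * (1 - h ^+ n)) (k * (1 - h ^+ n.+1)) _ _ _ th0 th2 _ _ IH.
  rewrite kD => /(_ _ _ _ _)/le_trans; apply.
  - by rewrite addr_gt0// mulr_gt0.
  - by rewrite mulr_gt0.
  - by rewrite -subr_gt0 kD mulr_gt0.
  - rewrite -rD; apply: subset_trans s0E; apply: le_cube.
    have : D * h ^+ n <= D by rewrite ler_piMr// ltW.
    by rewrite /D; lra.
  rewrite lee_fin [in leRHS]exprS -[leRHS]mulrA; apply: ler_wpM2r; first by rewrite mulr_ge0// exprn_ge0// ltW.
  rewrite [leLHS]mulrDr.
  rewrite [leRHS](_ : eta = eta / 2 + eta / 2); last by lra.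
  apply: lerD.
    apply: le_trans thA.
    rewrite -/P (_ : P * (_ * _ * _) = A * (2 * th) `^ p); last by rewrite /A; ring.
    rewrite ler_wpM2l//.
    rewrite -[leRHS]powRr1; last by rewrite mulr_ge0// ltW.
    rewrite ger_powR ?(ltW p1)// mulr_gt0//=; lra.
  have -> : (th * (D * h ^+ n.+1)) ^+ N = (th * D) ^+ N * a ^+ n.+1.
    by rewrite mulrA exprMn -exprM mulnC exprM.
  rewrite powRM ?(ltW k0) ?(ltW hS0)// hb.
  have -> : eta ^+ n = a ^+ n * b ^+ n by rewrite exprMn.
  have bn0 : b ^+ n != 0 by rewrite gt_eqF// exprn_gt0.
  have an0 : a ^+ n != 0 by rewrite gt_eqF// exprn_gt0.
  have kp0 : 0 < k `^ p by rewrite powR_gt0.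
  rewrite mulrA; have -> : 2 `^ p * ((th * D) ^+ N * a ^+ n.+1)^-1 * (a ^+ n * b ^+ n * Z0 / (k `^ p * b ^+ n.+1)) =
    (P * (th * D) ^- N * Z0 / eta) / k `^ p.
    rewrite /eta /P !exprS.
    move: bn0 an0; generalize (b ^+ n) (a ^+ n) => bn an bn0 an0.
    have := thDN; rewrite invr_gt0; generalize ((th * D) ^+ N) => q q0.
    by field; rewrite bn0 an0 !gt_eqF.
  rewrite ler_pdivrMr//; apply: le_trans (ler_wpM2l _ kB); last by rewrite divr_ge0// ltW.
  rewrite le_eqVlt; apply/orP; left; apply/eqP; rewrite /B.
  generalize ((th * D) ^- N) => q.
  by field; rewrite gt_eqF.
have E0 : uenergy y r k = 0%E.
  apply/eqP; rewrite eq_le uenergy_ge0 andbT.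
  clearbody eta Z0.
  have vle n : (uenergy y r k <= (eta ^+ n * Z0)%:E)%E.
    apply: le_trans (claim n); apply: uenergy_le.
    - by rewrite lerDl mulr_ge0 ?exprn_ge0 ?(ltW D0) ?(ltW h0).
    - by rewrite ler_piMr ?(ltW k0)// gerBl exprn_ge0// ltW.
    - apply: subset_trans s0E; apply: le_cube.
      have : D * h ^+ n <= D by rewrite ler_piMr ?(ltW D0)// exprn_ile1// ltW.
      by rewrite /D; lra.
  have vfin : uenergy y r k \is a fin_num.
    rewrite ge0_fin_numE; last exact: uenergy_ge0.
    exact: le_lt_trans (vle 0%N) (ltry _).
  rewrite -(fineK vfin) lee_fin.
  have cv : (fun n => eta ^+ n * Z0) @ \oo --> (0 : R).
    rewrite -(mul0r Z0); apply: cvgMr_tmp.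
    by apply: cvg_expr; rewrite ger0_norm// ltW.
  rewrite -(cvg_lim _ cv)//; apply: limr_ge; first by apply/cvg_ex; exists 0.
  by apply: nearW => n; rewrite -lee_fin fineK.
exists k.
have mE2 : measurable_fun (cube y r) (fun x => (upart k x `^ p)%:E).
  apply: measurable_upart_pow; first exact: measurable_cube.
  by apply: subset_trans sE; apply: le_cube; exact: ltW.
have /(ae_eq_integral_abs mu (measurable_cube y r) mE2) : (\int[mu]_(x in cube y r) `|(upart k x `^ p)%:E|)%E = 0%E.
  by rewrite -[RHS]E0; apply: eq_integral => x _; rewrite gee0_abs// lee_fin powR_ge0.
apply: filterS => x + cx => /(_ cx)[] /eqP; rewrite powR_eq0 => /andP[/eqP up0 _].
by rewrite -subr_le0 -up0 /upart le_max lexx.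
Qed.

Lemma local_bound_compact K : compact K -> K `<=` E ->
  exists M, {ae mu, forall x, K x -> u x <= M}.
Proof.
move=> cK KE; have [d d0 [K' [_ K'E fat]]] := compact_fatten cK oE KE.
have d20 : 0 < d / 2 by rewrite divr_gt0.
have d2d : d / 2 < d by rewrite ltr_pdivrMr// ltr_pMr// ltr1n.
move: (cK); rewrite compact_cover => /(_ _ K (fun y => cube y (d / 2))) [].
- by move=> y Ky; rewrite cube_ball//; exact: ball_open.
- by move=> x Kx; exists x => // i; rewrite subrr normr0.
move=> D' D'K KD'.
have finite_bound (s : seq 'rV[R]_N) : (forall y, y \in s -> K y) ->
    exists M, {ae mu, forall x, (exists2 y, y \in s & cube y (d / 2) x) -> u x <= M}.
  elim: s => [|y s IH] sK; first by exists 0; apply: nearW => x [].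
  have [|M HM] := IH; first by move=> z zs; apply: sK; rewrite inE zs orbT.
  have [|M' HM'] := @local_bound y (d / 2) d d20 d2d.
    apply: subset_trans K'E => x cx; apply: (fat y); first by apply: sK; rewrite inE eqxx.
    exact: sub_ccube.
  exists (Num.max M M'); apply: filterS2 HM HM' => x h1 h2 [z].
  rewrite inE => /orP[/eqP ->|zs] cx; rewrite le_max; apply/orP; [right; exact: h2|left].
  by apply: h1; exists z.
have [|M HM] := finite_bound (finmap.enum_fset D').
  by move=> y yD; apply/set_mem; exact: D'K.
exists M; apply: filterS HM => x h Kx; apply: h.
by have [y yD cx] := KD' x Kx; exists y.
Qed.
End de_giorgi.

(** * Convex functions *)
Section subgradient.
Context {R : realType}.
Implicit Types (phi Phi a b : R -> R).

(** [a] selects at each point a slope of a supporting line of [Phi]. *)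
Definition subgradient Phi a := forall x y, a x * (y - x) <= Phi y - Phi x.

(** The supremum of the slopes of the chords to the left is at most every slope of
    a chord to the right. *)
Lemma convex_subgradient phi : convex_function [set: R^o] phi -> exists a, subgradient phi a.
Proof.
move=> cphi.
have slopes x y z : y < x -> x < z -> (phi x - phi y) * (z - x) <= (phi z - phi x) * (x - y).
  move=> yx xz; have zy : 0 < z - y by lra.
  have t0 : 0 <= (z - x) / (z - y) by rewrite divr_ge0 ?ltW//; lra.
  have t1 : (z - x) / (z - y) <= 1 by rewrite ler_pdivrMr// mul1r; lra.
  pose th := (z - x) / (z - y).
  have h : phi (th * y + (1 - th) * z) <= th * phi y + (1 - th) * phi z.
    exact: (cphi (Itv01 t0 t1) y z (mem_set Logic.I) (mem_set Logic.I)).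
  move: h; rewrite /th.
  have -> : (z - x) / (z - y) * y + (1 - (z - x) / (z - y)) * z = x.
    by field; rewrite gt_eqF.
  move=> h; have := ler_wpM2r (ltW zy) h.
  have -> : ((z - x) / (z - y) * phi y + (1 - (z - x) / (z - y)) * phi z) * (z - y) =
    (z - x) * phi y + (x - y) * phi z by field; rewrite gt_eqF.
  by lra.
suff /choice [a Ha] : forall x, exists c, forall y, c * (y - x) <= phi y - phi x by exists a.
move=> x; pose S := [set (phi x - phi y) / (x - y) | y in [set y | y < x]].
have Sub z : x < z -> ubound S ((phi z - phi x) / (z - x)).
  move=> xz _ [y /= yx <-]; rewrite ler_pdivrMr ?subr_gt0// mulrAC ler_pdivlMr ?subr_gt0//.
  exact: slopes.
have S0 : S !=set0 by exists ((phi x - phi (x - 1)) / (x - (x - 1))), (x - 1) => //=; lra.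
have supS : has_sup S.
  by split => //; exists ((phi (x + 1) - phi x) / (x + 1 - x)); apply: Sub; lra.
exists (sup S) => y; have [yx|xy|->] := ltgtP y x; last by rewrite !subrr mulr0.
- have : (phi x - phi y) / (x - y) <= sup S by apply: sup_upper_bound => //; exists y.
  by rewrite ler_pdivrMr ?subr_gt0//; lra.
- have : sup S <= (phi y - phi x) / (y - x) by apply: ge_sup => //; exact: Sub.
  by rewrite ler_pdivlMr ?subr_gt0.
Qed.

Lemma subgradient_nondecreasing Phi a : subgradient Phi a -> {homo a : x y / x <= y}.
Proof.
move=> sub x y; rewrite le_eqVlt => /predU1P[->//|xy].
have h1 := sub x y; have h2 := sub y x.
have xy0 : 0 < y - x by lra.
by rewrite -(ler_pM2r xy0); lra.
Qed.

Lemma subgradient_ge0 Phi a : subgradient Phi a -> {homo Phi : x y / x <= y} -> forall x, 0 <= a x.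
Proof.
move=> sub nd x; have := sub x (x - 1); have := nd (x - 1) x.
by rewrite gerBl ler01 => /(_ isT); lra.
Qed.

Lemma nondecreasing_measurableT Phi : {homo Phi : x y / x <= y} -> measurable_fun setT Phi.
Proof. by move=> nd; apply: nondecreasing_measurable => // x y _ _; exact: nd. Qed.

(** At a point where the truncation vanishes, the slope [0] will do. *)
Lemma subgradient_trunc phi a h : subgradient phi a ->
  subgradient (fun v => Num.max (phi v - h) 0) (fun v => if h < phi v then a v else 0).
Proof.
move=> sub x y; case: ifPn => [hx|]; last first.
  by rewrite -leNgt => hx; rewrite mul0r (max_r (x := phi x - h)) ?subr_le0// subr0 le_max lexx orbT.
rewrite (max_l (x := phi x - h)); last by rewrite subr_ge0 ltW.
apply: le_trans (sub x y) _.
have : phi y - h <= Num.max (phi y - h) 0 by rewrite le_max lexx.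
by lra.
Qed.

Lemma trunc_nondecreasing phi h : {homo phi : x y / x <= y} ->
  {homo (fun v => Num.max (phi v - h) 0) : x y / x <= y}.
Proof.
move=> nd x y xy; rewrite ge_max !le_max lexx orbT andbT.
by rewrite lerD2r nd.
Qed.

Lemma subgradient_upart k : subgradient (fun v : R => Num.max (v - k) 0) (fun v => (k <= v)%R%:R).
Proof.
move=> x y; have [kx|kx] := leP k x => /=.
  rewrite mul1r (max_l (x := x - k)) ?subr_ge0//.
  have : y - k <= Num.max (y - k) 0 by rewrite le_max lexx.
  by lra.
by rewrite mul0r (max_r (x := x - k)); [rewrite subr0 le_max lexx orbT|rewrite subr_le0 ltW].
Qed.

Lemma upart_nondecreasing k : {homo (fun v : R => Num.max (v - k) 0) : x y / x <= y}.
Proof. exact: (trunc_nondecreasing (phi := id)). Qed.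

End subgradient.

(** * Difference quotients in L^1 *)
Section L1_derivative.
Context {R : realType} {N : nat}.
Local Notation mu := (@lebesgue_rV R N).
Local Notation lam := (@lebesgue_measure R).
Local Notation dir i := (delta_mx ord0 i : 'rV[R]_N).
Implicit Types (E K : set 'rV[R]_N) (v : 'rV[R]_N).

(** Finitely many cubes of edge [2 * r] centered in [K] cover [K]. *)
Lemma ae_compact_cover K (P : 'rV[R]_N -> Prop) r : 0 < r -> compact K ->
  (forall y, K y -> {ae mu, forall x, cube y r x -> K x -> P x}) ->
  {ae mu, forall x, K x -> P x}.
Proof.
move=> r0 cK H; move: (cK); rewrite compact_cover => /(_ _ K (fun y => cube y r)) [].
- by move=> y Ky; rewrite cube_ball//; exact: ball_open.
- by move=> x Kx; exists x => // i; rewrite subrr normr0.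
move=> D' D'K KD'.
have finite_ae (s : seq 'rV[R]_N) : (forall y, y \in s -> K y) ->
    {ae mu, forall x, (exists2 y, y \in s & cube y r x) -> K x -> P x}.
  elim: s => [|y s IH] sK; first by apply: nearW => x [].
  have {}IH := IH (fun z zs => sK z (@mem_behead _ (y :: s) z zs)).
  have Hy := H y (sK y (mem_head _ _)).
  apply: filterS2 IH Hy => x h1 h2 [z].
  by rewrite inE => /orP[/eqP ->|zs] cx; [exact: h2|apply: h1; exists z].
have := finite_ae (finmap.enum_fset D') (fun y yD => set_mem (D'K y yD)).
apply: filterS => x h Kx; apply: h => //.
by have [y yD cx] := KD' x Kx; exists y.
Qed.

Lemma ae_shift (h : 'rV[R]_N) (P : 'rV[R]_N -> Prop) : {ae mu, forall x, P x} ->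
  {ae mu, forall x, P (x + h)}.
Proof.
move=> [A [mA A0 PA]]; exists ((fun x => x + h) @^-1` A); split.
- by rewrite -[X in measurable X]setTI; exact: measurable_shift.
- exact: etrans (lebesgue_rV_shift h mA) A0.
- by move=> x nP; apply: PA.
Qed.

Lemma ccube_dir (x : 'rV[R]_N) d i s : `|s| <= d -> ccube x d (x + s *: dir i).
Proof.
move=> sd j; rewrite !mxE eqxx/= addrAC subrr add0r.
by case: eqP => _; rewrite ?mulr1// mulr0 normr0 (le_trans _ sd).
Qed.

Lemma line_integral_near v t (g : 'rV[R]_N -> R) x : 0 < t -> measurable_fun setT g ->
  ((`|line_integral v t g x - t * g x|)%:E <=
   \int[lam]_(s in bseg t) (`|g (x - s *: v) - g x|)%:E)%E.
Proof.
move=> t0 mg; have mI := measurable_bseg t.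
set J := (\int[lam]_(s in bseg t) _)%E.
have [Joo|] := ltP J +oo%E; last by rewrite leye_eq => /eqP ->; rewrite leey.
have mh : measurable_fun setT (fun s : R => g (x - s *: v)).
  by apply: (measurableT_comp (f := g)) => //; exact: measurable_line.
have intd : lam.-integrable (bseg t) (EFin \o (fun s => g (x - s *: v) - g x)).
  apply/integrableP; split; last exact: Joo.
  by apply/measurable_EFinP; apply: measurable_funTS; exact: measurable_funB.
have intc : lam.-integrable (bseg t) (EFin \o (fun=> g x)).
  apply/integrableP; split; first exact/measurable_EFinP.
  rewrite (eq_integral (cst (`|g x|)%:E))//.
  by rewrite integral_cst// [X in (_ * X)%E](lebesgue_bseg t0) -EFinM ltry.
have inth : lam.-integrable (bseg t) (EFin \o (fun s => g (x - s *: v))).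
  have /(_ mI) := fun m => integrableD m intd intc; congr (lam.-integrable _ _).
  by apply/funext => s /=; rewrite -EFinD subrK.
have -> : line_integral v t g x - t * g x = \int[lam]_(s in bseg t) (g (x - s *: v) - g x).
  by rewrite RintegralB// Rintegral_cst// mulrC [X in fine X](lebesgue_bseg t0).
apply: le_trans (_ : ((\int[lam]_(s in bseg t) `|g (x - s *: v) - g x|)%R)%:E <= _)%E.
  by rewrite lee_fin; exact: le_normr_Rintegral.
by rewrite /Rintegral fineK//; apply: integrable_fin_num => //; exact: integrable_norm intd.
Qed.

(** The derivative in the direction [v] in the sense of [L^1] on compact sets,
    multiplied through by [t]; it is one-sided because right difference quotients
    already determine a weak derivative. *)
Definition L1_derivative E v (w g : 'rV[R]_N -> R) := forall K, compact K -> K `<=` E ->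
  forall e : R, 0 < e -> exists2 d : R, 0 < d & forall t, 0 < t -> t < d ->
    (\int[mu]_(x in K) (`|w (x + t *: v) - w x - t * g x|)%:E <= (e * t)%:E)%E.

(** By [weak_increment], [w (x + t v) - w x - t g x] is the line integral of
    [g (x - s v) - g x]; exchanging integrals leaves the [L^1]-modulus of
    continuity of translations of [g]. *)
Lemma weak_gradient_L1 E w Dw i : open E -> weak_gradient E w Dw ->
  L1_derivative E (dir i) w (fun x => Dw x ord0 i).
Proof.
move=> oE wD K cK KE e e0; have [w1 /(_ i) g1 _] := wD.
have [d d0 [K' [cK' K'E fat]]] := compact_fatten cK oE KE.
have mK := compact_measurable_rV cK; have mK' := compact_measurable_rV cK'.
pose v := dir i; pose g x := Dw x ord0 i.
(* extensions by zero off [K'], to have integrable functions on the whole space *)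
pose W x := w x * \1_K' x; pose G x := g x * \1_K' x.
have intG : mu.-integrable setT (EFin \o G).
  by apply: (integrable_indicM mK'); exact: (Lp_loc1_integrable oE g1 cK' K'E).
have mG : measurable_fun setT G by apply/measurable_EFinP; exact: measurable_int intG.
have mW : measurable_fun setT W.
  apply: measurable_fun_indicM => //; apply: measurable_funS w1.1 => //.
  exact: open_measurable_rV.
have [del del0 Hdel] := integrable_transl_continuous v intG e0.
have d2 : 0 < d / 2 by rewrite divr_gt0.
have d2d : d / 2 < d by rewrite ltr_pdivrMr// ltr_pMr// ltr1n.
exists (Num.min del (d / 2)); first by rewrite lt_min del0.
move=> t t0; rewrite lt_min => /andP[tdel td].
have K'1 x s : K x -> `|s| <= d -> \1_K' (x + s *: v) = 1 :> R.
  by move=> Kx sd; rewrite indicE mem_set//; apply: fat Kx _; exact: ccube_dir.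
have K1 x : K x -> \1_K' x = 1 :> R.
  by move=> Kx; have := K'1 x 0 Kx; rewrite scale0r addr0 normr0; apply; exact: ltW.
have tld : `|t| <= d by rewrite gtr0_norm// ltW// (lt_trans td).
have key : {ae mu, forall x, K x -> W (x + t *: v) - W x = line_integral v t G x}.
  apply: (ae_compact_cover d2) => // y Ky.
  pose c := y - const_mx (d / 2); pose b := y + const_mx (d / 2).
  have CE : cbox c (b + t *: v) `<=` E.
    apply: subset_trans K'E => x xc; apply: (fat y) => // j; have := xc j.
    have := dir_ge0 i j; have : dir i ord0 j <= 1 by rewrite mxE; case: (_ && _).
    rewrite !mxE => v1 v0 /andP[x1 x2].
    have : t * ((ord0 == ord0 :> 'I_1) && (j == i))%:R <= t by rewrite ler_piMr// ltW.
    by rewrite ler_norml; move=> tv; apply/andP; split; lra.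
  have := weak_increment oE wD t0 CE; apply: filterS => x H cx Kx.
  rewrite /W K'1// K1// !mulr1 H; last by rewrite -cube_obox.
  apply: eq_Rintegral => s; rewrite inE /bseg/= in_itv/= => /andP[s1 s2].
  by rewrite /G -scaleNr K'1 ?mulr1// normrN ler0_norm// lerNl (le_trans _ s1)// lerN2 ltW// (lt_trans td).
pose F (xs : 'rV[R]_N * R) := (`|G (xs.1 - xs.2 *: v) - G xs.1|)%:E.
have mF : measurable_fun setT F.
  apply/measurable_EFinP; apply: measurableT_comp => //; apply: measurable_funB.
    by apply: (measurableT_comp mG); exact: measurable_transl_pair.
  exact: measurableT_comp.
have F0 z : (0 <= F z)%E by rewrite lee_fin.
apply: (@le_trans _ _ (\int[mu]_(x in K) \int[lam]_(s in bseg t) F (x, s))%E).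
  have -> : (\int[mu]_(x in K) (`|w (x + t *: v) - w x - t * g x|)%:E =
     \int[mu]_(x in K) (`|W (x + t *: v) - W x - t * G x|)%:E)%E.
    by apply: eq_integral => x; rewrite inE => Kx; rewrite /W /G K'1// K1// !mulr1.
  apply: ae_ge0_le_integral => //.
  - apply: measurable_funTS; apply/measurable_EFinP; apply: measurableT_comp => //.
    apply: measurable_funB; last exact: measurable_funM.
    by apply: measurable_funB => //; exact: measurable_fun_shift.
  - by move=> x _; apply: integral_ge0 => s _; exact: F0.
  - by apply: measurable_funTS; apply: measurable_integral_set => //; exact: measurable_bseg.
  - by apply: filterS key => x H Kx; rewrite (H Kx); exact: line_integral_near.
rewrite (tonelli_set mu lam)//; last exact: measurable_bseg.
apply: (@le_trans _ _ (\int[lam]_(s in bseg t) e%:E)%E); last first.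
  by rewrite integral_cst; [rewrite [X in (_ * X)%E](lebesgue_bseg t0)|exact: measurable_bseg].
apply: ge0_le_integral.
- exact: measurable_bseg.
- by move=> s _; apply: integral_ge0 => x _; exact: F0.
- by apply: measurable_funTS; exact: (measurable_integral_set2 mu).
- exact: measurable_cst.
- move=> s; rewrite /bseg/= in_itv/= => /andP[s1 s2].
  apply: le_trans (Hdel (- s) _); last by rewrite normrN ler0_norm// (le_lt_trans _ tdel)// lerNl.
  apply: (@le_trans _ _ (\int[mu]_x F (x, s))%E).
    apply: ge0_subset_integral => //.
    by apply: (measurableT_comp mF); exact: measurable_pair2.
  by rewrite le_eqVlt; apply/orP; left; apply/eqP; apply: eq_integral => x _; rewrite /F scaleNr.
Qed.

(** The lower bound of the increment of [Phi] has the slope at [ux], the upper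
    bound that at [uy].  In the latter [ay * gx] is exchanged for [ax * gx] in two
    steps, through [ay * gy], since only [ay] paired with [gy] is a translate of
    [ax] paired with [gx]. *)
Lemma squeeze_increment (uy ux gx gy Py Px ax ay t M : R) : 0 <= t -> 0 <= M ->
  `|ax| <= M -> `|ay| <= M -> ax * (uy - ux) <= Py - Px -> ay * (ux - uy) <= Px - Py ->
  `|Py - Px - t * (ax * gx)| <=
  M * `|uy - ux - t * gx| + (t * M * `|gy - gx| + t * `|ay * gy - ax * gx|).
Proof.
move=> t0 M0 axM ayM s1 s2.
set X1 := uy - ux - t * gx; set X2 := gy - gx; set X3 := ay * gy - ax * gx.
have h1 : - (ax * X1) <= M * `|X1|.
  by rewrite (le_trans (ler_norm _))// normrN normrM ler_wpM2r.
have h2 : ay * X1 <= M * `|X1| by rewrite (le_trans (ler_norm _))// normrM ler_wpM2r.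
have h3 : - (ay * X2) <= M * `|X2|.
  by rewrite (le_trans (ler_norm _))// normrN normrM ler_wpM2r.
have h2' : 0 <= t * M * `|X2| by rewrite !mulr_ge0.
have h3' : 0 <= t * `|X3| by rewrite mulr_ge0.
have h3t := ler_wpM2l t0 h3; have h4t := ler_wpM2l t0 (ler_norm X3).
rewrite ler_norml; apply/andP; split.
  apply: (@le_trans _ _ (ax * X1)); first by lra.
  by rewrite /X1; lra.
have -> : Py - Px - t * (ax * gx) =
    (Py - Px - ay * (uy - ux)) + ay * X1 + (t * (- (ay * X2))) + t * X3.
  by rewrite /X1 /X2 /X3; ring.
lra.
Qed.

(** The three terms of [squeeze_increment] tend to zero in [L^1]: the first one by
    the hypothesis on [u], the others by continuity of translations of [g] and of
    [a (u) g]. *)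
Lemma L1_chain_rule E i u g (Phi a : R -> R) : open E -> Lp_loc E 1 u -> Lp_loc E 1 g ->
  L1_derivative E (dir i) u g ->
  subgradient Phi a -> measurable_fun setT a ->
  (forall K, compact K -> K `<=` E -> exists M : R, {ae mu, forall x, K x -> `|a (u x)| <= M}) ->
  measurable_fun setT Phi ->
  L1_derivative E (dir i) (Phi \o u) (fun x => a (u x) * g x).
Proof.
move=> oE u1 g1 ug sub ma bnd mPhi K cK KE e e0.
have mE := open_measurable_rV oE.
have [d d0 [K' [cK' K'E fat]]] := compact_fatten cK oE KE.
have mK := compact_measurable_rV cK; have mK' := compact_measurable_rV cK'.
have [M0 aM0] := bnd K' cK' K'E.
pose M : R := `|M0|; have M_ge0 : 0 <= M by exact: normr_ge0.
have aM : {ae mu, forall x, K' x -> `|a (u x)| <= M}.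
  by apply: filterS aM0 => x H K'x; rewrite (le_trans (H K'x))// ler_norm.
pose v := dir i; pose g' x := g x * \1_K' x; pose F x := Phi (u x) * \1_K' x.
pose U x := u x * \1_K' x; pose A x := a (u x) * \1_K' x; pose H x := A x * g' x.
have muK' : measurable_fun K' u by apply: measurable_funS u1.1.
have intG : mu.-integrable setT (EFin \o g').
  by apply: (integrable_indicM mK'); exact: (Lp_loc1_integrable oE g1 cK' K'E).
have mG : measurable_fun setT g' by apply/measurable_EFinP; exact: measurable_int intG.
have mU : measurable_fun setT U by apply: measurable_fun_indicM.
have mF : measurable_fun setT F.
  by apply: (measurable_fun_indicM (f := Phi \o u)) => //; exact: measurableT_comp.
have mA : measurable_fun setT A.
  by apply: (measurable_fun_indicM (f := a \o u)) => //; exact: measurableT_comp.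
have mH : measurable_fun setT H by exact: measurable_funM.
have intH : mu.-integrable setT (EFin \o H).
  apply/integrableP; split; first exact/measurable_EFinP.
  have /integrableP[_] := integrableZl measurableT M intG; apply: le_lt_trans.
  apply: ae_ge0_le_integral => //.
  - by apply: measurableT_comp => //; exact/measurable_EFinP.
  - by apply: measurableT_comp => //; apply/measurable_EFinP; exact: measurable_funM.
  apply: filterS aM => x Hx _ /=; rewrite lee_fin !normrM /A indicE (ger0_norm M_ge0).
  rewrite ler_wpM2r//; have [xK'|xK'] := boolP (x \in K'); last by rewrite normr0 mulr0.
  by rewrite normr1 mulr1 Hx//; rewrite inE in xK'.
pose e1 := e / (2 * M + 1).
have M1 : 0 < 2 * M + 1 by rewrite ltr_wpDl// mulr_ge0.
have e10 : 0 < e1 by rewrite divr_gt0.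
have [d1 d10 Hd1] := ug K cK KE _ e10.
have [d2 d20 Hd2] := integrable_transl_continuous v intG e10.
have [d3 d30 Hd3] := integrable_transl_continuous v intH e10.
exists (Num.min d (Num.min d1 (Num.min d2 d3))); first by rewrite !lt_min d0 d10 d20 d30.
move=> t t0; rewrite !lt_min => /and4P[td td1 td2 td3].
have tn : `|t| = t by rewrite gtr0_norm.
have K'1 x : K x -> \1_K' (x + t *: v) = 1 :> R.
  by move=> Kx; rewrite indicE mem_set//; apply: fat Kx _; apply: ccube_dir; rewrite tn ltW.
have K1 x : K x -> \1_K' x = 1 :> R.
  move=> Kx; rewrite indicE mem_set//; apply: fat Kx _ => j.
  by rewrite subrr normr0 ltW.
pose Q1 x := M * `|U (x + t *: v) - U x - t * g' x|.
pose Q2 x := t * M * `|g' (x + t *: v) - g' x|.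
pose Q3 x := t * `|H (x + t *: v) - H x|.
have mQ1 : measurable_fun setT Q1.
  apply: measurable_funM => //; apply: measurableT_comp => //.
  apply: measurable_funB; last exact: measurable_funM.
  by apply: measurable_funB => //; exact: measurable_fun_shift.
have mQ2 : measurable_fun setT Q2.
  apply: measurable_funM => //; apply: measurableT_comp => //.
  by apply: measurable_funB => //; exact: measurable_fun_shift.
have mQ3 : measurable_fun setT Q3.
  apply: measurable_funM => //; apply: measurableT_comp => //.
  by apply: measurable_funB => //; exact: measurable_fun_shift.
have Q10 x : 0 <= Q1 x by rewrite mulr_ge0.
have Q20 x : 0 <= Q2 x by rewrite !mulr_ge0// ltW.
have Q30 x : 0 <= Q3 x by rewrite mulr_ge0// ltW.
have -> : (\int[mu]_(x in K) (`|(Phi \o u) (x + t *: v) - (Phi \o u) x - t * (a (u x) * g x)|)%:E =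
    \int[mu]_(x in K) (`|F (x + t *: v) - F x - t * H x|)%:E)%E.
  by apply: eq_integral => x; rewrite inE => Kx; rewrite /H /A /g' /F K'1// K1// !mulr1.
apply: (@le_trans _ _ (\int[mu]_(x in K) ((Q1 x)%:E + ((Q2 x)%:E + (Q3 x)%:E)))%E).
  apply: ae_ge0_le_integral => //.
  - apply: measurable_funTS; apply/measurable_EFinP; apply: measurableT_comp => //.
    apply: measurable_funB; last exact: measurable_funM.
    by apply: measurable_funB => //; exact: measurable_fun_shift.
  - by move=> x _; rewrite -!EFinD lee_fin !addr_ge0.
  - apply: measurable_funTS; apply: emeasurable_funD; first exact/measurable_EFinP.
    by apply: emeasurable_funD; exact/measurable_EFinP.
  apply: filterS2 aM (ae_shift (t *: v) aM) => x ax ay Kx.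
  rewrite -!EFinD lee_fin /Q1 /Q2 /Q3 /H /A /g' /F /U K'1// K1// !mulr1.
  have {}ax : `|a (u x)| <= M by apply: ax; have := K1 x Kx; rewrite indicE; case: (boolP (x \in K')); rewrite ?inE// => _ /eqP; rewrite eq_sym oner_eq0.
  have {}ay : `|a (u (x + t *: v))| <= M by apply: ay; have := K'1 x Kx; rewrite indicE; case: (boolP (_ \in K')); rewrite ?inE// => _ /eqP; rewrite eq_sym oner_eq0.
  by apply: squeeze_increment => //; exact: ltW.
have mE1 := (measurable_EFinP _ _).2 mQ1; have mE2 := (measurable_EFinP _ _).2 mQ2.
have mE3 := (measurable_EFinP _ _).2 mQ3.
rewrite ge0_integralD; [|exact: mK|by move=> x _; rewrite lee_fin|exact: measurable_funTS| |]; last 2 first.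
- by move=> x _; rewrite -EFinD lee_fin addr_ge0.
- by apply: measurable_funTS; exact: emeasurable_funD.
rewrite ge0_integralD; [|exact: mK|by move=> x _; rewrite lee_fin|exact: measurable_funTS|
  by move=> x _; rewrite lee_fin|exact: measurable_funTS].
have sum : (M%:E * (e1 * t)%:E + ((t * M)%:E * e1%:E + t%:E * e1%:E) = (e * t)%:E)%E.
  by rewrite -!EFinM -!EFinD; congr EFin; rewrite /e1; field; rewrite gt_eqF.
rewrite -sum.
apply: leeD; last apply: leeD.
- rewrite /Q1; under eq_integral do rewrite EFinM.
  rewrite ge0_integralZl//; last first.
    apply: measurable_funTS; apply/measurable_EFinP; apply: measurableT_comp => //.
    apply: measurable_funB; last exact: measurable_funM.
    by apply: measurable_funB => //; exact: measurable_fun_shift.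
  apply: lee_wpmul2l => //; apply: le_trans (Hd1 t t0 td1).
  rewrite le_eqVlt; apply/orP; left; apply/eqP.
  by apply: eq_integral => x; rewrite inE => Kx; rewrite /U /g' K'1// K1// !mulr1.
- rewrite /Q2; under eq_integral do rewrite EFinM.
  rewrite ge0_integralZl//; last 2 first.
  - by apply: measurable_funTS; apply: measurable_abs_diff => //; exact: measurable_fun_shift.
  - by rewrite lee_fin mulr_ge0// ltW.
  apply: lee_wpmul2l; first by rewrite lee_fin mulr_ge0// ltW.
  apply: le_trans (Hd2 t _); last by rewrite tn.
  apply: ge0_subset_integral => //.
  by apply: measurable_abs_diff => //; exact: measurable_fun_shift.
- rewrite /Q3; under eq_integral do rewrite EFinM.
  rewrite ge0_integralZl//; last 2 first.
  - by apply: measurable_funTS; apply: measurable_abs_diff => //; exact: measurable_fun_shift.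
  - by rewrite lee_fin ltW.
  apply: lee_wpmul2l; first by rewrite lee_fin ltW.
  apply: le_trans (Hd3 t _); last by rewrite tn.
  apply: ge0_subset_integral => //.
  by apply: measurable_abs_diff => //; exact: measurable_fun_shift.
Qed.

(** [J s], the integral of [W z (x + s v)], has the derivative [D], the integral of
    [w] against the derivative of [z].  Moving the translation from [z] to [W], the
    same difference quotient tends to minus the integral [I] of [g z]. *)
Lemma L1_weak_gradient E w (Dw : 'rV[R]_N -> 'rV[R]_N) : open E -> Lp_loc E 1 w ->
  (forall i, Lp_loc E 1 (fun x => Dw x ord0 i)) ->
  (forall i, L1_derivative E (dir i) w (fun x => Dw x ord0 i)) -> weak_gradient E w Dw.
Proof.
move=> oE w1 g1 wg; split => // z tz i.
have [_ [K [cK KE zK]]] := tz.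
have [d d0 [K' [cK' K'E fat]]] := compact_fatten cK oE KE.
have mK := compact_measurable_rV cK; have mK' := compact_measurable_rV cK'.
have K1 x : K x -> \1_K' x = 1 :> R.
  move=> Kx; rewrite indicE mem_set//; apply: fat Kx _ => j.
  by rewrite subrr normr0 ltW.
pose v := dir i; pose g x := Dw x ord0 i.
pose W x := w x * \1_K' x; pose G x := g x * \1_K' x.
have intW : mu.-integrable setT (EFin \o W).
  by apply: (integrable_indicM mK'); exact: (Lp_loc1_integrable oE w1 cK' K'E).
have intG : mu.-integrable setT (EFin \o G).
  by apply: (integrable_indicM mK'); exact: (Lp_loc1_integrable oE (g1 i) cK' K'E).
have mW : measurable_fun setT W by apply/measurable_EFinP; exact: measurable_int intW.
have mG : measurable_fun setT G by apply/measurable_EFinP; exact: measurable_int intG.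
have clK : closed K by apply: compact_closed => //; exact: hausdorff_rV.
have cz := test_function_continuous tz.
have dz x : derivable z x v by exact: test_function_derivable tz.
have cpz : continuous (partial i z) by exact: test_function_partial_continuous tz.
have mz : measurable_fun setT z by exact: continuous_measurable_rV.
have [C C0 zC] := bounded_compact_support cz cK zK.
have pz0 x : ~ K x -> partial i z x = 0 by exact: derive_out.
have [C' C'0 pzC] := bounded_compact_support cpz cK pz0.
pose J s := \int[mu]_x (W x * z (x + s *: v)).
pose D := \int[mu]_x (W x * partial i z x).
pose I := \int[mu]_x (G x * z x).
have intWz s : mu.-integrable setT (fun x => (W x * z (x + s *: v))%:E).
  by apply: (integrable_mul_bounded (M := C)) => //; exact: measurable_fun_shift_cont.
have intGz : mu.-integrable setT (fun x => (G x * z x)%:E).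
  exact: (integrable_mul_bounded (M := C)).
have intWp : mu.-integrable setT (fun x => (W x * partial i z x)%:E).
  by apply: (integrable_mul_bounded (M := C')) => //; exact: continuous_measurable_rV.
have dJ : is_derive (0 : R) (1 : R) J D.
  have := is_derive_int_transl (M := C) (M' := C') 0 intW cz dz zC pzC.
  by rewrite /D; under [X in is_derive _ _ _ X -> _]eq_Rintegral do rewrite scale0r addr0.
have intWs t : mu.-integrable setT (fun x => (W (x + t *: v) * z x)%:E).
  have := integrable_shift (t *: v) (intWz (- t)).
  by apply: eq_integrable => // x _; rewrite /= scaleNr addrK.
have Jdiff t : J (- t) - J 0 - t * I =
    \int[mu]_x ((W (x + t *: v) - W x - t * G x) * z x).
  have JE : J (- t) = \int[mu]_x (W (x + t *: v) * z x).
    rewrite /J /Rintegral -(integral_shift (t *: v) (intWz (- t))).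
    by congr fine; apply: eq_integral => x _; rewrite scaleNr addrK.
  have int0 : mu.-integrable setT (fun x => (W x * z x)%:E).
    exact: (integrable_mul_bounded (M := C)).
  have -> : J 0 = \int[mu]_x (W x * z x).
    by apply: eq_Rintegral => x _; rewrite scale0r addr0.
  have intB := integrableB measurableT (intWs t) int0.
  have intZ := integrableZl measurableT t intGz.
  transitivity (\int[mu]_x ((W (x + t *: v) * z x - W x * z x) - t * (G x * z x))).
    rewrite JE /I -(RintegralZl t measurableT intGz).
    rewrite RintegralB//.
    congr (_ - _); symmetry; apply: RintegralB.
    - exact: measurableT.
    - exact: intWs.
    - exact: int0.
  by apply: eq_Rintegral => x _; ring.
(* the test function lives on [K], where the truncations are the identity *)
suff DI : D = - I.
  have -> : (\int[mu]_(x in E) (w x * partial i z x)%:E = \int[mu]_x (W x * partial i z x)%:E)%E.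
    rewrite integral_support; last by move=> x nE; apply: pz0 => /KE.
    apply: eq_integral => x _; have [Kx|nKx] := pselect (K x); last by rewrite pz0// !mulr0.
    by rewrite /W K1// mulr1.
  have -> : (\int[mu]_(x in E) (Dw x ord0 i * z x)%:E = \int[mu]_x (G x * z x)%:E)%E.
    rewrite (integral_support g); last by move=> x nE; apply: zK => /KE.
    apply: eq_integral => x _; have [Kx|nKx] := pselect (K x); last by rewrite zK// !mulr0.
    by rewrite /G K1// mulr1.
  by rewrite !fine_Rintegral// -/D -/I DI.
apply/eqP; rewrite -subr_eq0 opprK -normr_le0; apply/ler_addgt0Pl => e e0.
rewrite addr0.
pose e1 := e / (C + 1); have C1 : 0 < C + 1 by rewrite ltr_wpDl.
have e10 : 0 < e1 by rewrite divr_gt0.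
have [d1 d10 Hd1] := wg i K cK KE _ e10.
have [dJ1 dJ2] := dJ.
have : (fun h : R => h^-1 *: (J (h *: 1 + 0) - J 0)) @ 0^' --> D.
  by rewrite -dJ2; exact: dJ1.
move=> /cvgrPdist_le/(_ e1 e10); rewrite near_withinE => /nbhs_ballP[r /= r0 Hr].
pose t := Num.min d (Num.min d1 r) / 2.
have m0 : 0 < Num.min d (Num.min d1 r) by rewrite !lt_min d0 d10.
have t0 : 0 < t by rewrite divr_gt0.
have : t < Num.min d (Num.min d1 r) by rewrite /t ltr_pdivrMr// ltr_pMr// ltr1n.
rewrite !lt_min => /and3P[td td1 tr].
have := Hr (- t); rewrite /ball/= sub0r opprK gtr0_norm// => /(_ tr).
rewrite oppr_eq0 gt_eqF// => /(_ isT).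
have -> : - t *: 1 + 0 = - t :> R by rewrite addr0 [_ *: _]mulr1.
set q := (- t)^-1 *: _ => Dq.
have qE : - q * t = J (- t) - J 0.
  by rewrite /q [_ *: _]/GRing.scale/=; field; rewrite gt_eqF.
have : `|J (- t) - J 0 - t * I| <= C * e1 * t.
  rewrite Jdiff -lee_fin.
  apply: (@le_trans _ _ (\int[mu]_x (`|(W (x + t *: v) - W x - t * G x) * z x|)%:E)%E).
    have intd : mu.-integrable setT (EFin \o (fun x => (W (x + t *: v) - W x - t * G x) * z x)).
      apply: (integrable_mul_bounded (M := C)) => //.
      have := integrableB measurableT (integrableB measurableT (integrable_shift (t *: v) intW) intW)
        (integrableZl measurableT t intG).
      by apply: eq_integrable.
    rewrite fine_Rintegral//; last exact: integrable_norm intd.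
    by rewrite lee_fin; exact: le_normr_Rintegral.
  have -> : (\int[mu]_x (`|(W (x + t *: v) - W x - t * G x) * z x|)%:E =
     \int[mu]_x (`|W (x + t *: v) - W x - t * G x| * `|z x|)%:E)%E.
    by apply: eq_integral => x _; rewrite normrM.
  rewrite -(integral_support (D := K)); last by move=> x nK; rewrite zK// normr0.
  have mWG : measurable_fun setT (fun x : 'rV[R]_N => (`|W (x + t *: v) - W x - t * G x|)%:E).
    apply/measurable_EFinP; apply: measurableT_comp => //.
    apply: measurable_funB; last exact: measurable_funM.
    by apply: measurable_funB => //; exact: measurable_fun_shift.
  apply: (@le_trans _ _ (\int[mu]_(x in K) (C%:E * (`|W (x + t *: v) - W x - t * G x|)%:E))%E).
    apply: ge0_le_integral.
    - exact: mK.
    - by move=> x _; rewrite lee_fin mulr_ge0.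
    - apply: measurable_funTS; apply/measurable_EFinP; apply: measurable_funM; first exact/measurable_EFinP.
      exact: measurableT_comp.
    - by apply: measurable_funTS; apply: emeasurable_funM.
    - by move=> x _; rewrite -EFinM lee_fin mulrC ler_wpM2r.
  rewrite ge0_integralZl//; last exact: measurable_funTS.
  rewrite -mulrA EFinM; apply: lee_wpmul2l; first by rewrite lee_fin.
  apply: le_trans (Hd1 t t0 td1); rewrite le_eqVlt; apply/orP; left; apply/eqP.
  apply: eq_integral => x; rewrite inE => Kx; rewrite /W /G (K1 _ Kx) indicE mem_set ?mulr1//.
  by apply: fat Kx _; apply: ccube_dir; rewrite gtr0_norm// ltW.
rewrite -qE (_ : - q * t - t * I = (- q - I) * t); last by ring.
rewrite normrM (gtr0_norm t0) ler_pM2r// => qI.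
have -> : D + I = (D - q) - (- q - I) by ring.
rewrite (le_trans (ler_normB _ _))//.
have -> : e = e1 + C * e1 by rewrite /e1; field; rewrite gt_eqF.
exact: lerD.
Qed.
End L1_derivative.

(** * Sums of powers *)
Section powR_sums.
Context {R : realType} (p : R) (p1 : 1 < p).
Let p0 : 0 < p. Proof. exact: lt_trans p1. Qed.

Lemma powR_superD (x y : R) : 0 <= x -> 0 <= y -> x `^ p + y `^ p <= (x + y) `^ p.
Proof.
wlog : / 0 < x + y => [H|xy] x0 y0.
  have [xy|] := ltP 0 (x + y); first exact: H.
  move=> xy; have [-> ->] : x = 0 /\ y = 0 by split; lra.
  by rewrite addr0 powR0 ?gt_eqF// addr0.
have le z : 0 <= z -> z <= x + y -> z `^ p <= z * (x + y) `^ (p - 1).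
  rewrite le_eqVlt => /predU1P[<- _|z0 zxy]; first by rewrite powR0 ?gt_eqF// mul0r.
  rewrite powR_predr// mulrC ler_wpM2l ?(ltW z0)//.
  by rewrite ge0_ler_powR ?nnegrE ?subr_ge0 ?(ltW p1) ?(ltW z0) ?(ltW xy).
rewrite [leRHS]powR_predr// mulrC mulrDl; apply: lerD; apply: le => //; lra.
Qed.

Lemma sum_powR_le n (F : 'I_n -> R) : (forall i, 0 <= F i) ->
  \sum_(i < n) F i `^ p <= (\sum_(i < n) F i) `^ p.
Proof.
move=> F0; elim: n F F0 => [|n IH] F F0; first by rewrite !big_ord0 powR0 ?gt_eqF.
rewrite !big_ord_recr /=; apply: le_trans (powR_superD _ _) => //.
  by rewrite lerD2r; exact: IH.
exact: sumr_ge0.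
Qed.

Lemma powR_sum_le (I : Type) (s : seq I) (F : I -> R) : (forall i, 0 <= F i) ->
  (\sum_(i <- s) F i) `^ p <= (2 `^ p) ^+ size s * \sum_(i <- s) F i `^ p.
Proof.
move=> F0; have P1 : 1 <= 2 `^ p by rewrite -[leLHS](powRr0 2) ler_powR ?ler1n// ltW.
have P0 : 0 <= 2 `^ p by exact: powR_ge0.
elim: s => [|i s IH]; first by rewrite !big_nil powR0 ?gt_eqF// mulr0.
rewrite !big_cons /= exprS; apply: le_trans (powR_le2D p0 _ _) _ => //; first exact: sumr_ge0.
rewrite -mulrA ler_wpM2l// mulrDr lerD// ler_peMl ?powR_ge0//.
exact: exprn_ege1.
Qed.

Lemma sum_sqr_le n (F : 'I_n -> R) : \sum_i F i ^+ 2 <= (\sum_i `|F i|) ^+ 2.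
Proof.
elim: n F => [|n IH] F; first by rewrite !big_ord0 expr0n.
rewrite !big_ord_recl /= sqrrD real_normK ?num_real// -addrA lerD2l.
apply: le_trans (IH _) _; rewrite lerDr mulrn_wge0// mulr_ge0// sumr_ge0//.
Qed.

Lemma enorm_le_sum N (v : 'rV[R]_N) : enorm v <= \sum_i `|v ord0 i|.
Proof.
have S0 : 0 <= \sum_i `|v ord0 i| by exact: sumr_ge0.
rewrite -(ger0_norm S0) -sqrtr_sqr /enorm ler_wsqrtr//.
exact: sum_sqr_le.
Qed.
End powR_sums.

(** * The chain rule *)
Section chain_rule.
Context {R : realType} {N : nat}.
Local Notation mu := (@lebesgue_rV R N).
Implicit Types (E : set 'rV[R]_N).

Lemma Lp_loc_bound E p (f u : 'rV[R]_N -> R) : open E -> 0 < p -> Lp_loc E p u ->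
  measurable_fun E f ->
  (forall K, compact K -> K `<=` E -> exists b c : R, [/\ 0 <= b, 0 <= c &
     {ae mu, forall x, K x -> `|f x| <= b + c * `|u x|}]) -> Lp_loc E p f.
Proof.
move=> oE p0 [mu_ uoo] mf bnd; split => // K cK KE.
have [b [c [b0 c0 fbc]]] := bnd K cK KE.
have mK := compact_measurable_rV cK; have mE := open_measurable_rV oE.
have muK : measurable_fun K (fun x => (`|u x| `^ p)%:E).
  apply/measurable_EFinP; apply: measurable_norm_powR; exact: measurable_funS mu_.
apply: (@le_lt_trans _ _ (\int[mu]_(x in K) ((2 `^ p * b `^ p)%:E + (2 `^ p * c `^ p)%:E * (`|u x| `^ p)%:E))%E).
  apply: ae_ge0_le_integral => //.
  - apply/measurable_EFinP; apply: measurable_norm_powR; exact: measurable_funS mf.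
  - by move=> x _; rewrite -EFinM -EFinD lee_fin addr_ge0// !mulr_ge0 ?powR_ge0.
  - by apply: emeasurable_funD => //; exact: emeasurable_funM.
  apply: filterS fbc => x H Kx; rewrite -EFinM -EFinD lee_fin.
  apply: (@le_trans _ _ ((b + c * `|u x|) `^ p)).
    by rewrite ge0_ler_powR ?nnegrE ?(ltW p0) ?addr_ge0 ?mulr_ge0 ?H.
  by rewrite -!mulrA -mulrDr -powRM// powR_le2D// mulr_ge0.
rewrite ge0_integralD//; last 3 first.
- by move=> x _; rewrite lee_fin mulr_ge0 ?powR_ge0.
- by move=> x _; rewrite -EFinM lee_fin !mulr_ge0 ?powR_ge0.
- exact: emeasurable_funM.
rewrite integral_cst// ge0_integralZl//; last by rewrite lee_fin mulr_ge0 ?powR_ge0.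
apply: lte_add_pinfty.
  by apply: lte_mul_pinfty; rewrite ?lee_fin ?mulr_ge0 ?powR_ge0//; exact: lebesgue_compact_lty.
by apply: lte_mul_pinfty; rewrite ?lee_fin ?mulr_ge0 ?powR_ge0//; exact: uoo.
Qed.

Lemma chain_rule E u Du (Phi a : R -> R) : open E -> weak_gradient E u Du ->
  subgradient Phi a -> {homo Phi : x y / x <= y} ->
  (forall K, compact K -> K `<=` E -> exists M : R, {ae mu, forall x, K x -> `|a (u x)| <= M}) ->
  Lp_loc E 1 (Phi \o u) -> weak_gradient E (Phi \o u) (fun x => a (u x) *: Du x).
Proof.
move=> oE uD sub nd bnd Phi1; have [u1 D1 _] := uD.
have ma := nondecreasing_measurableT (subgradient_nondecreasing sub).
have mPhi := nondecreasing_measurableT nd.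
have E1 i : (fun x => (a (u x) *: Du x) ord0 i) = (fun x => a (u x) * Du x ord0 i).
  by apply/funext => x; rewrite mxE.
have DPhi i : L1_derivative E (delta_mx ord0 i) (Phi \o u) (fun x => (a (u x) *: Du x) ord0 i).
  by rewrite E1; apply: (L1_chain_rule oE u1 (D1 i) _ sub ma bnd mPhi); exact: weak_gradient_L1.
apply: (L1_weak_gradient oE Phi1 _ DPhi) => i; rewrite E1.
apply: (Lp_loc_bound oE ltr01 (D1 i)).
  by apply: measurable_funM; [exact: measurableT_comp u1.1|exact: (D1 i).1].
move=> K cK KE; have [M aM] := bnd K cK KE; exists 0, `|M|; split => //.
apply: filterS aM => x H Kx; rewrite add0r normrM ler_wpM2r//.
by rewrite (le_trans (H Kx))// ler_norm.
Qed.
End chain_rule.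

(** * Dyadic decomposition of the slopes *)
Section slopes.
Context {R : realType} (p : R) (p1 : 1 < p).
Context (Phi b : R -> R) (sub : subgradient Phi b).
Hypothesis nd : {homo Phi : x y / x <= y}.
Hypothesis Phi0 : forall v, 0 <= Phi v.

Definition steep t : set R := [set v | t < b v].

(** The positive part of [v - k], where [k] is the point from which on the slope
    exceeds [t]; zero if the slope never does, when [inf] would be a default
    value. *)
Definition steep_part t v := if `[< steep t !=set0 >] then Num.max (v - inf (steep t)) 0 else 0.

Lemma steep_part_ge0 t v : 0 <= steep_part t v.
Proof. by rewrite /steep_part; case: ifP => _ //; rewrite le_max lexx orbT. Qed.

Lemma steep_part_lip t v w : w <= v -> steep_part t v <= steep_part t w + (v - w).
Proof.
move=> wv; rewrite /steep_part; case: ifP => _; last by rewrite add0r subr_ge0.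
rewrite ge_max; apply/andP; split.
  have : w - inf (steep t) <= Num.max (w - inf (steep t)) 0 by rewrite le_max lexx.
  by lra.
by rewrite addr_ge0 ?subr_ge0// le_max lexx orbT.
Qed.

(** A slope that exceeds [t] arbitrarily far to the left would make [Phi]
    negative there. *)
Lemma lbound_steep t : 0 < t -> lbound (steep t) (- (Phi 0 / t)).
Proof.
move=> t0 x /= tx; have h := sub x 0; have hx := Phi0 x; have h0 := Phi0 0.
have [x0|x0] := leP 0 x; first by rewrite (le_trans _ x0)// oppr_le0 divr_ge0// ltW.
rewrite lerNl ler_pdivlMr//; have : - x * t <= - x * b x by rewrite ler_wpM2l ?(ltW tx)// oppr_ge0 ltW.
by lra.
Qed.

Lemma steep_inf_le t v : 0 < t -> t < b v -> inf (steep t) <= v.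
Proof. by move=> t0 tv; apply: ge_inf => //; exists (- (Phi 0 / t)); exact: lbound_steep. Qed.

Lemma steep_gap t v : 0 < t -> steep t !=set0 -> inf (steep t) <= v ->
  t * (v - inf (steep t)) <= Phi v - Phi (inf (steep t)).
Proof.
move=> t0 S0; rewrite le_eqVlt => /predU1P[<-|kv]; first by rewrite !subrr mulr0.
set k := inf _ in kv *; apply/ler_addgt0Pl => e e0.
have hS : has_inf (steep t) by split => //; exists (- (Phi 0 / t)); exact: lbound_steep.
have : k < Num.min v (k + e / t) by rewrite lt_min kv ltrDl divr_gt0.
move=> /(inf_lt S0)[x /= tx]; rewrite lt_min => /andP[xv xk].
have kx : k <= x by exact: steep_inf_le.
have h := sub x v; have hn := nd kx.
have h1 : t * (v - x) <= b x * (v - x) by rewrite ler_wpM2r ?(ltW tx)// subr_ge0 ltW.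
have h2 : t * (x - k) <= e.
  by rewrite mulrC -ler_pdivlMr// lerBlDl ltW.
by lra.
Qed.

Lemma sum_dyadic_le (c : R) n : 0 < c -> \sum_(i < n) (c * 2 ^+ i / 2) <= c * 2 ^+ n / 2.
Proof.
move=> c0; elim: n => [|n IH]; first by rewrite big_ord0 divr_ge0 ?mulr_ge0 ?ltW.
rewrite big_ord_recr /= exprS; lra.
Qed.

(** By induction on [n]: to the right of the last threshold [k] all terms together
    have at most the slope [c * 2 ^+ n], one half from the last term and the other
    from the earlier ones, while [Phi] has a larger slope there; at [k] the last
    term vanishes. *)
Lemma sum_steep_part_le (c : R) n v : 0 < c ->
  \sum_(i < n) (c * 2 ^+ i / 2) * steep_part (c * 2 ^+ i) v <= Phi v.
Proof.
move=> c0; elim: n v => [|n IH] v; first by rewrite big_ord0.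
have t0 : 0 < c * 2 ^+ n by rewrite mulr_gt0// exprn_gt0.
rewrite big_ord_recr /= {2}/steep_part; case: ifPn => [/asboolP S0|_]; last by rewrite mulr0 addr0.
set k := inf _; have [vk|kv] := leP v k.
  by rewrite max_r ?subr_le0// mulr0 addr0.
rewrite max_l; last by rewrite subr_ge0 ltW.
have gap := steep_gap t0 S0 (ltW kv); rewrite -/k in gap.
have h : \sum_(i < n) (c * 2 ^+ i / 2) * steep_part (c * 2 ^+ i) v <=
    Phi k + (c * 2 ^+ n / 2) * (v - k).
  apply: (@le_trans _ _ (\sum_(i < n) (c * 2 ^+ i / 2) * (steep_part (c * 2 ^+ i) k + (v - k)))).
    apply: ler_sum => i _; rewrite ler_wpM2l ?steep_part_lip ?(ltW kv)//.
    by rewrite ltW// divr_gt0// mulr_gt0// exprn_gt0.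
  under eq_bigr do rewrite mulrDr.
  rewrite big_split /=; apply: lerD; first exact: (IH k).
  by rewrite -mulr_suml ler_wpM2r ?sum_dyadic_le// subr_ge0 ltW.
by lra.
Qed.

(** If [c * 2 ^+ i] is the largest height below [w], then [w] is at most twice this
    height. *)
Lemma powR_dyadic (c w : R) n : 0 < c -> 0 <= w -> w <= c * 2 ^+ n ->
  w `^ p <= c `^ p + \sum_(i < n) (2 * (c * 2 ^+ i)) `^ p * (c * 2 ^+ i < w)%R%:R.
Proof.
move=> c0 w0; have p0 : 0 <= p by rewrite ltW// (lt_trans _ p1).
elim: n => [|n IH] wn.
  rewrite big_ord0 addr0 ge0_ler_powR ?nnegrE ?(ltW c0)//.
  by rewrite expr0 mulr1 in wn.
have S0 : 0 <= \sum_(i < n) (2 * (c * 2 ^+ i)) `^ p * (c * 2 ^+ i < w)%R%:R.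
  by apply: sumr_ge0 => i _; rewrite mulr_ge0 ?powR_ge0.
rewrite big_ord_recr /=; have [wc|cw] := leP w (c * 2 ^+ n).
  by rewrite mulr0 addr0; exact: IH.
rewrite mulr1; have : w `^ p <= (2 * (c * 2 ^+ n)) `^ p.
  rewrite ge0_ler_powR ?nnegrE//; first by rewrite !mulr_ge0 ?exprn_ge0 ?ltW.
  by rewrite mulrCA -exprS.
have := powR_ge0 c p; lra.
Qed.
End slopes.

(** * The energy estimate for convex functions of [u] *)
Section energy.
Context {R : realType} {N : nat}.
Local Notation mu := (@lebesgue_rV R N).
Context (E : set 'rV[R]_N) (p gamma : R) (u : 'rV[R]_N -> R) (Du : 'rV[R]_N -> 'rV[R]_N).
Hypothesis oE : open E.
Hypothesis p1 : 1 < p.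
Hypothesis gamma0 : 0 < gamma.
Hypothesis uDG : DG_plus E p gamma u.
Hypothesis uD : weak_gradient E u Du.
Hypothesis Dup : forall i, Lp_loc E p (fun x => Du x ord0 i).

Let p0 : 0 < p. Proof. exact: lt_trans p1. Qed.
Let mE : measurable E. Proof. exact: open_measurable_rV. Qed.
Let mu_ : measurable_fun E u. Proof. by have [[[]]] := uDG. Qed.

Let G x := enorm (Du x) `^ p.
Let G0 x : 0 <= G x. Proof. exact: powR_ge0. Qed.

Let mG : measurable_fun E G.
Proof.
apply: (measurableT_comp (measurable_powR p)); apply: measurable_enorm => i.
exact: (Dup i).1.
Qed.

Lemma gradient_lty K : compact K -> K `<=` E -> (\int[mu]_(x in K) (G x)%:E < +oo)%E.
Proof.
move=> cK KE; have mK := compact_measurable_rV cK.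
pose C := (2 `^ p) ^+ size (index_enum 'I_N).
have C0 : 0 <= C by rewrite exprn_ge0// powR_ge0.
have mDp i : measurable_fun K (fun x => (`|Du x ord0 i| `^ p)%:E).
  apply/measurable_EFinP; apply: measurable_norm_powR.
  by apply: measurable_funS (Dup i).1.
apply: (@le_lt_trans _ _ (\int[mu]_(x in K) (C%:E * \sum_i (`|Du x ord0 i| `^ p)%:E))%E).
  apply: ge0_le_integral.
  - exact: mK.
  - by move=> x _; rewrite lee_fin.
  - by apply/measurable_EFinP; exact: measurable_funS mG.
  - by apply: emeasurable_funM => //; exact: emeasurable_sum.
  - move=> x _; rewrite sumEFin -EFinM lee_fin.
    apply: le_trans (powR_sum_le p1 _ _) => //.
    by rewrite ge0_ler_powR ?nnegrE ?(ltW p0) ?enorm_ge0 ?enorm_le_sum ?sumr_ge0.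
rewrite ge0_integralZl//; last 2 first.
- exact: emeasurable_sum.
- by move=> x _; apply: sume_ge0 => i _; rewrite lee_fin powR_ge0.
rewrite ge0_integral_sum//.
apply: lte_mul_pinfty => //; apply: lte_sum_pinfty => i _.
exact: (Dup i).2.
Qed.

(** Weak gradients are unique, so that the gradient of [(u - k)^\+] is that of
    [u] on the set where [k <= u]. *)
Lemma level_energy k y r s : 0 < r -> r < s -> cube y s `<=` E ->
  (\int[mu]_(x in cube y r) ((k <= u x)%R%:R * G x)%:E <=
   (gamma / (s - r) `^ p)%:E * uenergy p u y s k)%E.
Proof.
move=> r0 rs sE; have [Dw [wD HD]] := upart_energy uDG k.
pose a v : R := (k <= v)%R%:R.
have sub := subgradient_upart k.
have [w1 Dw1 wDw] := wD.
have wD2 : weak_gradient E (upart u k) (fun x => a (u x) *: Du x).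
  apply: (chain_rule oE uD sub (upart_nondecreasing k)) => //.
  by move=> K cK KE; exists 1; apply: nearW => x _; case: (k <= u x); rewrite ?normr1 ?normr0.
have [_ Da1 wDa] := wD2.
pose c := y - const_mx r; pose d := y + const_mx r.
have cd : cube y r = obox c d by rewrite cube_obox.
have CE : cbox c d `<=` E.
  apply: subset_trans sE => x xc j; have := xc j; rewrite !mxE => /andP[x1 x2].
  rewrite ltr_norml; apply/andP; split; lra.
have rE : cube y r `<=` E by apply: subset_trans sE; apply: le_cube; exact: ltW.
have mr := measurable_cube y r.
have intO (f : 'rV[R]_N -> R) : Lp_loc E 1 f -> mu.-integrable (obox c d) (EFin \o f).
  move=> f1; apply: integrableS (Lp_loc1_integrable oE f1 (@compact_cbox _ _ c d) CE).
  - exact: compact_measurable_rV (@compact_cbox _ _ c d).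
  - exact: measurable_obox.
  - exact: sub_obox_cbox.
(* both are weak gradients of [(u - k)^\+], by the class and by the chain rule *)
have key i : {ae mu, forall x, obox c d x -> Dw x ord0 i = (a (u x) *: Du x) ord0 i}.
  have : ae_eq mu (obox c d) (EFin \o (fun x => Dw x ord0 i)) (EFin \o (fun x => (a (u x) *: Du x) ord0 i)).
    apply: (@test_function_ae_eq R N E c d _ _ CE (intO _ (Dw1 i)) (intO _ (Da1 i))) => z tz z0.
    have zE x : ~ E x -> z x = 0.
      by move=> nE; apply: z0 => ox; apply: nE; apply: CE; exact: sub_obox_cbox.
    have zI (f : 'rV[R]_N -> R) : (\int[mu]_(x in obox c d) (f x * z x)%:E = \int[mu]_(x in E) (f x * z x)%:E)%E.
      by rewrite (integral_support f z0) (integral_support f zE).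
    apply: etrans (zI (fun x => Dw x ord0 i)) _; apply: etrans (esym (zI _)).
    by apply: oppe_inj; rewrite -wDw// -wDa.
  by apply: filterS => x H ox; have [] := H ox.
have {}key : {ae mu, forall x, cube y r x -> Dw x = a (u x) *: Du x}.
  have {}key : {ae mu, forall x i, obox c d x -> Dw x ord0 i = (a (u x) *: Du x) ord0 i}.
    exact: filter_forall.
  apply: filterS key => x H; rewrite cd => ox.
  by apply/rowP => i; exact: H.
apply: le_trans (HD y r s r0 rs sE).
apply: ae_ge0_le_integral => //.
- by move=> x _; rewrite lee_fin mulr_ge0.
- apply/measurable_EFinP; apply: measurable_funM; last exact: measurable_funS mG.
  apply: (measurableT_comp (f := a)); last exact: measurable_funS mu_.
  exact: nondecreasing_measurableT (subgradient_nondecreasing sub).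
- by move=> x _; rewrite lee_fin powR_ge0.
- apply/measurable_EFinP; apply: (measurableT_comp (measurable_powR p)).
  by apply: measurable_enorm => i; apply: measurable_funS (Dw1 i).1.
apply: filterS key => x H cx; rewrite lee_fin (H cx) enormZ powRM ?enorm_ge0// ler_wpM2r//.
by rewrite /a; case: (k <= u x); rewrite ?normr1 ?powR1// powR_ge0.
Qed.

Context (Phi b : R -> R) (sub : subgradient Phi b).
Hypothesis nd : {homo Phi : x y / x <= y}.
Hypothesis Phi0 : forall v, 0 <= Phi v.

Let b0 v : 0 <= b v. Proof. exact: subgradient_ge0 sub nd v. Qed.

(** [b (u)] exceeds [t] only above the threshold of [steep_part]. *)
Lemma steep_energy t y r s : 0 < t -> 0 < r -> r < s -> cube y s `<=` E ->
  (\int[mu]_(x in cube y r) ((t < b (u x))%R%:R * G x)%:E <=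
   (gamma / (s - r) `^ p)%:E * \int[mu]_(x in cube y s) (steep_part b t (u x) `^ p)%:E)%E.
Proof.
move=> t0 r0 rs sE.
have [S0|nS] := pselect (steep b t !=set0); last first.
  rewrite integral0_eq; last first.
    move=> x _; rewrite (_ : (t < b (u x)) = false) ?mul0r//; apply/negP => tb.
    by apply: nS; exists (u x).
  rewrite mule_ge0 ?lee_fin ?divr_ge0 ?powR_ge0 ?(ltW gamma0)//.
  by apply: integral_ge0 => x _; rewrite lee_fin powR_ge0.
set k := inf (steep b t).
have -> : (\int[mu]_(x in cube y s) (steep_part b t (u x) `^ p)%:E = uenergy p u y s k)%E.
  by apply: eq_integral => x _; rewrite /steep_part asboolT.
apply: le_trans (level_energy k r0 rs sE).
have rE : cube y r `<=` E by apply: subset_trans sE; apply: le_cube; exact: ltW.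
have mr := measurable_cube y r.
have mb := nondecreasing_measurableT (subgradient_nondecreasing sub).
have muR : measurable_fun (cube y r) u by exact: measurable_funS mu_.
have mGR : measurable_fun (cube y r) G by exact: measurable_funS mG.
apply: ge0_le_integral.
- exact: mr.
- by move=> x _; rewrite lee_fin mulr_ge0.
- apply/measurable_EFinP; apply: measurable_funM => //.
  apply: (measurableT_comp (f := fun v : R => (t < v)%R%:R : R)); last exact: measurableT_comp.
  apply: nondecreasing_measurableT => v w vw; rewrite ler_nat.
  by have [tv|//] := ltP t v; rewrite (lt_le_trans tv).
- apply/measurable_EFinP; apply: measurable_funM => //.
  apply: (measurableT_comp (f := fun v : R => (k <= v)%R%:R : R)) => //.
  exact: nondecreasing_measurableT (subgradient_nondecreasing (subgradient_upart k)).
- move=> x _; rewrite lee_fin ler_wpM2r// ler_nat.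
  have [tb|//] := ltP t (b (u x)).
  by rewrite (steep_inf_le sub Phi0 t0 tb).
Qed.

(** Sum of the estimates [steep_energy] over the dyadic heights up to the bound of
    [b (u)] on the smaller cube.  The factor [4] is the quotient of the coefficients
    [2 c 2^i] of [powR_dyadic] and [c 2^i / 2] of [sum_steep_part_le]; the height
    [c] is chosen so that the remainder [c^p] costs at most [e]. *)
Lemma energy_subgradient y r s : 0 < r -> r < s -> cube y s `<=` E ->
  (\int[mu]_(x in cube y r) (b (u x) `^ p * G x)%:E <=
   (4 `^ p * gamma / (s - r) `^ p)%:E * \int[mu]_(x in cube y s) (Phi (u x) `^ p)%:E)%E.
Proof.
move=> r0 rs sE.
have [M uM] := local_bound oE p1 gamma0 uDG r0 rs sE.
have rE : cube y r `<=` E by apply: subset_trans sE; apply: le_cube; exact: ltW.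
have mr := measurable_cube y r; have ms := measurable_cube y s.
have mb := nondecreasing_measurableT (subgradient_nondecreasing sub).
have mPhi := nondecreasing_measurableT nd.
have muR : measurable_fun (cube y r) u by exact: measurable_funS mu_.
have muS : measurable_fun (cube y s) u by exact: measurable_funS mu_.
have mGR : measurable_fun (cube y r) G by exact: measurable_funS mG.
set B := (\int[mu]_(x in cube y s) _)%E.
pose X := (\int[mu]_(x in cube y r) (G x)%:E)%E.
have X0 : (0 <= X)%E by apply: integral_ge0 => x _; rewrite lee_fin.
have Xoo : (X < +oo)%E.
  have cE : ccube y r `<=` E by apply: subset_trans sE; exact: ccube_sub.
  apply: le_lt_trans (gradient_lty (@compact_ccube _ _ y r) cE).
  apply: ge0_subset_integral.
  - exact: mr.
  - exact: measurable_ccube.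
  - apply/measurable_EFinP; apply: measurable_funS mG => //.
  - by move=> x _; rewrite lee_fin.
  - exact: sub_ccube.
have XE : X = (fine X)%:E by rewrite fineK// ge0_fin_numE.
have x0 : 0 <= fine X by rewrite fine_ge0.
have kap0 : 0 <= gamma / (s - r) `^ p by rewrite divr_ge0 ?powR_ge0// ltW.
apply/lee_addgt0Pr => e e0.
pose c := (e / (fine X + 1)) `^ p^-1.
have X1 : 0 < fine X + 1 by rewrite ltr_wpDl.
have c0 : 0 < c by rewrite powR_gt0// divr_gt0.
have cX : ((c `^ p)%:E * X <= e%:E)%E.
  rewrite XE -EFinM lee_fin /c -powRrM mulVf ?gt_eqF// powRr1 ?divr_ge0 ?(ltW e0) ?(ltW X1)//.
  by rewrite mulrAC ler_pdivrMr// ler_wpM2l ?(ltW e0)// lerDl.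
have [n Mn] : exists n, b M <= c * 2 ^+ n.
  exists (Num.bound (b M / c)); rewrite -ler_pdivrMl// mulrC.
  apply: (@le_trans _ _ (Num.bound (b M / c))%:R); first by rewrite ltW// archi_boundP// divr_ge0// ltW.
  by rewrite -natrX ler_nat ltnW// ltn_expl.
pose ci (i : 'I_n) := c * 2 ^+ i.
have ci0 i : 0 < ci i by rewrite mulr_gt0// exprn_gt0.
have mind i : measurable_fun (cube y r) (fun x => ((ci i < b (u x))%R%:R * G x)%:E).
  apply/measurable_EFinP; apply: measurable_funM => //.
  apply: (measurableT_comp (f := fun v : R => (ci i < v)%R%:R : R)); last exact: measurableT_comp.
  apply: nondecreasing_measurableT => v w vw; rewrite ler_nat.
  by have [tv|//] := ltP (ci i) v; rewrite (lt_le_trans tv).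
apply: (@le_trans _ _ (\int[mu]_(x in cube y r) ((c `^ p)%:E * (G x)%:E +
    \sum_(i < n) ((2 * ci i) `^ p)%:E * ((ci i < b (u x))%R%:R * G x)%:E))%E).
  apply: ae_ge0_le_integral => //.
  - by move=> x _; rewrite lee_fin mulr_ge0// powR_ge0.
  - apply/measurable_EFinP; apply: measurable_funM => //.
    apply: (measurableT_comp (measurable_powR p)); exact: measurableT_comp.
  - move=> x _; apply: adde_ge0; first by rewrite -EFinM lee_fin mulr_ge0 ?powR_ge0.
    by apply: sume_ge0 => i _; rewrite -EFinM lee_fin !mulr_ge0 ?powR_ge0.
  - apply: emeasurable_funD; first by apply: emeasurable_funM => //; exact/measurable_EFinP.
    by apply: emeasurable_sum => i; exact: emeasurable_funM.
  apply: filterS uM => x H cx.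
  under eq_bigr do rewrite -EFinM mulrA; rewrite sumEFin -EFinM -EFinD lee_fin -mulr_suml -mulrDl.
  rewrite ler_wpM2r//; apply: powR_dyadic => //.
  by apply: le_trans Mn; apply: (subgradient_nondecreasing sub); exact: H.
have nnG x : (0 <= (G x)%:E)%E by rewrite lee_fin.
have nnI i x : (0 <= ((2 * ci i) `^ p)%:E * ((ci i < b (u x))%R%:R * G x)%:E)%E.
  by rewrite -EFinM lee_fin !mulr_ge0 ?powR_ge0.
rewrite ge0_integralD; [|exact: mr|by move=> x _; rewrite mule_ge0 ?lee_fin ?powR_ge0| | |]; last 3 first.
- by apply: emeasurable_funM => //; exact/measurable_EFinP.
- by move=> x _; apply: sume_ge0 => i _; exact: nnI.
- by apply: emeasurable_sum => i; exact: emeasurable_funM.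
rewrite addeC; apply: leeD; last first.
  rewrite ge0_integralZl//; first exact/measurable_EFinP.
  by rewrite lee_fin powR_ge0.
rewrite ge0_integral_sum//; last by move=> i; exact: emeasurable_funM.
pose L i := (\int[mu]_(x in cube y s) (steep_part b (ci i) (u x) `^ p)%:E)%E.
have L0 i : (0 <= L i)%E by apply: integral_ge0 => x _; rewrite lee_fin powR_ge0.
apply: (@le_trans _ _ (\sum_(i < n) ((2 * ci i) `^ p)%:E * ((gamma / (s - r) `^ p)%:E * L i))%E).
  apply: lee_sum => i _; rewrite ge0_integralZl//; last 2 first.
  - by move=> x _; rewrite lee_fin mulr_ge0.
  - by rewrite lee_fin powR_ge0.
  by apply: lee_wpmul2l; [rewrite lee_fin powR_ge0|exact: steep_energy].
under eq_bigr do rewrite muleCA.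
rewrite -ge0_sume_distrr; last by move=> i _; apply: mule_ge0; [rewrite lee_fin powR_ge0|exact: L0].
have -> : 4 `^ p * gamma / (s - r) `^ p = gamma / (s - r) `^ p * 4 `^ p by ring.
rewrite [X in (_ <= X * B)%E]EFinM -[X in (_ <= X)%E]muleA.
apply: lee_wpmul2l; first by rewrite lee_fin.
have mst i : measurable_fun (cube y s) (fun x => (steep_part b (ci i) (u x) `^ p)%:E).
  apply/measurable_EFinP; apply: (measurableT_comp (measurable_powR p)).
  apply: (measurableT_comp (f := steep_part b (ci i))) => //.
  apply: nondecreasing_measurableT => v w vw; rewrite /steep_part; case: ifP => // _.
  exact: upart_nondecreasing.
rewrite /B -ge0_integralZl//; last 2 first.
- by apply/measurable_EFinP; apply: (measurableT_comp (measurable_powR p)); exact: measurableT_comp.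
- by move=> x _; rewrite lee_fin powR_ge0.
have -> : (\sum_(i < n) ((2 * ci i) `^ p)%:E * L i =
   \int[mu]_(x in cube y s) \sum_(i < n) ((2 * ci i) `^ p)%:E * (steep_part b (ci i) (u x) `^ p)%:E)%E.
  rewrite ge0_integral_sum//; last 2 first.
  - by move=> i; exact: emeasurable_funM.
  - by move=> i x _; rewrite -EFinM lee_fin mulr_ge0 ?powR_ge0.
  apply: eq_bigr => i _; rewrite ge0_integralZl// ?lee_fin ?powR_ge0//.
  by move=> x _; rewrite lee_fin powR_ge0.
apply: ge0_le_integral.
- exact: ms.
- by move=> x _; apply: sume_ge0 => i _; rewrite -EFinM lee_fin mulr_ge0 ?powR_ge0.
- by apply: emeasurable_sum => i; exact: emeasurable_funM.
- apply: emeasurable_funM => //.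
  by apply/measurable_EFinP; apply: (measurableT_comp (measurable_powR p)); exact: measurableT_comp.
- move=> x _; under eq_bigr do rewrite -EFinM; rewrite sumEFin -EFinM lee_fin.
  have E1 i : (2 * ci i) `^ p * steep_part b (ci i) (u x) `^ p =
      4 `^ p * (ci i / 2 * steep_part b (ci i) (u x)) `^ p.
    have c2 : 0 <= ci i / 2 * steep_part b (ci i) (u x).
      by rewrite mulr_ge0 ?steep_part_ge0// divr_ge0// ltW.
    have c3 : 0 <= 2 * ci i by rewrite mulr_ge0// ltW.
    rewrite -(powRM _ c3 (steep_part_ge0 b (ci i) (u x))) -(powRM _ _ c2)//.
    by congr (_ `^ p); field.
  under eq_bigr do rewrite E1; rewrite -mulr_sumr ler_wpM2l ?powR_ge0//.
  apply: le_trans (sum_powR_le p1 _) _.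
    by move=> i; rewrite mulr_ge0 ?steep_part_ge0// divr_ge0// ltW.
  rewrite ge0_ler_powR ?nnegrE ?(ltW p0)//.
    by apply: sumr_ge0 => i _; rewrite mulr_ge0 ?steep_part_ge0// divr_ge0// ltW.
  exact: sum_steep_part_le.
Qed.
End energy.

(** * Composition with convex and concave functions *)
Section convex_composition.
Context {R : realType} {N : nat}.
Local Notation mu := (@lebesgue_rV R N).
Context (E : set 'rV[R]_N) (p gamma : R) (u : 'rV[R]_N -> R).
Hypothesis oE : open E.
Hypothesis p1 : 1 < p.
Hypothesis gamma0 : 0 < gamma.
Hypothesis uDG : DG_plus E p gamma u.

Let p0 : 0 < p. Proof. exact: lt_trans p1. Qed.

Lemma slope_bounded (Phi a : R -> R) : subgradient Phi a -> {homo Phi : x y / x <= y} ->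
  forall K, compact K -> K `<=` E -> exists M : R, {ae mu, forall x, K x -> `|a (u x)| <= M}.
Proof.
move=> sub nd K cK KE; have [M uM] := local_bound_compact oE p1 gamma0 uDG cK KE.
exists (a M); apply: filterS uM => x H Kx.
rewrite ger0_norm ?(subgradient_ge0 sub nd)//.
by apply: (subgradient_nondecreasing sub); exact: H.
Qed.

Lemma Lp_loc_slope (Phi a : R -> R) q f : 0 < q -> subgradient Phi a ->
  {homo Phi : x y / x <= y} -> Lp_loc E q f -> Lp_loc E q (fun x => a (u x) * f x).
Proof.
move=> q0 sub nd fq; apply: (Lp_loc_bound oE q0 fq).
  apply: measurable_funM; last exact: fq.1.
  apply: (measurableT_comp (nondecreasing_measurableT (subgradient_nondecreasing sub))).
  by have [[[]]] := uDG.
move=> K cK KE; have [M aM] := slope_bounded sub nd cK KE; exists 0, `|M|; split => //.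
apply: filterS aM => x H Kx; rewrite add0r normrM ler_wpM2r//.
by rewrite (le_trans (H Kx))// ler_norm.
Qed.

(** A monotone convex function is bounded below by its supporting line at [0], and
    from above by its value at the local upper bound of [u]. *)
Lemma Lp_loc_convex (Phi a : R -> R) q : 0 < q -> subgradient Phi a ->
  {homo Phi : x y / x <= y} -> Lp_loc E q u -> Lp_loc E q (Phi \o u).
Proof.
move=> q0 sub nd uq; apply: (Lp_loc_bound oE q0 uq).
  by apply: (measurableT_comp (nondecreasing_measurableT nd)); exact: uq.1.
move=> K cK KE; have [M uM] := local_bound_compact oE p1 gamma0 uDG cK KE.
have a0 : 0 <= a 0 by exact: subgradient_ge0 sub nd 0.
exists (`|Phi M| + `|Phi 0|), (a 0); split => //.
apply: filterS uM => x H Kx /=; have h1 := nd _ _ (H Kx); have h2 := sub 0 (u x).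
have h3 : - (a 0 * u x) <= a 0 * `|u x|.
  by rewrite -mulrN ler_wpM2l// -normrN ler_norm.
have h4 := ler_norm (Phi M); have h5 := ler_norm (- Phi 0); rewrite normrN in h5.
have h6 := normr_ge0 (Phi M); have h7 := normr_ge0 (Phi 0).
have h8 : 0 <= a 0 * `|u x| by exact: mulr_ge0.
rewrite subr0 in h2; rewrite ler_norml; apply/andP; split; lra.
Qed.

Lemma weak_gradient_convex Du (Phi a : R -> R) : weak_gradient E u Du -> subgradient Phi a ->
  {homo Phi : x y / x <= y} -> weak_gradient E (Phi \o u) (fun x => a (u x) *: Du x).
Proof.
move=> uD sub nd; have [u1 _ _] := uD.
apply: (chain_rule oE uD sub nd (slope_bounded sub nd)).
exact: (Lp_loc_convex ltr01 sub nd u1).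
Qed.

Lemma DG_GDG_const (c r s : R) : 0 <= c -> 0 < r -> r < s ->
  c / (s - r) `^ p <= GDG_const N p c r s.
Proof.
move=> c0 r0 rs; have sr : 0 < s - r by rewrite subr_gt0.
rewrite /GDG_const ler_peMr ?divr_ge0 ?powR_ge0//.
rewrite -[leLHS](powRr0 (s / (s - r))) ler_powR ?mulr_ge0 ?(ltW p0)//.
by rewrite ler_pdivlMr// mul1r gerBl ltW.
Qed.

Lemma GDG_plus_convex (phi : R -> R) : convex_function [set: R^o] phi ->
  {homo phi : x y / x <= y} -> GDG_plus E p (4 `^ p * gamma) (phi \o u).
Proof.
move=> cphi nd; have [a sub] := convex_subgradient cphi.
have [[up [Du uD Dup]] _] := uDG.
split.
  split; first exact: (Lp_loc_convex p0 sub nd up).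
  exists (fun x => a (u x) *: Du x); first exact: weak_gradient_convex.
  move=> i; have := Lp_loc_slope p0 sub nd (Dup i).
  by congr (Lp_loc _ _ _); apply/funext => x; rewrite mxE.
move=> h; pose Phi v := Num.max (phi v - h) 0.
have subh := subgradient_trunc h sub; have ndh := trunc_nondecreasing h nd.
have Phi0 v : 0 <= Phi v by rewrite /Phi le_max lexx orbT.
set b := (fun v => if h < phi v then a v else 0) in subh.
exists (fun x => b (u x) *: Du x); first exact: (weak_gradient_convex uD subh ndh).
move=> y r s r0 rs sE.
have g0 : 0 <= 4 `^ p * gamma by rewrite mulr_ge0 ?powR_ge0// ltW.
have -> : (\int[mu]_(x in cube y r) (enorm (b (u x) *: Du x) `^ p)%:E =
    \int[mu]_(x in cube y r) (b (u x) `^ p * enorm (Du x) `^ p)%:E)%E.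
  apply: eq_integral => x _; have b0 := subgradient_ge0 subh ndh (u x).
  by rewrite enormZ ger0_norm// powRM// enorm_ge0.
apply: le_trans (energy_subgradient oE p1 gamma0 uDG uD Dup subh ndh Phi0 r0 rs sE) _.
have -> : (\int[mu]_(x in cube y s) (`|((fun x => (phi \o u) x - h)^\+)%R x| `^ p)%:E =
    \int[mu]_(x in cube y s) (Phi (u x) `^ p)%:E)%E.
  by apply: eq_integral => x _; rewrite ger0_norm ?funrpos_ge0.
apply: lee_wpmul2r; last by rewrite lee_fin DG_GDG_const.
by apply: integral_ge0 => x _; rewrite lee_fin powR_ge0.
Qed.
End convex_composition.

Section opposite.
Context {R : realType} {N : nat}.
Implicit Types (E : set 'rV[R]_N) (f z : 'rV[R]_N -> R).

Lemma Lp_loc_opp E p f : Lp_loc E p f -> Lp_loc E p (fun x => - f x).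
Proof.
move=> [mf foo]; split=> [|K cK KE]; first exact: measurableT_comp.
by under eq_integral do rewrite normrN; exact: foo.
Qed.

Lemma Ck_opp k z : Ck k z -> Ck k (fun x => - z x).
Proof.
elim: k z => [|k IH] z /=; first by move=> cz x; apply: continuousN; exact: cz.
move=> [cz dz]; split=> [x|i]; first by apply: continuousN; exact: cz.
have [dzi Ckz] := dz i; split => [x|]; first exact: derivableN.
rewrite (_ : partial i (fun x => - z x) = fun x => - partial i z x); first exact: IH.
by apply/funext => x; rewrite /partial deriveN.
Qed.

Lemma test_function_opp E z : test_function E z -> test_function E (fun x => - z x).
Proof.
move=> [Cz [K [cK KE zK]]]; split=> [k|]; first exact: Ck_opp.
by exists K; split => // x nK; rewrite zK// oppr0.
Qed.

(** The sign is passed on to the test function. *)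
Lemma weak_gradient_opp E w (Dw : 'rV[R]_N -> 'rV[R]_N) : weak_gradient E w Dw ->
  weak_gradient E (fun x => - w x) (fun x => - Dw x).
Proof.
move=> [w1 D1 wD]; split.
- exact: Lp_loc_opp.
- move=> i; have := Lp_loc_opp (D1 i).
  by congr (Lp_loc _ _ _); apply/funext => x; rewrite mxE.
move=> z tz i; have := wD _ (test_function_opp tz) i.
have -> : (\int[lebesgue_rV]_(x in E) (w x * partial i (fun x => - z x) x)%:E =
    \int[lebesgue_rV]_(x in E) (- w x * partial i z x)%:E)%E.
  apply: eq_integral => x _; rewrite /partial deriveN ?mulrN ?mulNr//.
  exact: test_function_derivable tz.
move=> ->; congr (- _)%E.
by apply: eq_integral => x _; rewrite mxE mulrN mulNr.
Qed.

Lemma W1p_loc_opp E p f : W1p_loc E p f -> W1p_loc E p (fun x => - f x).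
Proof.
move=> [fp [Df fD Dp]]; split; first exact: Lp_loc_opp.
exists (fun x => - Df x); first exact: weak_gradient_opp.
move=> i; have := Lp_loc_opp (Dp i).
by congr (Lp_loc _ _ _); apply/funext => x; rewrite mxE.
Qed.

Lemma funrneg_opp f (k : R) :
  (fun x => f x - k)^\- = (fun x => - f x - - k)^\+ :> ('rV[R]_N -> R).
Proof. by apply/funext => x; rewrite /funrneg /funrpos opprB opprK addrC. Qed.

Lemma DG_plus_opp E p gamma f : DG_minus E p gamma f -> DG_plus E p gamma (fun x => - f x).
Proof.
move=> [fW fE]; split => [|k]; first exact: W1p_loc_opp.
by have := fE (- k); rewrite funrneg_opp opprK.
Qed.

Lemma GDG_minus_opp E p gamma f : GDG_plus E p gamma (fun x => - f x) -> GDG_minus E p gamma f.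
Proof.
move=> [fW fE]; split => [|k].
  have := W1p_loc_opp fW; congr (W1p_loc _ _ _).
  by apply/funext => x; rewrite opprK.
by rewrite funrneg_opp.
Qed.
End opposite.

Lemma concave_opp (R : realType) (psi : R -> R) : concave_function psi ->
  convex_function [set: R^o] (fun x => - psi (- x)).
Proof.
move=> cpsi t x y _ _; have h := cpsi t (- x) (- y).
pose s : R := t%:inum.
have {}h : s * psi (- x) + (1 - s) * psi (- y) <= psi (s * - x + (1 - s) * - y) by exact: h.
suff : - psi (- (s * x + (1 - s) * y)) <= s * - psi (- x) + (1 - s) * - psi (- y) by [].
have -> : - (s * x + (1 - s) * y) = s * - x + (1 - s) * - y by rewrite !mulrN opprD.
have -> : s * - psi (- x) + (1 - s) * - psi (- y) = - (s * psi (- x) + (1 - s) * psi (- y)).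
  by rewrite !mulrN opprD.
by rewrite lerN2.
Qed.

Theorem lemma2p1 (R : realType) (N : nat) (p gamma : R) :
  (0 < N)%N -> 1 < p -> 0 < gamma ->
  (exists2 gamma' : R, 0 < gamma' &
     forall (E : set 'rV[R]_N) (phi : R -> R) (u : 'rV[R]_N -> R),
       open E ->
       convex_function [set: R^o] phi -> {homo phi : x y / x <= y} ->
       DG_plus E p gamma u -> GDG_plus E p gamma' (phi \o u)) /\
  (exists2 gamma' : R, 0 < gamma' &
     forall (E : set 'rV[R]_N) (psi : R -> R) (u : 'rV[R]_N -> R),
       open E ->
       concave_function psi -> {homo psi : x y / x <= y} ->
       DG_minus E p gamma u -> GDG_minus E p gamma' (psi \o u)).
Proof.
move=> _ p1 gamma0; have g0 : 0 < 4 `^ p * gamma by rewrite mulr_gt0// powR_gt0.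
split; (exists (4 `^ p * gamma); first exact: g0).
  by move=> E phi u oE cphi nd uDG; exact: GDG_plus_convex.
move=> E psi u oE cpsi nd uDG; apply: GDG_minus_opp.
have := @GDG_plus_convex R N E p gamma _ oE p1 gamma0 (DG_plus_opp uDG) _ (concave_opp cpsi).
have nd' : {homo (fun x => - psi (- x)) : x y / x <= y}.
  by move=> x y xy; rewrite lerN2 nd// lerN2.
move=> /(_ nd'); congr (GDG_plus _ _ _ _).
by apply/funext => x; rewrite /= opprK.
Qed.
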